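(* Let $\equiv$ be a simple essential lattice congruence of the weak order on $\mathfrak{S}_n$. Then the contraction poset on $\equiv$-admissible Schröder separating trees is isomorphic to the poset of nonempty faces (ordered by inclusion) of the quotientope of $\equiv$, or equivalently to the set of cones of the quotient fan $\mathcal{F}_\equiv$ ordered by reverse inclusion.
   Context: Notation: $[n]=\{1,\dots,n\}$ and $]i,j[\,=\{i+1,\dots,j-1\}$ for $i<j$. The weak order on the permutations $\mathfrak{S}_n$ of $[n]$ is the lattice defined by $\sigma\le\tau$ iff $\mathrm{inv}(\sigma)\subseteq\mathrm{inv}(\tau)$, where $\mathrm{inv}(\sigma)=\{(\sigma_p,\sigma_q) : p<q,\ \sigma_p>\sigma_q\}$. A lattice congruence is an equivalence relation $\equiv$ on $\mathfrak{S}_n$ compatible with meets and joins; its classes are intervals. Arcs. An arc is a quadruple $(i,j,A,B)$ with $1\le i<j\le n$ and $A\sqcup B={]i,j[}$; $\mathcal{A}_n$ is the set of all arcs. The up arc is $u(i,j)=(i,j,]i,j[,\varnothing)$ and the down arc is $d(i,j)=(i,j,\varnothing,]i,j[)$. The arc $(i,j,A,B)$ is a subarc of $(i',j',A',B')$ if $i'\le i<j\le j'$, $A\subseteq A'$ and $B\subseteq B'$. For an arc $\alpha=(i,j,A,B)$ let $\sigma_\alpha$ be the permutation with a single descent whose one-line notation is $1,\dots,i-1$, then the elements of $A$ in increasing order, then $j$, then $i$, then the elements of $B$ in increasing order, then $j+1,\dots,n$. For a lattice congruence $\equiv$, let $\mathcal{A}_\equiv$ be the set of arcs $\alpha$ such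 that $\sigma_\alpha$ is the minimum of its $\equiv$-class. (The map $\equiv\ \mapsto\mathcal{A}_\equiv$ is a bijection from the lattice congruences of the weak order on $\mathfrak{S}_n$ to the subsets of $\mathcal{A}_n$ closed under taking subarcs.) The congruence $\equiv$ is essential if $\mathcal{A}_\equiv$ contains all arcs $(i,i+1,\varnothing,\varnothing)$, $i\in[n-1]$. It is simple if every arc of $\mathcal{A}_n\setminus\mathcal{A}_\equiv$ having no strict subarc in $\mathcal{A}_n\setminus\mathcal{A}_\equiv$ is an up arc or a down arc. Quotient fan and quotientope. For a permutation $\sigma$, let $C(\sigma)=\{x\in\mathbb{R}^n : x_{\sigma_1}\le\dots\le x_{\sigma_n}\}$. The quotient fan $\mathcal{F}_\equiv$ is the complete fan in $\mathbb{R}^n$ whose maximal cones are the unions $\bigcup_{\sigma\in X}C(\sigma)$ over the $\equiv$-classes $X$ (and whose cones are all the faces of these). A quotientope of $\equiv$ is a polytope whose normal fan is $\mathcal{F}_\equiv$ (such a polytope is known to exist). Schröder separating trees. In a directed tree $S$ (an orientation of a tree) whose nodes are the parts of a set partition of $[n]$, the parents (resp. children) of a node $J$ are the targets of its outgoing edges (resp. the sources of its incoming edges), and the ancestor (resp. descendant) subtrees of $J$ are the connected components of $S\setminus J$ containing its parents (resp. children). A Schröder separating tree is a directed tree on the parts of a set partition of $[n]$ such that any two distinct ancestor (resp. descendant) subtrees of a node $J$ are separated by some integer $j\in J$, meaning that all integers appearing in nodes of one of the two subtrees are smaller than $j$ while all integers appearing in nodes of the other are larger than $j$. For subtrees, $L<R$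 means that every integer appearing in $L$ is smaller than every integer appearing in $R$, and $\max L$, $\min R$ refer to these integers. Contraction. The contraction of an edge $e$ in a Schröder separating tree is the tree obtained by contracting $e$ and labeling the resulting node with the union of the two parts labeling the endpoints of $e$. In the contraction poset, $S\le T$ iff $T$ is obtained from $S$ by a (possibly empty) sequence of edge contractions. Admissibility. The mandatory arcs of a Schröder separating tree $S$ are the arcs $(i,k,A,B)$ such that the nodes $I\ni i$ and $K\ni k$ of $S$ either coincide or form an edge of $S$ (in either direction), ${]i,k[}\cap(I\cup K)=\varnothing$, and $A$ (resp. $B$) is the set of integers $j\in{]i,k[}$ contained in a node $J$ of $S$ such that there is a directed path in $S$ from $J$ to $I$ or $K$ (resp. from $I$ or $K$ to $J$). The forbidden up (resp. down) arcs of $S$ are the arcs $u(\max L,\min R)$ (resp. $d(\max L,\min R)$) where $L<R$ are two ancestor (resp. descendant) subtrees of a node of $S$. The tree $S$ is $\equiv$-admissible if $\mathcal{A}_\equiv$ contains all mandatory arcs of $S$ and none of the forbidden (up or down) arcs of $S$. *)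

(* Defs.v *)
From mathcomp Require Import classical_sets functions reals.
From mathcomp Require Import all_boot all_order all_fingroup all_algebra.

Set Implicit Arguments.
Unset Strict Implicit.
Unset Printing Implicit Defensive.

Import Order.TTheory GRing.Theory Num.Theory.

(* The set [n] = {1, ..., n} is represented by 'I_n, whose values are shifted *)
(* by one; only the relative order of the integers matters below.             *)

Section WeakOrder.

Variable n : nat.

(* The one-line notation of s is s 0, s 1, ..., s (n - 1). *)
Definition oneline (s : 'S_n) : seq 'I_n := [seq s p | p <- enum 'I_n].

Definition inversions (s : 'S_n) : {set 'I_n * 'I_n} :=
  [set (s pq.1, s pq.2) | pq : 'I_n * 'I_n & (pq.1 < pq.2) && (s pq.2 < s pq.1)].

Definition weak_le : rel 'S_n := fun s t => inversions s \subset inversions t.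

Definition weak_meet (s t m : 'S_n) : Prop :=
  forall x, weak_le x m = weak_le x s && weak_le x t.

Definition weak_join (s t m : 'S_n) : Prop :=
  forall x, weak_le m x = weak_le s x && weak_le t x.

Definition lattice_congruence (e : rel 'S_n) : Prop :=
  [/\ equivalence_rel e,
      forall s s' t t' m m', e s s' -> e t t' ->
        weak_meet s t m -> weak_meet s' t' m' -> e m m'
    & forall s s' t t' m m', e s s' -> e t t' ->
        weak_join s t m -> weak_join s' t' m' -> e m m'].

End WeakOrder.

Section Arcs.

Variable n : nat.

Definition open_itv (i j : 'I_n) : {set 'I_n} := [set k : 'I_n | i < k < j].

(* Quadruples (i, j, A, B); the actual arcs are the elements of all_arcs. *)
Definition quad : Type := ('I_n * 'I_n * {set 'I_n} * {set 'I_n})%type.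

Definition all_arcs : {set quad} :=
  [set a : quad | let: (i, j, A, B) := a in
     [&& i < j, A :|: B == open_itv i j & [disjoint A & B]]].

Definition up_arc (i j : 'I_n) : quad := (i, j, open_itv i j, set0).
Definition down_arc (i j : 'I_n) : quad := (i, j, set0, open_itv i j).

Definition is_up_arc (a : quad) : bool := [exists i, exists j, a == up_arc i j].
Definition is_down_arc (a : quad) : bool :=
  [exists i, exists j, a == down_arc i j].

Definition subarc (a a' : quad) : bool :=
  let: (i, j, A, B) := a in let: (i', j', A', B') := a' in
  [&& i' <= i, i < j, j <= j', A \subset A' & B \subset B'].

Definition strict_subarc (a a' : quad) : bool := subarc a a' && (a != a').

(* The one-line notation of sigma_a; enum 'I_n is increasing. *)
Definition arc_word (a : quad) : seq 'I_n :=
  let: (i, j, A, B) := a in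
  [seq k : 'I_n <- enum 'I_n | k < i]
    ++ [seq k <- enum 'I_n | k \in A] ++ [:: j; i]
    ++ [seq k <- enum 'I_n | k \in B]
    ++ [seq k : 'I_n <- enum 'I_n | j < k].

Definition class_min (e : rel 'S_n) (s : 'S_n) : bool :=
  [forall t : 'S_n, e s t ==> weak_le s t].

Definition congruence_arcs (e : rel 'S_n) : {set quad} :=
  [set a in all_arcs |
     [exists s : 'S_n, (oneline s == arc_word a) && class_min e s]].

Definition essential (e : rel 'S_n) : Prop :=
  forall i j : 'I_n, j = i.+1 :> nat ->
    (i, j, set0, set0) \in congruence_arcs e.

Definition simple_congruence (e : rel 'S_n) : Prop :=
  forall a, a \in all_arcs :\: congruence_arcs e ->
    (forall b, b \in all_arcs :\: congruence_arcs e -> ~~ strict_subarc b a) ->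
    is_up_arc a || is_down_arc a.

End Arcs.

Section Trees.

Variable n : nat.

Definition part : Type := {set 'I_n}.

(* A directed graph on sets of integers: its nodes and its directed edges. *)
Definition digraph : Type := ({set part} * {set part * part})%type.

Definition nodes (S : digraph) : {set part} := S.1.
Definition edges (S : digraph) : {set part * part} := S.2.

Definition dedge (S : digraph) : rel part := fun I J => (I, J) \in edges S.
Definition adj (S : digraph) : rel part := fun I J => dedge S I J || dedge S J I.

(* The first three conditions make S an orientation of the simple graph adj S *)
(* on the nodes of S, and the last two make this graph a tree.                *)
Definition directed_tree (S : digraph) : Prop :=
  [/\ forall I J, dedge S I J -> (I \in nodes S) && (J \in nodes S),
      forall I, ~~ dedge S I I,
      forall I J, dedge S I J -> ~~ dedge S J I,
      {in nodes S &, forall I J, connect (adj S) I J}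
    & forall c : seq part, 2 < size c -> ~ ucycle (adj S) c].

Definition adj_avoiding (S : digraph) (J : part) : rel part :=
  fun X Y => [&& X != J, Y != J & adj S X Y].

(* The connected component of K in S \ J, for K <> J. *)
Definition component (S : digraph) (J K : part) : {set part} :=
  [set X | connect (adj_avoiding S J) K X].

Definition ancestor_subtrees (S : digraph) (J : part) : {set {set part}} :=
  [set component S J K | K in nodes S & dedge S J K].

Definition descendant_subtrees (S : digraph) (J : part) : {set {set part}} :=
  [set component S J K | K in nodes S & dedge S K J].

(* The integers appearing in a subtree X are the elements of cover X. *)
Definition subtree_lt (X Y : {set part}) : bool :=
  [forall x in cover X, forall y in cover Y, x < y].

Definition lies_between (j : 'I_n) (X Y : {set part}) : bool :=
  [forall x in cover X, x < j] && [forall y in cover Y, j < y].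

Definition separated_by (J : part) (X Y : {set part}) : bool :=
  [exists j in J, lies_between j X Y || lies_between j Y X].

Definition schroder_separating_tree (S : digraph) : Prop :=
  [/\ partition (nodes S) [set: 'I_n],
      directed_tree S,
      forall J, J \in nodes S ->
        {in ancestor_subtrees S J &, forall X Y, X != Y -> separated_by J X Y}
    & forall J, J \in nodes S ->
        {in descendant_subtrees S J &, forall X Y, X != Y -> separated_by J X Y}].

Definition merge_parts (e : part * part) (X : part) : part :=
  if (X == e.1) || (X == e.2) then e.1 :|: e.2 else X.

Definition contract (S : digraph) (e : part * part) : digraph :=
  (merge_parts e @: nodes S,
   [set (merge_parts e f.1, merge_parts e f.2) | f in edges S :\ e]).

Definition contraction_step : rel digraph :=
  fun S T => [exists e in edges S, T == contract S e].

Definition contraction_le : rel digraph := connect contraction_step.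

Definition mandatory_arcs (S : digraph) : {set quad n} :=
  [set a in all_arcs n | let: (i, k, A, B) := a in
    [exists I in nodes S, exists K in nodes S,
     [&& i \in I, k \in K, (I == K) || adj S I K,
         open_itv i k :&: (I :|: K) == set0,
         A == [set j in open_itv i k | [exists J in nodes S, (j \in J) &&
                (connect (dedge S) J I || connect (dedge S) J K)]]
       & B == [set j in open_itv i k | [exists J in nodes S, (j \in J) &&
                (connect (dedge S) I J || connect (dedge S) K J)]]]]].

Definition is_max (l : 'I_n) (X : {set 'I_n}) : bool :=
  (l \in X) && [forall x in X, x <= l].

Definition is_min (r : 'I_n) (X : {set 'I_n}) : bool :=
  (r \in X) && [forall x in X, r <= x].

Definition gap (X Y : {set part}) (l r : 'I_n) : bool :=
  [&& subtree_lt X Y, is_max l (cover X) & is_min r (cover Y)].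

Definition forbidden_up_arcs (S : digraph) : {set quad n} :=
  [set a | [exists J in nodes S,
     exists X in ancestor_subtrees S J, exists Y in ancestor_subtrees S J,
     exists l, exists r, gap X Y l r && (a == up_arc l r)]].

Definition forbidden_down_arcs (S : digraph) : {set quad n} :=
  [set a | [exists J in nodes S,
     exists X in descendant_subtrees S J, exists Y in descendant_subtrees S J,
     exists l, exists r, gap X Y l r && (a == down_arc l r)]].

Definition admissible (e : rel 'S_n) (S : digraph) : Prop :=
  mandatory_arcs S \subset congruence_arcs e /\
  [disjoint forbidden_up_arcs S :|: forbidden_down_arcs S & congruence_arcs e].

Definition admissible_trees (e : rel 'S_n) : set digraph := fun S =>
  schroder_separating_tree S /\ admissible e S.

End Trees.

Section Geometry.

Variables (R : realType) (n : nat).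

Local Open Scope ring_scope.
Local Open Scope classical_set_scope.

Local Notation vec := 'rV[R]_n.

Definition dot (x y : vec) : R := \sum_i x ord0 i * y ord0 i.

Definition maximizers (K : set vec) (a : vec) : set vec :=
  [set x | K x /\ forall y, K y -> dot a y <= dot a x].

(* For a convex polyhedral cone C, a linear form bounded above on C has       *)
(* maximum 0, so that the nonempty faces of C are its usual faces             *)
(* C `&` [set x | dot a x = 0], where dot a is nonpositive on C.              *)
Definition nonempty_faces (K : set vec) : set (set vec) :=
  [set F | F !=set0 /\ exists a, F = maximizers K a].

Definition convex_hull k (v : 'I_k -> vec) : set vec :=
  [set x : vec | exists c : 'I_k -> R,
     [/\ forall i, 0 <= c i, \sum_i c i = 1 & x = \sum_i c i *: v i]].

Definition polytope (P : set vec) : Prop :=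
  exists k (v : 'I_k -> vec), P = convex_hull v.

Definition normal_cone (P F : set vec) : set vec :=
  [set a | F `<=` maximizers P a].

Definition normal_fan (P : set vec) : set (set vec) :=
  [set normal_cone P F | F in nonempty_faces P].

Definition perm_cone (s : 'S_n) : set vec :=
  [set x : vec | forall p q : 'I_n, (p <= q)%N -> x ord0 (s p) <= x ord0 (s q)].

Definition class_cone (e : rel 'S_n) (s : 'S_n) : set vec :=
  \bigcup_(t in [set t | e s t]) perm_cone t.

Definition quotient_fan (e : rel 'S_n) : set (set vec) :=
  [set C | exists s, nonempty_faces (class_cone e s) C].

Definition quotientope (e : rel 'S_n) (P : set vec) : Prop :=
  polytope P /\ normal_fan P = quotient_fan e.

End Geometry.

Definition poset_isomorphic (T U : Type) (A : set T) (leT : T -> T -> Prop)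
    (B : set U) (leU : U -> U -> Prop) : Prop :=
  exists2 f : T -> U, set_bij A B f &
    forall x y, A x -> A y -> (leT x y <-> leU (f x) (f y)).

(* Main.v *)
Require Import Defs.
From mathcomp Require Import boolp classical_sets functions reals.
From mathcomp Require Import all_boot all_order all_fingroup all_algebra.
From mathcomp Require Import zify ring.

Set Implicit Arguments.
Unset Strict Implicit.
Unset Printing Implicit Defensive.

Import Order.TTheory GRing.Theory Num.Theory.

(** Why the theorem holds. Send an admissible tree [S] to the cone [tree_cone S] of the
points that increase along the edges of [S]. These cones are exactly the cones of the
quotient fan, and contracting edges amounts to passing to faces.

Congruence and arcs. Two cover relations of the weak order with the same arc are
contracted simultaneously, so a cover relation is contracted if and only if its arc is
missing from the arcs of the congruence ([mem_congruence_arcs]), and the classes are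
connected by contracted cover relations ([cong_ind]). For a simple congruence, an arc
belongs to the congruence if and only if all the up arcs and down arcs that it contains
do ([mem_congruence_good]). Only two relations [U] and [D] on values thus matter, those
of the endpoints of the up arcs and of the down arcs. They are treated abstractly
([arc_relations]); reversing all the edges of a tree exchanges them, and this duality
halves most arguments.

A point determines its tree. In a separating tree, two incomparable nodes are
separated by the first turn of the path joining them ([comparable_or_turnP]). The
values of the gap at such a turn all lie on the same side of it ([forbidden_gap]). So
an arc of the congruence whose sides respect the order of the tree cannot join
incomparable nodes: it would contain a forbidden up or down arc ([good_comparable]).
If two admissible trees have a common point in the relative interiors of their cones,
this applies to the mandatory arcs of each of them and the order of the other, so that
both trees have the same order and are equal ([relint_unique]).

Every permutation has a tree. Join two values of a permutation if the arc passing above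
the values placed before both and below the values placed after both belongs to the
congruence and no value between them is placed between them ([vis]). The Hasse diagram
of the order generated in this way is an admissible tree whose nodes are singletons
([perm_tree_adm]). The key point is that no such arc passes above a value [p] with two
upper covers, since these would be comparable ([no_arc_above]); the lowest value of a
cycle would contradict this. The linear extensions of the tree form the class of the
permutation, so the class cone is the cone of the tree ([class_cone_tree]).

Faces. Contracting an edge keeps a tree admissible ([contract_adm]). The nonempty faces
of [tree_cone S] are the cones of the contractions of [S] ([face_contraction],
[contraction_face]), and any point of [tree_cone S] lies in the relative interior of
the cone of the contraction of its tight edges ([relint_contraction]).

Hence every cone of the fan, as a face of a class cone, is the cone of an admissible
tree. Conversely, a relative interior point of the cone of an admissible tree [S] lies
in a class cone, so it belongs to the relative interior of the cone of a contraction of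
a class tree; by uniqueness this contraction is [S]. The same argument shows that the
inclusion of cones is the reverse of the contraction order ([contraction_le_cone]). For
a quotientope, taking normal cones is an antiisomorphism from its nonempty faces to the
fan ([quotientope_iso]). *)

(** * The weak order *)

Section Permutations.

Variable n : nat.
Implicit Types (s t : 'S_n) (a b c v w : 'I_n).

Lemma neq_ord v w : (v != w) = (v != w :> nat).
Proof. by []. Qed.

Lemma gt_ne v w : v < w -> w != v.
Proof. by rewrite neq_ord; lia. Qed.

Lemma lt_ne v w : v < w -> v != w.
Proof. by rewrite neq_ord; lia. Qed.

Lemma le_ne_lt v w : v <= w -> v != w -> v < w.
Proof. by rewrite neq_ord; lia. Qed.

Definition bef s v w : bool := (s^-1%g v < s^-1%g w)%N.

Lemma bef_irr s : irreflexive (bef s).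
Proof. by move=> v; rewrite /bef ltnn. Qed.

Lemma bef_trans s : transitive (bef s).
Proof. by move=> v u w; rewrite /bef; apply: ltn_trans. Qed.

Lemma bef_total s v w : v != w -> bef s v w || bef s w v.
Proof.
move=> vw; rewrite /bef -neq_ltn; apply: contra vw => /eqP /val_inj.
by move/perm_inj ->.
Qed.

Lemma bef_asym s v w : bef s v w -> ~~ bef s w v.
Proof. by rewrite /bef -leqNgt => /ltnW. Qed.

Lemma befC s v w : v != w -> ~~ bef s v w = bef s w v.
Proof.
move=> vw; have := bef_total s vw; have := @bef_asym s v w.
by case: (bef s v w); case: (bef s w v) => // /(_ isT).
Qed.

Lemma in_inversions s b a : ((b, a) \in inversions s) = (a < b) && bef s b a.
Proof.
apply/imsetP/andP => [[[p q]] | [ab sba]].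
  by rewrite inE /= => /andP[pq sqp] [-> ->]; rewrite /bef !permK.
by exists (s^-1%g b, s^-1%g a); rewrite ?inE /= !permKV // ab andbT.
Qed.

Lemma weak_leP s t :
  reflect (forall a b, a < b -> bef s b a -> bef t b a) (weak_le s t).
Proof.
apply: (iffP subsetP) => [st a b ab sba | st [b a]].
  by have := st (b, a); rewrite !in_inversions ab sba => /(_ isT).
by rewrite !in_inversions => /andP[ab sba]; rewrite ab st.
Qed.

Lemma weak_le_refl s : weak_le s s.
Proof. exact: subxx. Qed.

Lemma weak_le_trans t s r : weak_le s t -> weak_le t r -> weak_le s r.
Proof. exact: subset_trans. Qed.

Lemma eq_bef s t : bef s =2 bef t -> s = t.
Proof.
(* The position of v is the number of values standing before v. *)
move=> st; apply: invg_inj; apply/permP => v; apply/val_inj.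
have cnt r : #|[set w | bef r w v]| = r^-1%g v.
  rewrite /bef -(card_imset _ (@perm_inj _ r^-1%g)).
  have -> : [set r^-1%g x | x in [set w | r^-1%g w < r^-1%g v]]
            = [set p : 'I_n | p < r^-1%g v].
    apply/setP => p; rewrite inE; apply/imsetP/idP => [[w]|pv].
      by rewrite inE => wv ->.
    by exists (r p); rewrite ?inE ?permK.
  have -> : #|[set p : 'I_n | p < r^-1%g v]|
            = count (ltn^~ (r^-1%g v)) (map val (enum 'I_n)).
    rewrite count_map cardE enumT size_filter; apply: eq_count => p.
    by rewrite !inE.
  rewrite val_enum_ord.
  have := ltnW (ltn_ord (r^-1%g v)); move: (nat_of_ord _) => k kn.
  rewrite -(subnKC kn) iotaD count_cat add0n.
  have -> : count (ltn^~ k) (iota 0 k) = k.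
    rewrite -[RHS](size_iota 0 k); apply/eqP; rewrite -all_count.
    by apply/allP => j; rewrite mem_iota.
  rewrite (_ : count _ _ = 0) ?addn0 //.
  apply/eqP; rewrite -leqn0 leqNgt -has_count; apply/hasPn => j.
  by rewrite mem_iota /= -leqNgt => /andP[].
by rewrite /= -!cnt; apply: eq_card => w; rewrite !inE st.
Qed.

Lemma perm_of_lt (lt : rel 'I_n) :
  irreflexive lt -> transitive lt -> (forall v w, v != w -> lt v w || lt w v) ->
  exists t, bef t =2 lt.
Proof.
move=> irr tr tot.
have asym v w : lt v w -> ~~ lt w v.
  by move=> vw; apply/negP => /(tr _ _ _ vw); rewrite irr.
pose c v := #|[set w | lt w v]|.
have cP v w : (c v < c w) = lt v w.
  have mono u z : lt u z -> c u < c z.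
    move=> uz; apply: proper_card; apply/properP; split.
      by apply/subsetP => y; rewrite !inE => /tr; apply.
    by exists u; rewrite !inE ?irr.
  apply/idP/idP; last exact: mono.
  case: (eqVneq v w) => [->|vw]; first by rewrite ltnn.
  by have /orP[//|/mono] := tot _ _ vw; lia.
have cn v : c v < n.
  rewrite -[X in _ < X]card_ord -cardsT; apply: proper_card; apply/properP.
  by split; [apply/subsetP => ?; rewrite inE | exists v; rewrite !inE ?irr].
have inj : injective (fun v => Ordinal (cn v)).
  move=> v w /(congr1 val) /= cvw; apply/eqP/negPn/negP => /tot.
  by rewrite -!cP cvw ltnn.
by exists (perm inj)^-1%g => v w; rewrite /bef invgK !permE /= cP.
Qed.

Lemma perm_of_key (f : 'I_n -> nat) :
  exists t, forall v w,
    bef t v w = (f v < f w) || (f v == f w) && (v < w).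
Proof.
apply: perm_of_lt => [v|w v u|v w vw].
- by rewrite !ltnn andbF.
- lia.
- by move: vw; rewrite neq_ord; lia.
Qed.

(** The join of [s] and [t] inverts the transitive closure of the pairs inverted
by [s] or [t]: this closure is again co-closed, because an inversion of a
permutation can be split at any intermediate value. *)
Lemma weak_join_exists s t : exists m, weak_join s t m.
Proof.
pose iv : rel 'I_n := fun b a => (a < b) && (bef s b a || bef t b a).
have down c a : connect iv c a -> a <= c.
  move/connectP => [p]; elim: p c => [|d p IH] c /=; first by move=> _ ->.
  by move=> /andP[/andP[dc _] /IH h] /h; lia.
have split c b a : connect iv c a -> a < b -> b < c ->
    connect iv c b || connect iv b a.
  move/connectP => [p]; elim: p c => [|d p IH] c /=.
    by move=> _ <-; lia.
  move=> /andP[cd pd] la ab bc.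
  case: (ltngtP d b) => [db|bd|/val_inj e]; last first.
  - by rewrite -e connect1.
  - have /orP[h|->] := IH _ pd la ab bd; last by rewrite orbT.
    by rewrite (connect_trans (connect1 cd) h).
  have da : connect iv d a by apply/connectP; exists p.
  case/andP: cd => lt_dc iv_cd.
  have : iv c b \/ iv b d.
    have cut r : bef r c d -> bef r c b \/ bef r b d.
      by rewrite /bef; case: (ltnP (r^-1%g c) (r^-1%g b)); [left | right; lia].
    rewrite /iv db bc /=; case/orP: iv_cd => /cut[]->; rewrite ?orbT; by [left|right].
  case=> [h|h]; first by rewrite connect1.
  by rewrite (connect_trans (connect1 h) da) orbT.
pose lt : rel 'I_n := fun v w =>
  if v < w then ~~ connect iv w v else (w < v) && connect iv v w.
have [m mP] : exists m, bef m =2 lt.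
  apply: perm_of_lt => [v|v u w|v w vw]; rewrite /lt.
  - by rewrite ltnn.
  - have cl := @connect_trans _ iv.
    case: (ltngtP u v) => uv; case: (ltngtP v w) => vw //=;
      try (by rewrite (val_inj uv)); try (by rewrite (val_inj vw)).
    + rewrite (ltn_trans uv vw) => h1 h2; apply/negP => h.
      by have := split _ _ _ h uv vw; rewrite (negPf h1) (negPf h2).
    + move=> h1 h2; case: (ltngtP u w) => [uw|wu|/val_inj e].
      * by apply: contra h1 => h; apply: cl h2 h.
      * by have := split _ _ _ h2 wu uv; rewrite (negPf h1).
      * by rewrite e h2 in h1.
    + move=> h1 h2; case: (ltngtP u w) => [uw|wu|/val_inj e].
      * by apply: contra h2 => h; apply: cl h h1.
      * by have := split _ _ _ h1 vw wu; rewrite (negPf h2) orbF.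
      * by rewrite -e h1 in h2.
    + move=> h1 h2; rewrite (ltn_trans vw uv) ifF; last by lia.
      exact: cl h1 h2.
  - case: (ltngtP v w) => [_|_|/val_inj/eqP]; rewrite ?orNb ?orbN //.
    by rewrite (negPf vw).
have mE a b : a < b -> bef m b a = connect iv b a.
  by move=> ab; rewrite mP /lt ab ifF //; lia.
exists m => x; apply/weak_leP/andP => [mx|[/weak_leP sx /weak_leP tx]].
  by split; apply/weak_leP => a b ab h; apply: mx => //; rewrite mE // connect1 //
    /iv ab h ?orbT.
move=> a b ab; rewrite mE // => /connectP[p].
elim: p b ab => [|d p IH] b ab /=; first by move=> _ e; rewrite e ltnn in ab.
move=> /andP[/andP[db bd] pd] la.
have xbd : bef x b d by case/orP: bd; [apply: sx | apply: tx].
case: (ltngtP a d) => [ad|da|/val_inj ->] //.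
  exact: bef_trans xbd (IH _ ad pd la).
have := down d a; rewrite leqNgt da => /(_ _)/negP; case=> //.
by apply/connectP; exists p.
Qed.

Lemma weak_meet_exists s t : exists m, weak_meet s t m.
Proof.
(* Reversing the values is an antiautomorphism of the weak order. *)
pose rho : 'S_n := perm (@rev_ord_inj n).
have rhoV v : (rho^-1)%g v = rev_ord v.
  by apply: (@perm_inj _ rho); rewrite permKV permE rev_ordK.
have rhoE r v w : bef (r * rho)%g v w = bef r (rev_ord v) (rev_ord w).
  by rewrite /bef invMg !permM !rhoV.
have anti x y : weak_le (x * rho)%g (y * rho)%g = weak_le y x.
  apply/weak_leP/weak_leP => h a b ab.
    move=> yba; have ne : b != a by rewrite neq_ord; lia.
      rewrite -[bef _ _ _]negbK befC //; apply/negP => xab.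
    have := h (rev_ord b) (rev_ord a); rewrite !rhoE !rev_ordK /=.
    have -> : n - b.+1 < n - a.+1 by have := ltn_ord b; lia.
    by move=> /(_ isT xab) /bef_asym; rewrite yba.
  rewrite !rhoE => xba; rewrite -[bef _ _ _]negbK befC; last first.
    by rewrite (inj_eq (@rev_ord_inj _)) neq_ord; lia.
  apply/negP => yab; have := h (rev_ord b) (rev_ord a).
  rewrite yab /=; have -> : n - b.+1 < n - a.+1 by have := ltn_ord b; lia.
  by move=> /(_ isT isT) /bef_asym; rewrite xba.
have rhoK x : (x * rho * rho)%g = x.
  by apply/permP => p; rewrite !permM !permE rev_ordK.
have [m mP] := weak_join_exists (s * rho)%g (t * rho)%g.
by exists (m * rho)%g => x; rewrite -[x in LHS]rhoK anti mP !anti.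
Qed.

End Permutations.

(** * Congruences of the weak order and their arcs *)

Section Swaps.

Variable n : nat.
Implicit Types (s t : 'S_n) (a b c i j p q r v w x y : 'I_n).

(** A cover relation of the weak order, seen on inversions: [b] immediately precedes
[a] in [s], and [t] exchanges them. *)
Definition drop_inv s t a b : Prop :=
  [/\ a < b, bef s b a &
      forall x y, x < y -> bef t y x = bef s y x && ~~ ((y == b) && (x == a))].

Lemma drop_inv_adjacent s t a b : drop_inv s t a b ->
  forall j, j != a -> j != b -> bef s j a = bef s j b.
Proof.
move=> [ab sba st] j ja jb; apply/idP/idP => [sja|]; last by move/bef_trans; apply.
rewrite -befC 1?eq_sym //; apply/negP => sbj.
have tba : bef t b a = false by rewrite st // !eqxx andbF.
case: (ltngtP j b) => [jb'|bj|/val_inj e]; last by rewrite e eqxx in jb.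
- case: (ltngtP j a) => [ja'|aj|/val_inj e]; last by rewrite e eqxx in ja.
  + have := st _ _ ja'; have : bef s a j = false by apply/negbTE/bef_asym.
    move=> -> /= taj; have := st _ _ jb'; rewrite sbj (negPf ja) andbF /= => tbj.
    have aj : a != j by rewrite eq_sym.
    have tja : bef t j a by rewrite -befC // taj.
    by rewrite (bef_trans tbj tja) in tba.
  + have := st _ _ aj; rewrite sja (negPf jb) /= => tja.
    have := st _ _ jb'; rewrite sbj (negPf ja) andbF /= => tbj.
    by rewrite (bef_trans tbj tja) in tba.
- have := st _ _ (ltn_trans ab bj); rewrite sja (negPf jb) /= => tja.
  have := st _ _ bj; have -> : bef s j b = false by apply/negbTE/bef_asym.
  move=> /= tjb; have tbj : bef t b j by rewrite -befC // tjb.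
  by rewrite (bef_trans tbj tja) in tba.
Qed.

Lemma drop_inv_le s t a b : drop_inv s t a b -> weak_le t s.
Proof. by case=> _ _ st; apply/weak_leP => x y xy; rewrite st // => /andP[]. Qed.

Lemma drop_inv_below s t a b u : drop_inv s t a b ->
  weak_le u s -> ~~ bef u b a -> weak_le u t.
Proof.
case=> _ _ st /weak_leP us uba; apply/weak_leP => x y xy uyx.
rewrite st // us //=; apply: contra uba => /andP[/eqP e1 /eqP e2].
by rewrite -e1 -e2.
Qed.

Lemma drop_inv_above s t a b u : drop_inv s t a b ->
  weak_le t u -> bef u b a -> weak_le s u.
Proof.
case=> _ _ st /weak_leP tu uba; apply/weak_leP => x y xy syx.
case: (boolP ((y == b) && (x == a))) => [/andP[/eqP-> /eqP->] //|h].
by apply: tu => //; rewrite st // syx.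
Qed.

Definition swap s v w := (s * tperm v w)%g.

Lemma bef_swap s v w x y : bef s v w ->
    (forall u, bef s v u -> bef s u w -> False) ->
  bef (swap s v w) x y =
    if (x == v) && (y == w) then false
    else if (x == w) && (y == v) then true else bef s x y.
Proof.
move=> vw no; rewrite /bef /swap invMg !permM tpermV.
have nvw : v != w by apply: contraTneq vw => ->; rewrite bef_irr.
have nwv : w != v by rewrite eq_sym.
have side u : u != v -> u != w -> bef s u v = bef s u w.
  move=> uv uw; apply/idP/idP => [/bef_trans|h]; first exact.
  by rewrite -befC 1?eq_sym //; apply/negP => /no; apply.
have side' u : u != v -> u != w -> bef s v u = bef s w u.
  by move=> uv uw; rewrite -(@befC _ s u v) // -(@befC _ s u w) // side.
rewrite -!/(bef s _ _); case: tpermP => [->|->|/eqP xv /eqP xw];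
  case: tpermP => [->|->|/eqP yv /eqP yw]; rewrite ?eqxx ?bef_irr ?(negPf nvw)
  ?(negPf nwv) ?(negPf xv) ?(negPf xw) ?(negPf yv) ?(negPf yw) ?andbF //=.
- by apply/negbTE/bef_asym.
- by rewrite side'.
- by rewrite side'.
- by rewrite side.
- by rewrite side.
Qed.

Lemma swap_drop s a b : a < b -> bef s b a ->
    (forall u, bef s b u -> bef s u a -> False) ->
  drop_inv s (swap s b a) a b.
Proof.
move=> ab sba no; split=> // x y xy; rewrite bef_swap //.
case: (boolP ((y == b) && _)) => h; first by rewrite andbF.
rewrite andbT; case: ifP => // /andP[/eqP e1 /eqP e2].
by move: xy; rewrite e1 e2; lia.
Qed.

Lemma swap_raise s a b : a < b -> bef s a b ->
    (forall u, bef s a u -> bef s u b -> False) ->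
  drop_inv (swap s a b) s a b.
Proof.
move=> ab sab no.
have ne : a != b by rewrite neq_ord; lia.
split=> //.
  by rewrite bef_swap // !eqxx eq_sym (negPf ne).
move=> x y xy; rewrite bef_swap //.
case: ifP => [/andP[/eqP e1 /eqP e2]|_]; first by move: xy; rewrite e1 e2; lia.
case: ifP => [/andP[/eqP-> /eqP->]|_]; last by rewrite andbT.
by apply/negbTE/bef_asym.
Qed.

(** Among the pairs of values ordered differently by [s] and [t], one whose positions
in [s] are closest is adjacent: a value in between would give a closer pair. *)
Lemma adjacent_disagreement s t : s != t ->
  exists v w, [/\ bef s v w, (forall u, bef s v u -> bef s u w -> False)
                & bef t w v].
Proof.
move=> st.
have [v [w [sw tw]]] : exists v w, bef s v w /\ bef t w v.
  case: (boolP [exists v, exists w, bef s v w && bef t w v]).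
    by move=> /existsP[v /existsP[w /andP[? ?]]]; exists v, w.
  rewrite negb_exists => /forallP no; case/eqP: st; apply: eq_bef => v w.
  have h x y : bef s x y -> bef t x y.
    move=> xy; have ne : y != x by apply: contraTneq xy => ->; rewrite bef_irr.
    rewrite -befC //; move: (no x); rewrite negb_exists => /forallP/(_ y).
    by rewrite xy.
  apply/idP/idP => [/h //|txy].
  have ne : w != v by apply: contraTneq txy => ->; rewrite bef_irr.
  by rewrite -befC //; apply/negP => /h; apply/negP/bef_asym.
have [k] := ubnP (s^-1%g w - s^-1%g v).
elim: k v w sw tw => // k IH v w sw tw hk.
case: (boolP [exists u, bef s v u && bef s u w]); last first.
  rewrite negb_exists => /forallP no; exists v, w; split=> // u h1 h2.
  by have := no u; rewrite h1 h2.
move=> /existsP[u /andP[vu uw]].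
case: (boolP (bef t u v)) => [tuv|].
  by apply: (IH v u) => //; move: hk vu uw; rewrite /bef; lia.
have ne : u != v by apply: contraTneq vu => ->; rewrite bef_irr.
rewrite befC // => tvu; apply: (IH u w) => //; first exact: bef_trans tw tvu.
by move: hk vu uw; rewrite /bef; lia.
Qed.

End Swaps.

Section Congruence.

Variables (n : nat) (e : rel 'S_n).
Hypothesis e_congr : lattice_congruence e.
Implicit Types (s t : 'S_n) (a b c i j p q r v w x y : 'I_n) (A : pred 'I_n).

Lemma cong_refl s : e s s.
Proof. by case: e_congr => /(_ s s s)[]. Qed.

Lemma cong_sym s t : e s t = e t s.
Proof.
case: e_congr => eqv _ _; apply/idP/idP => h.
  by have [_ /(_ h)] := eqv s t s; rewrite cong_refl => <-.
by have [_ /(_ h)] := eqv t s t; rewrite cong_refl => <-.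
Qed.

Lemma cong_trans t s (r : 'S_n) : e s t -> e t r -> e s r.
Proof. by case: e_congr => eqv _ _ st tr; have [_ /(_ st)->] := eqv s t r. Qed.

Lemma weak_meet_le s t : weak_le s t -> weak_meet s t s.
Proof.
move=> st x; case: (boolP (weak_le x s)) => //= xs.
by rewrite (weak_le_trans xs st).
Qed.

Lemma weak_join_le s t : weak_le s t -> weak_join s t t.
Proof.
move=> st x; case: (boolP (weak_le t x)) => /=; last by rewrite andbF.
by move=> tx; rewrite (weak_le_trans st tx).
Qed.

Lemma weak_joinC s t m : weak_join s t m -> weak_join t s m.
Proof. by move=> h x; rewrite andbC. Qed.

Lemma weak_meetC s t m : weak_meet s t m -> weak_meet t s m.
Proof. by move=> h x; rewrite andbC. Qed.

Lemma cong_meet u s t m m' : e s t ->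
  weak_meet u s m -> weak_meet u t m' -> e m m'.
Proof. by case: e_congr => _ h _ st; apply: h => //; apply: cong_refl. Qed.

Lemma cong_join u s t m m' : e s t ->
  weak_join u s m -> weak_join u t m' -> e m m'.
Proof. by case: e_congr => _ _ h st; apply: h => //; apply: cong_refl. Qed.

Lemma cong_convex s t (r : 'S_n) : weak_le s t -> weak_le t r -> e s r -> e s t.
Proof.
move=> st tr sr; apply: (cong_meet (u := t) sr).
  exact/weak_meetC/weak_meet_le.
exact: weak_meet_le.
Qed.

(** The two cover relations that drop the same inversion, one above the other,
are perspective, hence contracted simultaneously. *)
Lemma cong_perspective s t s' t' a b :
  drop_inv s t a b -> drop_inv s' t' a b -> weak_le s s' -> e s t = e s' t'.
Proof.
move=> d d' ss'; have [ab sba st] := d; have [_ sba' st'] := d'.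
have tt' : weak_le t t'.
  apply/weak_leP => x y xy; rewrite st // st' // => /andP[sxy ->].
  by rewrite (weak_leP _ _ ss').
have ns't : ~~ bef t' b a by rewrite st' // !eqxx andbF.
apply/idP/idP => h.
  apply: (cong_join (u := t') h) => x.
    apply/idP/andP => [h'|[t'x sx]].
      by rewrite (weak_le_trans (drop_inv_le d') h') (weak_le_trans ss' h').
    by apply: (drop_inv_above d' t'x); apply: (weak_leP _ _ sx).
  by apply: weak_joinC; apply: weak_join_le.
apply: (cong_meet (u := s) h); first exact: weak_meet_le.
move=> x; apply/idP/andP => [h'|[xs xt']].
  by rewrite (weak_le_trans h' (drop_inv_le d)) (weak_le_trans h' tt').
by apply: (drop_inv_below d xs); apply: contra ns't; apply: (weak_leP _ _ xt').
Qed.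

Definition mkarc a b A : quad n :=
  (a, b, [set j in open_itv a b | A j], [set j in open_itv a b | ~~ A j]).

Lemma mkarc_all a b A : a < b -> mkarc a b A \in all_arcs n.
Proof.
move=> ab; rewrite inE /= ab /=; apply/andP; split.
  by apply/eqP/setP => j; rewrite !inE; case: (A j); case: (a < j < b).
rewrite disjoints_subset; apply/subsetP => j; rewrite !inE.
by case: (A j); case: (a < j < b).
Qed.

Lemma mkarc_eq a b A A' : (forall j : 'I_n, a < j < b -> A j = A' j) ->
  mkarc a b A = mkarc a b A'.
Proof.
move=> h; rewrite /mkarc; congr (_, _, _, _); apply/setP => j; rewrite !inE;
  by case: (boolP (a < j < b)) => //= /h ->.
Qed.

Lemma all_arcsE a b (A B : {set 'I_n}) : (a, b, A, B) \in all_arcs n ->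
  a < b /\ (a, b, A, B) = mkarc a b (mem A).
Proof.
rewrite inE => /and3P[ab /eqP/setP AB dis]; split=> //.
rewrite /mkarc; congr (_, _, _, _); apply/setP => j; move: (AB j) (@disjointFr _ _ _ j dis);
  rewrite !inE; case: (j \in A) => /= [<- h|<- _]; rewrite ?andbT ?andbF ?h //.
Qed.

(** The key sorting the values into the one-line notation of the permutation of
an arc. *)
Definition arc_key a b A j : nat :=
  if j < a then 0 else if j == a then 3 else if j < b then (if A j then 1 else 4)
  else if j == b then 2 else 5.

Definition arc_perm_spec a b A s : Prop := forall v w : 'I_n,
  bef s v w = (arc_key a b A v < arc_key a b A w)
           || (arc_key a b A v == arc_key a b A w) && (v < w).

Lemma arc_perm_inv a b A s x y : a < b -> arc_perm_spec a b A s ->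
  x < y -> bef s y x = [&& a <= x, y <= b, (y == b) || A y & (x == a) || ~~ A x].
Proof.
move=> ab -> xy.
have -> : y < x = false by lia.
rewrite andbF orbF /arc_key -!val_eqE /=.
case: (ltngtP x a) => hxa; case: (ltngtP y a) => hya; try lia;
case: (ltngtP x b) => hxb; case: (ltngtP y b) => hyb; try lia;
case: (A x); case: (A y); rewrite /=; lia.
Qed.

Lemma arc_perm_oneline a b A s : a < b -> arc_perm_spec a b A s ->
  oneline s = arc_word (mkarc a b A).
Proof.
move=> ab sP.
have sorted_one : sorted (bef s) (oneline s).
  rewrite /oneline sorted_map.
  apply: (@sub_sorted _ (relpre val ltn)) => [p q /=|].
    by rewrite /bef !permK.
  by rewrite -sorted_map val_enum_ord iota_ltn_sorted.
apply: (irr_sorted_eq (@bef_trans _ s) (@bef_irr _ s)) => //; last first.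
  move=> v; have -> : v \in oneline s.
    by apply/mapP; exists (s^-1%g v); rewrite ?mem_enum ?permKV.
  have en : v \in enum 'I_n by rewrite mem_enum.
  rewrite /arc_word /mkarc !mem_cat !inE.
  rewrite !(mem_filter _ _ (enum _)) en !inE -!val_eqE /=.
  by case: (ltngtP v a) => ?; case: (ltngtP v b) => ? //=; case: (A v) => //=; lia.
rewrite (sorted_pairwise (@bef_trans _ s)) /arc_word /mkarc.
have srt (P : pred 'I_n) k : (forall j, P j -> arc_key a b A j = k) ->
    pairwise (bef s) [seq j <- enum 'I_n | P j].
  move=> hk; have : pairwise (relpre val ltn) [seq j <- enum 'I_n | P j].
    apply: pairwise_filter; rewrite -(@pairwise_map _ _ val) val_enum_ord.
    by rewrite -(sorted_pairwise ltn_trans) iota_ltn_sorted.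
  apply: (@sub_in_pairwise _ P); last exact: filter_all.
  move=> v w Pv Pw /= vw.
  by rewrite sP (hk _ Pv) (hk _ Pw) ltnn eqxx vw.
have key0 j : j < a -> arc_key a b A j = 0 by rewrite /arc_key => ->.
have key1 j : a < j < b -> A j -> arc_key a b A j = 1.
  by rewrite /arc_key -!val_eqE /= => /andP[? ->] ->; rewrite ifF 1?ifF //; lia.
have key4 j : a < j < b -> ~~ A j -> arc_key a b A j = 4.
  by rewrite /arc_key -!val_eqE /= => /andP[? ->] /negPf->; rewrite ifF 1?ifF //; lia.
have key5 j : b < j -> arc_key a b A j = 5.
  by rewrite /arc_key -!val_eqE /= => ?; do 4 (rewrite ifF; last lia).
have keyb : arc_key a b A b = 2.
  by rewrite /arc_key -!val_eqE /= eqxx; do 3 (rewrite ifF; last lia).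
have keya : arc_key a b A a = 3 by rewrite /arc_key ltnn eqxx.
have lt_key (r1 r2 : seq 'I_n) k : {in r1, forall j, arc_key a b A j < k} ->
    {in r2, forall j, k <= arc_key a b A j} -> allrel (bef s) r1 r2.
  move=> h1 h2; apply/allrelP => v w /h1 hv /h2 hw; rewrite sP.
  by rewrite (leq_trans hv hw).
have m0 j : j \in [seq k : 'I_n <- enum 'I_n | k < a] -> arc_key a b A j = 0.
  by rewrite mem_filter => /andP[/key0].
have m1 j : j \in [seq k <- enum 'I_n | k \in [set j in open_itv a b | A j]] ->
    arc_key a b A j = 1.
  by rewrite mem_filter !inE => /andP[/andP[/key1 h /h]].
have m4 j : j \in [seq k <- enum 'I_n | k \in [set j in open_itv a b | ~~ A j]] ->
    arc_key a b A j = 4.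
  by rewrite mem_filter !inE => /andP[/andP[/key4 h /h]].
have m5 j : j \in [seq k : 'I_n <- enum 'I_n | b < k] -> arc_key a b A j = 5.
  by rewrite mem_filter => /andP[/key5].
have m23 j : j \in [:: b; a] -> 2 <= arc_key a b A j <= 3.
  by rewrite !inE => /orP[]/eqP->; rewrite ?keya ?keyb.
rewrite !pairwise_cat.
have k1 j : j \in [set j in open_itv a b | A j] -> arc_key a b A j = 1.
  by rewrite !inE => /andP[/key1 h /h].
have k4 j : j \in [set j in open_itv a b | ~~ A j] -> arc_key a b A j = 4.
  by rewrite !inE => /andP[/key4 h /h].
rewrite (srt _ _ key0) (srt _ _ k1) (srt _ _ k4) (srt _ _ key5).
have -> : pairwise (bef s) [:: b; a] by rewrite /= sP keya keyb.
rewrite !andTb !andbT.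
apply/and4P; split.
- apply: (@lt_key _ _ 1) => j; first by move/m0 ->.
  by rewrite !mem_cat => /or4P[/m1->|/m23|/m4->|/m5->] //; lia.
- apply: (@lt_key _ _ 2) => j; first by move/m1 ->.
  by rewrite !mem_cat => /or3P[/m23|/m4->|/m5->] //; lia.
- apply: (@lt_key _ _ 4) => j; first by move/m23; lia.
  by rewrite mem_cat => /orP[/m4->|/m5->].
by apply: (@lt_key _ _ 5) => j; [move/m4-> | move/m5->].
Qed.

Lemma oneline_inj s t : oneline s = oneline t -> s = t.
Proof.
move=> st; apply/permP => p.
have E (r : 'S_n) : nth p (oneline r) p = r p.
  rewrite (nth_map p) ?size_enum_ord //; congr (r _); exact: nth_ord_enum.
by rewrite -!E st.
Qed.

(** The arc of a cover relation passes above the values placed before the two exchanged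
ones. *)
Definition has_arc s t a b A : Prop :=
  drop_inv s t a b /\ forall j, a < j < b -> A j = bef s j b.

Lemma arc_perm_exists a b A : a < b ->
  exists s t, arc_perm_spec a b A s /\ has_arc s t a b A.
Proof.
move=> ab; have [s sP] := perm_of_key (arc_key a b A).
have keyb : arc_key a b A b = 2.
  by rewrite /arc_key -!val_eqE /= eqxx; do 3 (rewrite ifF; last lia).
have keya : arc_key a b A a = 3 by rewrite /arc_key ltnn eqxx.
have key2 u : arc_key a b A u = 2 -> u = b.
  by rewrite /arc_key; case: (u < a) => //; case: (u == a) => //;
     case: (u < b); [case: (A u) | case: eqP].
have key3 u : arc_key a b A u = 3 -> u = a.
  by rewrite /arc_key; case: (u < a) => //; case: eqP => // _;
     case: (u < b); [case: (A u) | case: (u == b)].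
exists s, (swap s b a); split=> //; split.
  apply: swap_drop => // [|u]; rewrite !sP keyb keya //.
  have : u != b -> arc_key a b A u != 2 by apply: contra => /eqP/key2->.
  have : u != a -> arc_key a b A u != 3 by apply: contra => /eqP/key3->.
  by rewrite !neq_ord; move: (arc_key a b A u) => c; lia.
move=> j /andP[aj jb]; rewrite sP keyb /arc_key -!val_eqE /= jb.
have -> : j < a = false by lia.
have -> : j == a :> nat = false by lia.
by case: (A j).
Qed.

Lemma arc_perm_le a b A s t u :
  arc_perm_spec a b A u -> has_arc s t a b A -> weak_le u s.
Proof.
move=> uP [d sA]; have [ab sba _] := d.
apply/weak_leP => x y xy; rewrite (arc_perm_inv ab uP xy) => /and4P[ax yb hy hx].
have sy : (y == b) || bef s y b.
  case: (eqVneq y b) hy => //= ne Ay.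
  by rewrite -sA // (leq_ltn_trans ax xy) le_ne_lt.
have sx : (x == a) || bef s a x.
  case: (eqVneq x a) hx => //= ne Ax; have xb := leq_trans xy yb.
  rewrite -befC // (drop_inv_adjacent d) // ?lt_ne // -sA // xb andbT.
  by rewrite le_ne_lt // eq_sym.
case/orP: sx => [/eqP->|sx]; case/orP: sy => [/eqP->|sy] //.
- exact: bef_trans sy sba.
- exact: bef_trans sba sx.
- exact: bef_trans (bef_trans sy sba) sx.
Qed.

(** The permutation of an arc is join irreducible: any permutation strictly
below it misses its unique descent. *)
Lemma arc_perm_min a b A s t :
  arc_perm_spec a b A s -> has_arc s t a b A -> class_min e s = ~~ e s t.
Proof.
move=> sP [d sA]; have [ab sba st] := d.
apply/forallP/idP => [min|nst u].
  apply/negP => h; have := min t; rewrite h /= => /weak_leP/(_ _ _ ab sba).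
  by rewrite st // !eqxx andbF.
apply/implyP => su; apply: contraR nst => nsu.
have [m mP] := weak_meet_exists s u.
have sm : e s m by apply: (cong_meet su (weak_meet_le (weak_le_refl s))).
have /andP[ms mu] : weak_le m s && weak_le m u by rewrite -mP weak_le_refl.
rewrite cong_sym (cong_trans (t := m)) //; last first.
  by rewrite cong_sym.
rewrite cong_sym; apply: cong_convex (drop_inv_le d) _; last by rewrite cong_sym.
apply: (drop_inv_below d) => //; apply: contra nsu => mba.
apply: weak_le_trans mu; apply/weak_leP => x y xy syx.
have := syx; rewrite (arc_perm_inv ab sP xy) => /and4P[ax yb hy hx].
have noninv v w : v < w -> bef s v w -> bef m v w.
  move=> vw svw; have ne := gt_ne vw.
  rewrite -befC //; apply/negP => /(weak_leP _ _ ms _ _ vw).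
  by apply/negP/bef_asym.
have my : (y == b) || bef m y b.
  case: (eqVneq y b) hy => //= ne Ay; have yb' := le_ne_lt yb ne.
  by apply: noninv => //; rewrite -sA // (leq_ltn_trans ax xy).
have mx : (x == a) || bef m a x.
  case: (eqVneq x a) hx => //= ne Ax; have xb := leq_trans xy yb.
  have ax' : a < x by rewrite le_ne_lt // eq_sym.
  apply: noninv => //.
  by rewrite -befC // (drop_inv_adjacent d) // ?lt_ne // -sA // ax'.
case/orP: mx => [/eqP->|mx]; case/orP: my => [/eqP->|my] //.
- exact: bef_trans my mba.
- exact: bef_trans mba mx.
- exact: bef_trans (bef_trans my mba) mx.
Qed.

(** Every cover relation with a given arc is perspective to the one below the
permutation of that arc. *)
Lemma mem_congruence_arcs a b A s t : has_arc s t a b A ->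
  (mkarc a b A \in congruence_arcs e) = ~~ e s t.
Proof.
move=> h; have [d _] := h; have [ab _ _] := d.
have [u [v [uP uv]]] := arc_perm_exists A ab.
rewrite -(cong_perspective uv.1 d (arc_perm_le uP h)) -(arc_perm_min uP uv).
rewrite inE mkarc_all // andTb; apply/existsP/idP => [[w /andP[/eqP ow]]|min].
  by rewrite -(arc_perm_oneline ab uP) in ow; rewrite (oneline_inj ow).
by exists u; rewrite (arc_perm_oneline ab uP) eqxx.
Qed.

(** Two ways in which contracting a cover relation [z < z1] forces the
contraction of [l < s]: the polynomials [(_ /\ s) \/ l] and [(_ \/ l) /\ s] map
the former to the latter. *)
Lemma forcing_meet s l z1 z i (k : 'I_n) i' k' :
  drop_inv s l i k -> drop_inv z1 z i' k' -> weak_le s z1 ->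
  (forall m, weak_le m z -> weak_le m s -> ~~ bef m k i) -> e z1 z -> e s l.
Proof.
move=> d _ sz1 nb z1z; have [m mP] := weak_meet_exists s z.
have /andP[ms mz] : weak_le m s && weak_le m z by rewrite -mP weak_le_refl.
have sm : e s m by apply: (cong_meet z1z _ mP); apply: weak_meet_le.
have ml : weak_le m l by apply: (drop_inv_below d ms); apply: nb.
apply: (cong_trans sm); apply: cong_convex ml (drop_inv_le d) _.
by rewrite cong_sym.
Qed.

Lemma forcing_join s l z1 z (w : 'S_n) i (k : 'I_n) i' k' :
  drop_inv s l i k -> drop_inv z1 z i' k' -> weak_le l w -> weak_le z w ->
  ~~ bef w k i ->
  (forall q : 'S_n, weak_le z1 q -> weak_le l q -> bef q k i) -> e z1 z -> e s l.
Proof.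
move=> d _ lw zw nb qb z1z.
have [p pP] := weak_join_exists l z; have [q qP] := weak_join_exists l z1.
have pw : weak_le p w by rewrite pP lw.
have /andP[lq z1q] : weak_le l q && weak_le z1 q by rewrite -qP weak_le_refl.
have qp : e q p by apply: (cong_join z1z qP pP).
have sq : weak_le s q by apply: (drop_inv_above d lq); apply: qb.
have [m mP] := weak_meet_exists s p.
have /andP[ms mp] : weak_le m s && weak_le m p by rewrite -mP weak_le_refl.
have sm : e s m by apply: (cong_meet qp _ mP); apply: weak_meet_le.
have ml : weak_le m l.
  apply: (drop_inv_below d ms); apply: contra nb.
  by case: d => ik _ _; apply: (weak_leP _ _ (weak_le_trans mp pw)).
apply: (cong_trans sm); apply: cong_convex ml (drop_inv_le d) _.
by rewrite cong_sym.
Qed.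

(** Sorting by this key lists the elements of [A] in the interval from [a] to [b], then
[p], [q], [r], then the rest of that interval. The permutations obtained by placing
the endpoints of an arc and of a subarc as [p], [q], [r] carry the forcing. *)
Definition key3 a b A p q r j : nat :=
  if j < a then 0 else if b < j then 9 else if j == p then 2
  else if j == q then 3 else if j == r then 4 else if A j then 1 else 8.

Definition key3_perm a b A p q r s : Prop := forall v w, bef s v w =
  (key3 a b A p q r v < key3 a b A p q r w)
     || (key3 a b A p q r v == key3 a b A p q r w) && (v < w).

Lemma key3_perm_exists a b A p q r : exists s, key3_perm a b A p q r s.
Proof. exact: perm_of_key. Qed.

Lemma key3_cases a c b A j : a < c < b ->
  let k1 := key3 a b A b c a j in let k2 := key3 a b A c a b j in
  let k3 := key3 a b A a b c j in
  (j < a /\ k1 = 0 /\ k2 = 0 /\ k3 = 0) \/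
  (j = a :> nat /\ k1 = 4 /\ k2 = 3 /\ k3 = 2) \/
  (j = c :> nat /\ k1 = 3 /\ k2 = 2 /\ k3 = 4) \/
  (j = b :> nat /\ k1 = 2 /\ k2 = 4 /\ k3 = 3) \/
  (b < j /\ k1 = 9 /\ k2 = 9 /\ k3 = 9) \/
  (a < j < b /\ j != c :> nat /\ let k := if A j then 1 else 8 in
                                 k1 = k /\ k2 = k /\ k3 = k).
Proof.
move=> acb; rewrite /key3 -!val_eqE /=.
case: (ltngtP j a) => [ja|ja|/val_inj ->]; first by left.
- case: (ltngtP b j) => [jb|jb|/val_inj <-].
  + by do 4 right; left.
  + by case: (eqVneq (j : nat) c) => [/val_inj->|jc]; [do 2 right; left | do 5 right].
  + have -> : b == c :> nat = false by lia.
    by do 3 right; left.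
- have -> : b < a = false by lia.
  have -> : a == b :> nat = false by lia.
  have -> : a == c :> nat = false by lia.
  by right; left.
Qed.

Lemma key3_inj a b A p q r x y :
  2 <= key3 a b A p q r x <= 4 -> key3 a b A p q r x = key3 a b A p q r y -> x = y.
Proof.
have val z : 2 <= key3 a b A p q r z <= 4 ->
    z = if key3 a b A p q r z == 2 then p
        else if key3 a b A p q r z == 3 then q else r.
  rewrite /key3; case: (z < a) => //; case: (b < z) => //.
  case: (z =P p) => // _; case: (z =P q) => // _; case: (z =P r) => // _.
  by case: (A z).
by move=> h E; rewrite (val y) -E //; apply: val.
Qed.

Lemma key3_inv a b A p q r s x y : key3_perm a b A p q r s -> x < y ->
  bef s y x = (key3 a b A p q r y < key3 a b A p q r x).
Proof. by move=> -> xy; rewrite [y < x]ltnNge (ltnW xy) andbF orbF. Qed.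

Lemma key3_drop a b A p q r s i (k : 'I_n) : key3_perm a b A p q r s ->
    i < k -> (key3 a b A p q r k == 2) && (key3 a b A p q r i == 3)
          || (key3 a b A p q r k == 3) && (key3 a b A p q r i == 4) ->
  drop_inv s (swap s k i) i k.
Proof.
move=> sP ik h; apply: swap_drop => //; first by rewrite (key3_inv sP ik); lia.
move=> u ku ui; have /orP[/eqP E|/eqP E] :
    (key3 a b A p q r k == key3 a b A p q r u)
      || (key3 a b A p q r i == key3 a b A p q r u).
  by move: h ku ui; rewrite !sP; move: (key3 _ _ _ _ _ _ u) => U; lia.
- by move: ku; rewrite -(key3_inj _ E) ?bef_irr //; lia.
- by move: ui; rewrite -(key3_inj _ E) ?bef_irr //; lia.
Qed.

(** An arc is contracted as soon as one of its subarcs is. It suffices to move one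
endpoint; the side of the arc on which the new endpoint lies decides which of the
two forcing polynomials applies. *)
Lemma subarc_right a c b A : a < c < b ->
  mkarc a b A \in congruence_arcs e -> mkarc a c A \in congruence_arcs e.
Proof.
move=> acb; have ab : a < b by lia.
have [ac cb] : a < c /\ c < b by lia.
have [s [l [sP [sl sA]]]] := arc_perm_exists A ab.
rewrite (mem_congruence_arcs (conj sl sA)); apply: contraR => nac.
have ka := key3_cases A a acb; have kc := key3_cases A c acb.
have kb := key3_cases A b acb.
have atc x : x = c :> nat -> A x = A c by move/val_inj->.
case: (boolP (A c)) => Ac.
- (* z1 is A, b, c, a, B *)
  have [z1 z1P] := key3_perm_exists a b A b c a.
  have d : drop_inv z1 (swap z1 c a) a c.
    by apply: (key3_drop z1P) => //; move: ka kc => /=; lia.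
  have zA : has_arc z1 (swap z1 c a) a c A.
    split=> // j jac; rewrite z1P; have := key3_cases A j acb.
    by move: jac kc => /=; case: (A j); lia.
  apply: (forcing_meet sl d).
  + apply/weak_leP => x y xy; rewrite (arc_perm_inv ab sP xy) (key3_inv z1P xy).
    have := key3_cases A x acb; have := key3_cases A y acb; move: xy acb Ac (atc x) (atc y).
    rewrite /= -!val_eqE /=; clear.
    by case: (A c); case: (A x); case: (A y); lia.
  + move=> m mz ms; apply/negP => mba.
    have h1 : ~~ bef m c a.
      apply/negP => /(weak_leP _ _ mz _ _ ac); case: d => _ _ -> //.
      by rewrite !eqxx andbF.
    have h2 : ~~ bef m b c.
      apply/negP => /(weak_leP _ _ ms _ _ cb); rewrite (arc_perm_inv ab sP) // Ac.
      by rewrite -!val_eqE /=; lia.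
    rewrite befC ?gt_ne // in h1; rewrite befC ?gt_ne // in h2.
    by have := bef_asym (bef_trans h1 h2); rewrite mba.
  + by move: nac; rewrite (mem_congruence_arcs zA) negbK.
- (* z1 is A, c, a, b, B and w is A, a, b, c, B *)
  have [z1 z1P] := key3_perm_exists a b A c a b.
  have d : drop_inv z1 (swap z1 c a) a c.
    by apply: (key3_drop z1P) => //; move: ka kc => /=; lia.
  have zA : has_arc z1 (swap z1 c a) a c A.
    split=> // j jac; rewrite z1P; have := key3_cases A j acb.
    by move: jac kc => /=; case: (A j); lia.
  have [w wP] := key3_perm_exists a b A a b c.
  apply: (@forcing_join s l z1 (swap z1 c a) w _ _ _ _ sl d).
  + apply/weak_leP => x y xy; case: sl => _ _ -> //.
    rewrite (arc_perm_inv ab sP xy) (key3_inv wP xy).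
    have := key3_cases A x acb; have := key3_cases A y acb; move: xy acb Ac (atc x) (atc y).
    rewrite /= -!val_eqE /=; clear.
    by case: (A c); case: (A x); case: (A y); lia.
  + apply/weak_leP => x y xy; case: d => _ _ -> //.
    rewrite (key3_inv z1P xy) (key3_inv wP xy).
    have := key3_cases A x acb; have := key3_cases A y acb; move: xy acb Ac (atc x) (atc y).
    rewrite /= -!val_eqE /=; clear.
    by case: (A c); case: (A x); case: (A y); lia.
  + by rewrite (key3_inv wP ab); move: ka kb => /=; lia.
  + move=> q z1q lq; have h : bef q c a.
      by apply: (weak_leP _ _ z1q) => //; case: d.
    apply: bef_trans h; apply: (weak_leP _ _ lq) => //.
    case: sl => _ _ -> //; rewrite (arc_perm_inv ab sP) //.
    by rewrite Ac eqxx -!val_eqE /=; lia.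
  + by move: nac; rewrite (mem_congruence_arcs zA) negbK.
Qed.

Lemma subarc_left a c b A : a < c < b ->
  mkarc a b A \in congruence_arcs e -> mkarc c b A \in congruence_arcs e.
Proof.
move=> acb; have ab : a < b by lia.
have [ac cb] : a < c /\ c < b by lia.
have [s [l [sP [sl sA]]]] := arc_perm_exists A ab.
rewrite (mem_congruence_arcs (conj sl sA)); apply: contraR => ncb.
have ka := key3_cases A a acb; have kc := key3_cases A c acb.
have kb := key3_cases A b acb.
have atc x : x = c :> nat -> A x = A c by move/val_inj->.
case: (boolP (A c)) => Ac; last first.
- (* z1 is A, b, c, a, B *)
  have [z1 z1P] := key3_perm_exists a b A b c a.
  have d : drop_inv z1 (swap z1 b c) c b.
    by apply: (key3_drop z1P) => //; move: kb kc => /=; lia.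
  have zA : has_arc z1 (swap z1 b c) c b A.
    split=> // j jcb; rewrite z1P; have := key3_cases A j acb.
    by move: jcb kb => /=; case: (A j); lia.
  apply: (forcing_meet sl d).
  + apply/weak_leP => x y xy; rewrite (arc_perm_inv ab sP xy) (key3_inv z1P xy).
    have := key3_cases A x acb; have := key3_cases A y acb; move: xy acb Ac (atc x) (atc y).
    rewrite /= -!val_eqE /=; clear.
    by case: (A c); case: (A x); case: (A y); lia.
  + move=> m mz ms; apply/negP => mba.
    have h1 : ~~ bef m b c.
      apply/negP => /(weak_leP _ _ mz _ _ cb); case: d => _ _ -> //.
      by rewrite !eqxx andbF.
    have h2 : ~~ bef m c a.
      apply/negP => /(weak_leP _ _ ms _ _ ac); rewrite (arc_perm_inv ab sP) //.
      by rewrite (negPf Ac) -!val_eqE /=; lia.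
    rewrite befC ?gt_ne // in h1; rewrite befC ?gt_ne // in h2.
    by have := bef_asym (bef_trans h2 h1); rewrite mba.
  + by move: ncb; rewrite (mem_congruence_arcs zA) negbK.
- (* z1 is A, a, b, c, B and w is A, c, a, b, B *)
  have [z1 z1P] := key3_perm_exists a b A a b c.
  have d : drop_inv z1 (swap z1 b c) c b.
    by apply: (key3_drop z1P) => //; move: kb kc => /=; lia.
  have zA : has_arc z1 (swap z1 b c) c b A.
    split=> // j jcb; rewrite z1P; have := key3_cases A j acb.
    by move: jcb kb => /=; case: (A j); lia.
  have [w wP] := key3_perm_exists a b A c a b.
  apply: (@forcing_join s l z1 (swap z1 b c) w _ _ _ _ sl d).
  + apply/weak_leP => x y xy; case: sl => _ _ -> //.
    rewrite (arc_perm_inv ab sP xy) (key3_inv wP xy).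
    have := key3_cases A x acb; have := key3_cases A y acb; move: xy acb Ac (atc x) (atc y).
    rewrite /= -!val_eqE /=; clear.
    by case: (A c); case: (A x); case: (A y); lia.
  + apply/weak_leP => x y xy; case: d => _ _ -> //.
    rewrite (key3_inv z1P xy) (key3_inv wP xy).
    have := key3_cases A x acb; have := key3_cases A y acb; move: xy acb Ac (atc x) (atc y).
    rewrite /= -!val_eqE /=; clear.
    by case: (A c); case: (A x); case: (A y); lia.
  + by rewrite (key3_inv wP ab); move: ka kb => /=; lia.
  + move=> q z1q lq; have h : bef q b c.
      by apply: (weak_leP _ _ z1q) => //; case: d.
    apply: (bef_trans h); apply: (weak_leP _ _ lq) => //.
    case: sl => _ _ -> //; rewrite (arc_perm_inv ab sP) //.
    by rewrite Ac eqxx -!val_eqE /=; lia.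
  + by move: ncb; rewrite (mem_congruence_arcs zA) negbK.
Qed.

Lemma subarc a b a' b' A : a <= a' -> a' < b' -> b' <= b ->
  mkarc a b A \in congruence_arcs e -> mkarc a' b' A \in congruence_arcs e.
Proof.
move=> aa ab bb h.
have {}h : mkarc a b' A \in congruence_arcs e.
  case: (eqVneq b' b) => [->//|ne]; apply: (subarc_right _ h).
  by rewrite (leq_ltn_trans aa ab) le_ne_lt.
case: (eqVneq a a') => [<-//|ne]; apply: (subarc_left _ h).
by rewrite ab le_ne_lt.
Qed.

Definition up_ok : rel 'I_n := fun a b => up_arc a b \in congruence_arcs e.
Definition down_ok : rel 'I_n := fun a b => down_arc a b \in congruence_arcs e.

Lemma mkarc_up a b : mkarc a b predT = up_arc a b.
Proof. by rewrite /mkarc /up_arc; congr (_, _, _, _); apply/setP => j; rewrite !inE ?andbT ?andbF. Qed.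

Lemma mkarc_down a b : mkarc a b pred0 = down_arc a b.
Proof. by rewrite /mkarc /down_arc; congr (_, _, _, _); apply/setP => j; rewrite !inE ?andbT ?andbF. Qed.

Lemma mkarc_endpoints a b A i j B : mkarc a b A = mkarc i j B -> a = i /\ b = j.
Proof. by case. Qed.

(** The permutations congruent to [s] are connected to it by cover relations
inside the class, through the join of [s] and [t]. *)
Lemma cong_ind (P : 'S_n -> Prop) s :
  P s ->
  (forall t t' a b, has_arc t t' a b (fun j => bef t j b) -> e t t' -> (P t <-> P t')) ->
  forall t, e s t -> P t.
Proof.
move=> Ps step.
have chain (r m : 'S_n) : weak_le r m -> e r m -> (P r <-> P m).
  have [k] := ubnP (#|inversions m| - #|inversions r|).
  elim: k r => // k IH r hk rm erm.
  case: (eqVneq r m) => [->//|/adjacent_disagreement[v [w [rvw no mwv]]]].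
  have vw : v < w.
    have ne : v != w by apply: contraTneq rvw => ->; rewrite bef_irr.
    case: (ltngtP v w) => // [wv|/val_inj E]; last by rewrite E eqxx in ne.
    by have := bef_asym (weak_leP _ _ rm _ _ wv rvw); rewrite mwv.
  have d := swap_raise vw rvw no.
  have r'm := drop_inv_above d rm mwv.
  have err' := cong_convex (drop_inv_le d) r'm erm.
  have er'm : e (swap r v w) m by apply: cong_trans erm; rewrite cong_sym.
  rewrite -(step (swap r v w) r v w) 1?cong_sym //; apply: IH => //.
  have : #|inversions r| < #|inversions (swap r v w)|.
    apply: proper_card; apply/properP; split; first exact: (drop_inv_le d).
    exists (w, v); rewrite in_inversions vw /=; first by case: d.
    exact: bef_asym.
  by have := subset_leq_card r'm; lia.
move=> t est; have [m mP] := weak_join_exists s t.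
have /andP[sm tm] : weak_le s m && weak_le t m by rewrite -mP weak_le_refl.
have esm : e s m by apply: (cong_join est (weak_join_le (weak_le_refl s)) mP).
have etm : e t m by apply: cong_trans esm; rewrite cong_sym.
by apply/(chain _ _ tm etm)/(chain _ _ sm esm).
Qed.

End Congruence.

(** [U] and [D] record which up arcs and down arcs are present; the arc with endpoints
[i], [k], in any order, passes above the values in [A] and below the others. *)
Definition good n (U D : rel 'I_n) (i k : 'I_n) (A : pred 'I_n) : Prop :=
  forall a b : 'I_n, a < b -> minn i k <= a -> b <= maxn i k ->
    ((forall j : 'I_n, a < j < b -> A j) -> U a b) /\
    ((forall j : 'I_n, a < j < b -> ~~ A j) -> D a b).

(** The two relations recording the up and down arcs of a simple essential
congruence. *)
Definition arc_relations n (U D : rel 'I_n) : Prop :=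
  [/\ forall a b a' b' : 'I_n, a <= a' -> a' < b' -> b' <= b -> U a b -> U a' b',
      forall a b a' b' : 'I_n, a <= a' -> a' < b' -> b' <= b -> D a b -> D a' b',
      forall a b : 'I_n, b = a.+1 :> nat -> U a b
    & forall a b : 'I_n, b = a.+1 :> nat -> D a b].

Section Simple.

Variables (n : nat) (e : rel 'S_n).
Hypothesis e_congr : lattice_congruence e.
Hypothesis e_simple : simple_congruence e.
Hypothesis e_ess : essential e.

Lemma congruence_arc_relations : arc_relations (up_ok e) (down_ok e).
Proof.
split=> [a b a' b' aa ab bb|a b a' b' aa ab bb|a b ab|a b ab].
- by rewrite /up_ok -!mkarc_up; apply: subarc.
- by rewrite /down_ok -!mkarc_down; apply: subarc.
- rewrite /up_ok /up_arc (_ : open_itv a b = set0) ?e_ess //.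
  by apply/setP => j; rewrite !inE; lia.
- rewrite /down_ok /down_arc (_ : open_itv a b = set0) ?e_ess //.
  by apply/setP => j; rewrite !inE; lia.
Qed.

(** A minimal missing arc is an up arc or a down arc, so an arc belongs to the
congruence as soon as its up and down subarcs do. *)
Lemma mem_congruence_good (a b : 'I_n) (A : pred 'I_n) : a < b ->
  (mkarc a b A \in congruence_arcs e) <-> good (up_ok e) (down_ok e) a b A.
Proof.
move=> ab; split.
  move=> h c d cd; rewrite (minn_idPl (ltnW ab)) (maxn_idPr (ltnW ab)) => ac db.
  have := subarc e_congr ac cd db h.
  by split=> hA; rewrite /up_ok /down_ok -?mkarc_up -?mkarc_down -(mkarc_eq (A := A)) //
    => j /hA // /negbTE.
have [k] := ubnP (b - a); elim: k a b ab => // k IH a b ab hk g.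
apply/negPn/negP => nin.
have up_down : is_up_arc (mkarc a b A) || is_down_arc (mkarc a b A).
  apply: e_simple; first by rewrite in_setD nin mkarc_all.
  move=> [[[i j] A'] B'] /setDP[/all_arcsE[ij ->] nb]; apply/negP => /andP[].
  rewrite /subarc /= => /and5P[ai _ jb /subsetP sA /subsetP sB] ne.
  have E : mkarc i j (mem A') = mkarc i j A.
    apply: mkarc_eq => l lij /=.
    apply/idP/idP => lA; first by have := sA l; rewrite !inE lij lA => /(_ isT)/andP[].
    by apply: contraTT lA => lA; have := sB l; rewrite !inE lij lA => /(_ isT)/andP[].
  case: (boolP ((i == a) && (j == b))) => [/andP[/eqP ia /eqP jb']|ne'].
    by rewrite E ia jb' eqxx in ne.
  case/negP: nb; rewrite E; apply: IH => //.
    by move: ne'; rewrite -!val_eqE /=; lia.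
  by move=> c d cd ci dj; apply: g => //; lia.
have := g a b ab; rewrite geq_minl leq_maxr => /(_ isT isT)[gU gD].
have full P : (mkarc a b A = mkarc a b P) -> forall j : 'I_n, a < j < b -> A j = P j.
  by case=> /setP h _ j jab; have := h j; rewrite !inE jab.
case/orP: up_down => /existsP[i /existsP[j /eqP E]].
- have [ia jb] : a = i /\ b = j by apply: (@mkarc_endpoints _ _ _ A _ _ predT); rewrite mkarc_up.
  subst i j; case/negP: nin; rewrite E; apply: gU => l lab.
  by rewrite (full predT) // mkarc_up.
- have [ia jb] : a = i /\ b = j by apply: (@mkarc_endpoints _ _ _ A _ _ pred0); rewrite mkarc_down.
  subst i j; case/negP: nin; rewrite E; apply: gD => l lab.
  by rewrite (full pred0) // mkarc_down.
Qed.

End Simple.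


(** * Visible arcs of a permutation *)

Section Good.

Variable n : nat.
Implicit Types (U D : rel 'I_n) (A : pred 'I_n) (i j k a b : 'I_n).

Definition btw i k j : bool := minn i k < j < maxn i k.

Definition goodb U D i k A : bool :=
  [forall a : 'I_n, forall b : 'I_n,
    [&& a < b, minn i k <= a & b <= maxn i k] ==>
      ([forall j : 'I_n, (a < j < b) ==> A j] ==> U a b)
      && ([forall j : 'I_n, (a < j < b) ==> ~~ A j] ==> D a b)].

Lemma goodP U D i k A : reflect (good U D i k A) (goodb U D i k A).
Proof.
have allP (B : pred 'I_n) a b :
    (forall j, a < j < b -> B j) <-> [forall j : 'I_n, (a < j < b) ==> B j].
  by split=> [h|/forallP h j]; [apply/forallP => j; apply/implyP/h | apply/implyP].
apply: (iffP forallP) => [h a b ab ia bk|h a].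
  have /forallP/(_ b)/implyP := h a; rewrite ab ia bk => /(_ isT)/andP[hU hD].
  by split=> /allP; apply/implyP.
apply/forallP => b; apply/implyP => /and3P[ab ia bk].
have [hU hD] := h a b ab ia bk.
by apply/andP; split; apply/implyP => /allP.
Qed.

Lemma good_ext U D i k A A' : (forall j, btw i k j -> A j = A' j) ->
  good U D i k A -> good U D i k A'.
Proof.
move=> AA g a b ab ia bk; have [gU gD] := g a b ab ia bk.
have h j : a < j < b -> A j = A' j by move=> ajb; apply: AA; rewrite /btw; lia.
by split=> hA; [apply: gU | apply: gD] => j ajb; rewrite h // hA.
Qed.

Lemma good_sub U D i k i' k' A :
  minn i k <= minn i' k' -> maxn i' k' <= maxn i k ->
  good U D i k A -> good U D i' k' A.
Proof. by move=> ii kk g a b ab ia bk; apply: g => //; lia. Qed.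

Lemma good_swap U D i k A : good U D i k A -> good U D k i A.
Proof. by apply: good_sub; rewrite ?[minn k i]minnC ?[maxn k i]maxnC. Qed.

(** Turning the picture upside down exchanges up and down arcs. *)
Lemma good_dual U D i k A : good U D i k A -> good D U i k (fun j => ~~ A j).
Proof.
move=> g a b ab ia bk; have [gU gD] := g a b ab ia bk; split; first exact: gD.
by move=> h; apply: gU => j /h; rewrite negbK.
Qed.

Lemma arc_relations_dual U D : arc_relations U D -> arc_relations D U.
Proof. by case. Qed.

End Good.

Section Visible.

Variables (n : nat) (U D : rel 'I_n) (x : 'I_n -> nat).
Implicit Types (i j k l p q r z : 'I_n).

(** Here [x v] is the position of the value [v]. The arc joining [i] to [k] passes
above the values placed before [i] and below those placed after [k]. *)
Definition vis i k : bool :=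
  [&& x i < x k, [forall j, btw i k j ==> (x j < x i) || (x k < x j)]
    & goodb U D i k (fun j => x j < x i)].

Definition tle := connect vis.

Definition cov i k : bool :=
  [&& tle i k, i != k & [forall z, (tle i z && tle z k) ==> (z == i) || (z == k)]].

Lemma visP i k : reflect
  [/\ x i < x k, forall j, btw i k j -> (x j < x i) || (x k < x j)
    & good U D i k (fun j => x j < x i)] (vis i k).
Proof.
apply: (iffP and3P) => [[h1 /forallP h2 /goodP h3]|[h1 h2 /goodP h3]]; split=> //.
  by move=> j; apply/implyP.
by apply/forallP => j; apply/implyP/h2.
Qed.

Lemma tle_x i k : tle i k -> x i <= x k.
Proof.
move/connectP => [p]; elim: p i => [|j p IH] i /=; first by move=> _ ->.
by move=> /andP[/visP[ij _ _] /IH h] /h; lia.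
Qed.

Hypothesis x_inj : injective x.

Lemma tle_lt i k : tle i k -> i != k -> x i < x k.
Proof.
move=> /tle_x; rewrite leq_eqVlt => /orP[/eqP/x_inj->|//]; by rewrite eqxx.
Qed.

Lemma tle_trans : transitive tle.
Proof. exact: connect_trans. Qed.

Lemma cov_vis i k : cov i k -> vis i k.
Proof.
move=> /and3P[/connectP[[|z p] /= + lk] ik /forallP h]; first by rewrite lk eqxx in ik.
move=> /andP[iz zp]; have zk : tle z k by apply/connectP; exists p.
have := h z; rewrite /tle (connect1 iz) [connect _ _ _]zk /= => /orP[]/eqP E; last by rewrite -E.
by have /visP[] := iz; rewrite E ltnn.
Qed.

Lemma cov_x i k : cov i k -> x i < x k.
Proof. by move/cov_vis/visP => []. Qed.

Lemma cov_le i k : cov i k -> tle i k.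
Proof. by case/and3P. Qed.

Lemma not_cov_between i z k : tle i z -> tle z k -> z != i -> z != k -> ~~ cov i k.
Proof.
move=> iz zk zi zk'; apply/negP => /and3P[_ _ /forallP/(_ z)].
by rewrite iz zk (negPf zi) (negPf zk').
Qed.

(** Climb from [j] towards [i]: the closest value placed between [j] and [i] is joined to
[j] by a visible arc, because only values placed before [j] or after [k] separate
them. *)
Lemma vis_below i k j : vis i k -> btw i k j -> x j < x i -> tle j i.
Proof.
move=> /visP[ik no g]; have [m] := ubnP (x i - x j).
elim: m j => // m IH j hm bj ji.
pose P z := [&& minn j i <= z, z <= maxn j i & x j < x z <= x i].
have Pi : P i by rewrite /P; lia.
pose dist z := (z - j) + (j - z).
case: (@arg_minnP _ i P dist Pi) => z /and3P[jz zi /andP[xjz xzi]] zmin.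
have jz' : vis j z.
  apply/visP; split=> // [l bl|].
    case: (ltnP (x l) (x j)) => //= xl.
    have lj : j != l by apply/eqP => E; move: bl; rewrite /btw E; lia.
    have xl' : x j < x l.
      by rewrite ltn_neqAle xl andbT; apply: contra lj => /eqP/x_inj->.
    have bl' : btw i k l by move: bl bj jz zi; rewrite /btw; clear; lia.
    have := no l bl'; case/orP => [xli|]; last by lia.
    have : P l.
      rewrite /P xl' (ltnW xli); move: bl bj jz zi; rewrite /btw; clear; lia.
    by move/zmin; move: bl jz zi; rewrite /dist /btw; clear; lia.
  have jz1 : minn i k <= minn j z by move: bj jz zi; rewrite /btw; clear; lia.
  have jz2 : maxn j z <= maxn i k by move: bj jz zi; rewrite /btw; clear; lia.
  apply: good_ext (good_sub jz1 jz2 g) => l bl.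
  have bl' : btw i k l by move: bl bj jz zi; rewrite /btw; clear; lia.
  case: (ltnP (x l) (x j)) => xl; first by lia.
  apply/negbTE; rewrite -leqNgt leqNgt; apply/negP => xli.
  have lj : j != l by apply/eqP => E; move: bl; rewrite /btw E; lia.
  have xl' : x j < x l.
    by rewrite ltn_neqAle xl andbT; apply: contra lj => /eqP/x_inj->.
  have : P l.
    rewrite /P xl' (ltnW xli); move: bl bj jz zi; rewrite /btw; clear; lia.
  by move/zmin; move: bl jz zi; rewrite /dist /btw; clear; lia.
case: (eqVneq z i) => [<-|zi']; first exact: connect1.
have xz : x z < x i.
  by rewrite ltn_neqAle xzi andbT; apply: contra zi' => /eqP/x_inj->.
apply: tle_trans (connect1 jz') (IH z _ _ xz); first by lia.
by move: bj jz zi zi'; rewrite /btw neq_ord; clear; lia.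
Qed.

(** No value lies between consecutive ones, so essentiality suffices. *)
Lemma vis_succ i k : arc_relations U D -> k = i.+1 :> nat -> vis i k || vis k i.
Proof.
move=> [_ _ U1 D1] ik.
have g A : good U D i k A.
  move=> a b ab ia bk; split=> _; [apply: U1 | apply: D1]; lia.
have no j : ~~ btw i k j by rewrite /btw; lia.
have ne : i != k by rewrite neq_ord; lia.
have : x i != x k by apply: contra ne => /eqP/x_inj->.
rewrite neq_ltn => /orP[h|h]; apply/orP; [left|right]; apply/visP; split=> //.
- by move=> j /(negP (no j)).
- by move=> j; rewrite /btw minnC maxnC => /(negP (no j)).
- exact: good_swap.
Qed.

Lemma tle_connect_cov i k : tle i k -> connect cov i k.
Proof.
have [m] := ubnP (x k - x i); elim: m i k => // m IH i k hm ik.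
case: (eqVneq i k) => [->|ne]; first exact: connect0.
case: (boolP (cov i k)) => [|]; first exact: connect1.
rewrite /cov ik ne /= => /forallPn[z]; rewrite negb_imply negb_or.
move=> /andP[/andP[iz zk] /andP[zi zk']].
have xiz : x i < x z by apply: tle_lt; rewrite // eq_sym.
have xzk : x z < x k by apply: tle_lt.
by apply: connect_trans (IH i z _ iz) (IH z k _ zk); lia.
Qed.

(** On the same side of [p], the arc joining [p] to the farther cover would pass the
nearer one, which would make them comparable. *)
Lemma cov_sides p l r : cov p l -> cov p r -> l != r ->
  (forall i k j, vis i k -> btw i k j -> x k < x j -> tle k j) ->
  (l < p < r) || (r < p < l).
Proof.
move=> pl pr lr above; have [/cov_vis vl /cov_vis vr] := (pl, pr).
have [[xl nl _] [xr nr _]] := (visP _ _ vl, visP _ _ vr).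
have key a b : cov p b -> vis p a -> btw p a b -> False.
  move=> pb va pab; have xb := cov_x pb; have [xa na _] := visP _ _ va.
  have xab : x a < x b by have := na _ pab; lia.
  have ab := above _ _ _ va pab xab.
  have ne1 : a != p by apply/eqP => E; rewrite E ltnn in xa.
  have ne2 : a != b by apply/eqP => E; rewrite E ltnn in xab.
  by have := not_cov_between (connect1 va) ab ne1 ne2; rewrite pb.
have lp : l != p by apply/eqP => E; rewrite E ltnn in xl.
have rp : r != p by apply/eqP => E; rewrite E ltnn in xr.
have h1 := key _ _ pr vl; have h2 := key _ _ pl vr.
move: lr lp rp; rewrite !neq_ord => lr lp rp.
have {}h1 : ~~ btw p l r by apply/negP.
have {}h2 : ~~ btw p r l by apply/negP.
by move: h1 h2; rewrite /btw; lia.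
Qed.

End Visible.

Section Dual.

Variables (n : nat) (U D : rel 'I_n) (x : 'I_n -> nat) (N : nat).
Hypothesis x_inj : injective x.
Hypothesis x_le : forall v, x v <= N.
Implicit Types (i j k l p q r z : 'I_n).

Let x' v := N - x v.

Lemma dual_lt i k : (x' i < x' k) = (x k < x i).
Proof. by have := x_le i; have := x_le k; rewrite /x'; lia. Qed.

Lemma dual_inj : injective x'.
Proof. by move=> i k E; apply: x_inj; have := x_le i; have := x_le k; move: E; rewrite /x'; lia. Qed.

Lemma vis_dual i k : vis D U x' k i = vis U D x i k.
Proof.
apply/visP/visP; rewrite dual_lt => -[ik no g]; split=> //.
- by move=> j b; have := no j; rewrite /btw minnC maxnC => /(_ b); rewrite !dual_lt orbC.
- apply: good_ext (good_dual (good_swap g)) => j b /=; rewrite dual_lt.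
  by have := no j; rewrite /btw minnC maxnC => /(_ b); rewrite !dual_lt; lia.
- by move=> j b; have := no j; rewrite /btw minnC maxnC => /(_ b); rewrite !dual_lt orbC.
- apply: good_ext (good_swap (good_dual g)) => j b /=; rewrite dual_lt.
  by have := no j; rewrite /btw minnC maxnC => /(_ b); lia.
Qed.

Lemma tle_dual i k : tle D U x' k i = tle U D x i k.
Proof.
rewrite /tle -[RHS](connect_rev (vis U D x)) /=.
by apply: eq_connect => a b; rewrite /= vis_dual.
Qed.

Lemma cov_dual i k : cov D U x' k i = cov U D x i k.
Proof.
rewrite /cov tle_dual (eq_sym k i); congr [&& _, _ & _].
by apply: eq_forallb => z; rewrite !tle_dual andbC orbC.
Qed.

Lemma vis_above i k j : vis U D x i k -> btw i k j -> x k < x j -> tle U D x k j.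
Proof.
rewrite -vis_dual -tle_dual => v b xkj; apply: (vis_below dual_inj v).
  by rewrite /btw minnC maxnC.
by rewrite dual_lt.
Qed.

End Dual.

Section Crossing.

Variables (n : nat) (U D : rel 'I_n) (x : 'I_n -> nat) (N : nat).
Hypothesis UD : arc_relations U D.
Hypothesis x_inj : injective x.
Hypothesis x_le : forall v, x v <= N.
Implicit Types (i j k l p q r z : 'I_n).

Notation vis := (vis U D x).
Notation tle := (tle U D x).
Notation cov := (cov U D x).

Definition same_side p u v : bool := (p < u) && (p < v) || (u < p) && (v < p).

Definition dist (u v : 'I_n) : nat := (u - v) + (v - u).

Lemma cov_btw p l r : cov p l -> cov p r -> l != r -> btw l r p.
Proof.
move=> pl pr lr; have := cov_sides pl pr lr (vis_above x_inj x_le).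
by rewrite /btw; lia.
Qed.

(** If the visible arc passes above [p], then the lower cover [l] of [p], or a value above
[l] in the order, is joined to the other cover [r] by a visible arc, whose up subarcs
passing above [p] are subarcs of the given one. So [r] does not cover [p]. *)
Lemma no_arc_above_lt p l r i k : cov p l -> cov p r -> x l < x r ->
  vis i k -> btw i k p -> x p < x i -> False.
Proof.
move=> pl pr xlr ik bp xpi.
have lr : l != r by apply/eqP => E; rewrite E ltnn in xlr.
have [vl vr] := (cov_vis pl, cov_vis pr).
have [[xpl nl gl] [xpr nr gr]] := (visP _ _ _ _ _ vl, visP _ _ _ _ _ vr).
have [xik nik gik] := visP _ _ _ _ _ ik.
have plr := cov_btw pl pr lr.
have [el [er [hl hr el_ik er_ik]]] : exists el er : 'I_n,
    [/\ same_side p l el, same_side p r er, el = i \/ el = k & er = i \/ er = k].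
  move: bp plr; rewrite /btw /same_side; case: (ltnP l p) => lp; case: (ltnP i p) => ip bp plr.
  - by exists i, k; split; try lia; [left|right].
  - by exists k, i; split; try lia; [right|left].
  - by exists k, i; split; try lia; [right|left].
  - by exists i, k; split; try lia; [left|right].
have xel : x p < x el <= x k by move: xik xpi; case: el_ik => ->; clear; lia.
have xer : x p < x er <= x k by move: xik xpi; case: er_ik => ->; clear; lia.
have elr : btw el er p by move: hl hr plr; rewrite /same_side /btw; clear; lia.
have elr_ik : (minn el er = minn i k) /\ (maxn el er = maxn i k).
  have ne : el != er by apply/eqP => E; move: elr; rewrite E /btw; clear; lia.
  by case: el_ik er_ik ne => -> [] ->; rewrite ?eqxx // => _; clear; lia.
have xrk : x r <= x k.
  rewrite leqNgt; apply/negP => xkr.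
  case: (boolP (btw i k r)) => bir.
    have kr := vis_above x_inj x_le ik bir xkr.
    have pk : tle p k := tle_trans (vis_below x_inj ik bp xpi) (connect1 ik).
    have kp : k != p by apply/eqP => E; move: xik xpi; rewrite E; clear; lia.
    have kr' : k != r by apply/eqP => E; move: xkr; rewrite E; clear; lia.
    by have := not_cov_between pk kr kp kr'; rewrite pr.
  have rer : r != er by apply/eqP => E; move: xkr xer; rewrite E; clear; lia.
  have ber : btw p r er.
    move: bir rer hr elr elr_ik; rewrite neq_ord /btw /same_side; clear; lia.
  by have := nr _ ber; move: xer xkr; clear; lia.
pose P z := same_side p l z && (x p < x z < x r).
have Pl : P l by rewrite /P xpl xlr !andbT; move: plr; rewrite /btw /same_side; clear; lia.
case: (@arg_minnP _ l P (dist p) Pl) => m /andP[lm /andP[xpm xmr]] mmin.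
have mbet : minn p l <= m <= maxn p l.
  by have := mmin l Pl; move: lm; rewrite /dist /same_side; clear; lia.
have lm' : tle l m.
  case: (eqVneq m l) => [->|ml]; first exact: connect0.
  have bm : btw p l m by move: mbet lm ml; rewrite /btw /same_side neq_ord; clear; lia.
  apply: (vis_above x_inj x_le vl bm); have := nl _ bm; move: xpm; clear; lia.
have mrp : btw m r p by move: lm plr; rewrite /same_side /btw; clear; lia.
have F j : btw m r j -> [\/ j = p, x j < x p | x r < x j].
  move=> bj; case: (eqVneq j p) => [->|jp]; first by constructor 1.
  case: (boolP (btw p r j)) => bpr.
    by case/orP: (nr _ bpr); [constructor 2|constructor 3].
  have bpm : btw p m j by move: bj jp bpr mrp; rewrite neq_ord /btw; clear; lia.
  have nP : ~~ P j.
    apply/negP => /mmin; move: bpm; rewrite /btw /dist; clear; lia.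
  have sj : same_side p l j by move: bpm lm; rewrite /btw /same_side; clear; lia.
  have rj : r != j by apply/eqP => E; move: bj; rewrite E /btw; clear; lia.
  have xrj : x r != x j by apply: contra rj => /eqP/x_inj->.
  have xpj : x p != x j by apply: contra jp => /eqP/x_inj->.
  move: nP; rewrite /P sj /=; case: (ltnP (x j) (x p)) => h; first by constructor 2.
  by move: xrj xpj h => h1 h2 h3 h4; constructor 3; move: h1 h2 h3 h4; clear; lia.
have vmr : vis m r.
  apply/visP; split=> // [j /F[->|h|->]|]; first by rewrite xpm.
  - by rewrite (ltn_trans h xpm).
  - by rewrite orbT.
  have inner a b : a < b -> minn m r <= a -> b <= maxn m r -> ~~ (a < p < b) ->
     [/\ minn p l <= a & b <= maxn p l] \/ [/\ minn p r <= a & b <= maxn p r].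
    by move: mbet mrp; rewrite /btw; clear; lia.
  have inn a b j : minn m r <= a -> b <= maxn m r -> a < j < b -> btw m r j.
    by rewrite /btw; clear; lia.
  move=> a b ab ma br; split=> hA.
  - case: (boolP (a < p < b)) => pab.
      have nel : ~~ (a < el < b).
        apply/negP => /[dup] eab /hA xem.
        have : P el by rewrite /P hl; move: xel xem xmr; clear; lia.
        by move/mmin; move: eab hl lm mrp ma br; rewrite /same_side /dist /btw; clear; lia.
      have ner : ~~ (a < er < b).
        apply/negP => /[dup] eab /hA xem.
        have : btw p r er by move: eab hr mrp ma br; rewrite /same_side /btw; clear; lia.
        by move/nr; move: xer xem xmr; clear; lia.
      have [ia bk] : minn i k <= a /\ b <= maxn i k.
        by move: nel ner pab elr elr_ik; rewrite /btw; clear; lia.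
      have [gU _] := gik a b ab ia bk; apply: gU => j jab; have xjm := hA j jab.
      case: (F j (inn _ _ _ ma br jab)) => [->//|h|h]; first exact: ltn_trans h xpi.
      by move: h xjm xmr; clear; lia.
    have low j : a < j < b -> x j < x p.
      move=> jab; have xjm := hA j jab.
      case: (F j (inn _ _ _ ma br jab)) => [E|//|h].
        by move: pab jab; rewrite E => /negP.
      by move: h xjm xmr; clear; lia.
    by case: (inner a b ab ma br pab) => -[h1 h2]; [have [gU _] := gl a b ab h1 h2 |
      have [gU _] := gr a b ab h1 h2]; apply: gU.
  - have pab : ~~ (a < p < b).
      by apply/negP => /hA; rewrite xpm.
    have high j : a < j < b -> ~~ (x j < x p).
      by move=> /hA; move: xpm; clear; lia.
    by case: (inner a b ab ma br pab) => -[h1 h2]; [have [_ gD] := gl a b ab h1 h2 |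
      have [_ gD] := gr a b ab h1 h2]; apply: gD.
have pm : tle p m := tle_trans (cov_le pl) lm'.
have mp : m != p by apply/eqP => E; rewrite E ltnn in xpm.
have mr : m != r by apply/eqP => E; rewrite E ltnn in xmr.
by have := not_cov_between pm (connect1 vmr) mp mr; rewrite pr.
Qed.

Lemma no_arc_above p l r i k : cov p l -> cov p r -> l != r ->
  vis i k -> btw i k p -> x p < x i -> False.
Proof.
move=> pl pr lr; have : x l != x r by apply: contra lr => /eqP/x_inj->.
rewrite neq_ltn => /orP[h|h]; first exact: (no_arc_above_lt pl pr h).
exact: (no_arc_above_lt pr pl h).
Qed.

End Crossing.

(** * Schröder separating trees *)

Section Trees.

Variable n : nat.
Implicit Types (S T : digraph n) (I J K P Q X Y : part n) (i j k a b : 'I_n).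

(** Reversing all edges exchanges ancestors and descendants. *)
Definition op S : digraph n := (nodes S, [set (f.2, f.1) | f in edges S]).

Definition reach S : rel (part n) := connect (dedge S).

(** Connected avoiding [P]. *)
Definition cav S P : rel (part n) := connect (adj_avoiding S P).

Definition node_of S i : part n := pblock (nodes S) i.

(** Acyclicity says that removing a node disconnects its neighbours from each other. *)
Record is_tree S : Prop := IsTree {
  tree_partition : partition (nodes S) [set: 'I_n];
  tree_edge_nodes : forall I J, dedge S I J -> (I \in nodes S) && (J \in nodes S);
  tree_irr : forall I, ~~ dedge S I I;
  tree_asym : forall I J, dedge S I J -> ~~ dedge S J I;
  tree_conn : {in nodes S &, forall I J, connect (adj S) I J};
  tree_acyc : forall P Q Q', adj S P Q -> adj S P Q' -> cav S P Q Q' -> Q = Q' }.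

Definition separated S : Prop := forall P Q Q',
  dedge S P Q -> dedge S P Q' -> Q != Q' ->
  exists2 p, p \in P &
    (forall a b, cav S P Q (node_of S a) -> cav S P Q' (node_of S b) -> a < p < b) \/
    (forall a b, cav S P Q (node_of S a) -> cav S P Q' (node_of S b) -> b < p < a).

Record sst S : Prop := SST {
  sst_tree : is_tree S; sst_up : separated S; sst_down : separated (op S) }.

Lemma dedge_op S I J : dedge (op S) I J = dedge S J I.
Proof.
rewrite /dedge /edges /=; apply/imsetP/idP => [[[X Y] h [-> ->]] //|h].
by exists (J, I).
Qed.

Lemma op_op S : op (op S) = S.
Proof.
case: S => V E; congr (_, _); rewrite /= -imset_comp -[RHS]imset_id.
by apply: eq_imset => -[].
Qed.

Lemma adj_sym S : symmetric (adj S).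
Proof. by move=> I J; rewrite /adj orbC. Qed.

Lemma adj_op S : adj (op S) =2 adj S.
Proof. by move=> I J; rewrite /adj !dedge_op orbC. Qed.

Lemma cav_op S P : cav (op S) P =2 cav S P.
Proof. by apply: eq_connect => X Y; rewrite /adj_avoiding adj_op. Qed.

Lemma reach_op S I J : reach (op S) I J = reach S J I.
Proof.
rewrite /reach -[RHS](connect_rev (dedge S)) /=.
by apply: eq_connect => X Y; rewrite dedge_op.
Qed.

Lemma cav_sym S P : symmetric (cav S P).
Proof.
apply: sym_connect_sym => X Y; rewrite /adj_avoiding adj_sym.
by case: (X != P); case: (Y != P).
Qed.

Lemma cav_trans S P : transitive (cav S P).
Proof. exact: connect_trans. Qed.

Lemma cav_edge S P X Y : X != P -> Y != P -> adj S X Y -> cav S P X Y.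
Proof. by move=> XP YP XY; apply: connect1; rewrite /adj_avoiding XP YP. Qed.

Lemma cav_neq S P Q X : cav S P Q X -> Q != P -> X != P.
Proof.
move/connectP => [p]; elim: p Q => [|Y p IH] Q /=; first by move=> _ ->.
by move=> /andP[/and3P[_ YP _] pY] l _; apply: IH pY l YP.
Qed.

Lemma path_avoiding S P Q (p : seq (part n)) :
  path (adj S) Q p -> P \notin Q :: p -> path (adj_avoiding S P) Q p.
Proof.
move=> pQ nP; have allP : all [pred Y | Y != P] (Q :: p).
  by apply/allP => Y Yp /=; apply: contraNneq nP => <-.
by apply: (sub_in_path (P := [pred Y | Y != P]) _ allP pQ) => Y Z YP ZP YZ;
   rewrite /adj_avoiding YZ andbT; apply/andP.
Qed.

Lemma is_tree_op S : is_tree S -> is_tree (op S).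
Proof.
case=> h1 h2 h3 h4 h5 h6; split=> //.
- by move=> I J; rewrite dedge_op => /h2; rewrite andbC.
- by move=> I; rewrite dedge_op.
- by move=> I J; rewrite !dedge_op => /h4.
- by move=> I J IS JS; rewrite (eq_connect (adj_op S)); apply: h5.
- by move=> P Q Q'; rewrite !adj_op cav_op; apply: h6.
Qed.

Lemma sst_op S : sst S -> sst (op S).
Proof. by case=> h1 h2 h3; split; rewrite ?op_op //; apply: is_tree_op. Qed.

Section Tree.

Variable S : digraph n.
Hypothesis tS : is_tree S.
Local Notation V := (nodes S).
Local Notation d := (dedge S).
Local Notation N := (node_of S).
Local Notation cavS := (cav S).

Lemma mem_node i : i \in N i.
Proof. by rewrite mem_pblock (cover_partition (tree_partition tS)) inE. Qed.

Lemma node_in i : N i \in V.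
Proof. by rewrite pblock_mem // (cover_partition (tree_partition tS)) inE. Qed.

Lemma node_ofE i X : X \in V -> i \in X -> N i = X.
Proof. by case/and3P: (tree_partition tS) => _ tr _; apply: def_pblock. Qed.

Lemma node_neq0 X : X \in V -> exists i, N i = X.
Proof.
move=> XV; case/and3P: (tree_partition tS) => _ _ V0.
case: (set_0Vmem X) => [E|[i iX]]; first by rewrite E (negPf V0) in XV.
by exists i; apply: node_ofE.
Qed.

Lemma adj_nodes I J : adj S I J -> (I \in V) && (J \in V).
Proof. by case/orP => /(tree_edge_nodes tS)// /andP[-> ->]. Qed.

Lemma adj_neq I J : adj S I J -> I != J.
Proof.
by move=> h; apply/eqP => E; move: h; rewrite E /adj orbb; apply/negP/(tree_irr tS).
Qed.

Lemma dedge_neq I J : d I J -> I != J.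
Proof. by move=> h; apply: adj_neq; rewrite /adj h. Qed.

Lemma dedge_adj I J : d I J -> adj S I J.
Proof. by rewrite /adj => ->. Qed.

Lemma dedge_adj' I J : d I J -> adj S J I.
Proof. by rewrite /adj => ->; rewrite orbT. Qed.

Lemma nbr_exists P X : P \in V -> X \in V -> X != P ->
  exists2 Q, adj S P Q & cavS P Q X.
Proof.
move=> PV XV XP; have /connectP[p0] := tree_conn tS PV XV.
move=> /shortenP[p + + _]; case: p => [_ _ l|Q p]; first by rewrite l eqxx in XP.
move=> /= /andP[PQ pQ] /andP[nP _] l; exists Q => //; apply/connectP; exists p => //.
exact: path_avoiding.
Qed.

(** A path from [P] to [X] that meets [Q] can be cut at [Q]; one that does not keeps [P]
and [X] together once [Q] is removed. *)
Lemma cav_or P Q X : P \in V -> X \in V -> P != Q -> X != P ->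
  cavS P Q X || cavS Q P X.
Proof.
move=> PV XV PQ XP; have [R PR RX] := nbr_exists PV XV XP.
have RP : R != P by rewrite eq_sym adj_neq.
have : cavS P Q X || connect (fun Y Z => adj_avoiding S P Y Z && (Y != Q) && (Z != Q)) R X
       && (R != Q).
  case/connectP: RX => p; elim: p R RP {PR} => [|Y p IH] R RP /=.
    by move=> _ ->; case: (eqVneq R Q) => [->|_]; rewrite /cav !connect0 ?orbT.
  move=> /andP[RY pY] l; have YP : Y != P by case/and3P: RY.
  case/orP: (IH Y YP pY l) => [->//|/andP[YX YQ]].
  have RX : cavS P R X by apply/connectP; exists (Y :: p); rewrite //= RY.
  case: (eqVneq R Q) => [<-|RQ]; first by rewrite RX.
  apply/orP; right; rewrite andbT; apply: connect_trans YX; apply: connect1.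
  by rewrite RY RQ YQ.
case/orP => [->//|/andP[RX' RQ]]; apply/orP; right.
apply: (cav_trans (cav_edge PQ RQ PR)); apply: connect_sub RX' => Y Z.
move=> /andP[/andP[/and3P[_ _ YZ] YQ] ZQ].
by apply: connect1; rewrite /adj_avoiding YQ ZQ.
Qed.

Lemma reach_last J I : reach S J I -> J != I ->
  exists Q, [/\ d Q I, cavS I J Q & reach S J Q].
Proof.
move=> /connectP[p0 /shortenP[p pP up _] l] JI; move: l pP up.
case/lastP: p => [l|p I']; first by rewrite l eqxx in JI.
rewrite last_rcons => <-; rewrite rcons_path -rcons_cons rcons_uniq.
move=> /andP[pJ dI] /andP[nI _]; exists (last J p); split=> //; last first.
  by apply/connectP; exists p.
apply/connectP; exists p => //; apply: path_avoiding nI.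
exact: (sub_path dedge_adj pJ).
Qed.

Lemma reach_refl I : reach S I I.
Proof. exact: connect0. Qed.

Lemma reach_trans J I K : reach S I J -> reach S J K -> reach S I K.
Proof. exact: connect_trans. Qed.

Lemma reach1 I J : d I J -> reach S I J.
Proof. exact: connect1. Qed.

Lemma cav_nodes P I J : cavS P I J -> I \in V -> J \in V.
Proof.
move/connectP => [p]; elim: p I => [|X p IH] I /=; first by move=> _ ->.
by move=> /andP[/and3P[_ _ /adj_nodes/andP[_ XV]] pX] l _; apply: IH pX l XV.
Qed.

End Tree.

Lemma reach_first S I K : reach S I K -> I != K ->
  exists Q, [/\ dedge S I Q, cav S I Q K & reach S Q K].
Proof.
rewrite -reach_op eq_sym => /reach_last h /h[Q].
by rewrite dedge_op cav_op reach_op cav_sym; exists Q.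
Qed.

Lemma reach_anti S I K : is_tree S -> reach S I K -> reach S K I -> I = K.
Proof.
move=> tS IK KI; apply/eqP/negPn/negP => ne.
have [Q [IQ QK _]] := reach_first IK ne.
rewrite eq_sym in ne; have [Q' [Q'I KQ' _]] := reach_last KI ne.
have E := tree_acyc tS (dedge_adj IQ) (dedge_adj' Q'I) (cav_trans QK KQ').
by move: (tree_asym tS IQ); rewrite E Q'I.
Qed.

(** The path from [I] to [K] goes down to [P] and leaves it upwards. *)
Definition turn S I K : Prop := exists P Q Q',
  [/\ dedge S P Q, dedge S P Q', Q != Q', cav S P Q I & cav S P Q' K /\ reach S P I].

Definition comparable_or_turn S I K : Prop :=
  [\/ reach S I K, reach S K I, turn S I K | turn (op S) I K].

Lemma comparable_or_turn_op S I K :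
  comparable_or_turn S I K -> comparable_or_turn (op S) I K.
Proof.
case=> [h|h|h|h]; rewrite /comparable_or_turn op_op !reach_op;
  by [constructor 2|constructor 1|constructor 4|constructor 3].
Qed.

Lemma comparable_or_turn_step S I P K : is_tree S -> K \in nodes S ->
  dedge S I P -> cav S I P K -> I != K -> (P = K \/ comparable_or_turn S P K) ->
  comparable_or_turn S I K.
Proof.
move=> tS KV IP PK IK; have [IV PV] := andP (tree_edge_nodes tS IP).
have PI : P != I by rewrite eq_sym (dedge_neq tS IP).
(* coming from I, the path would turn at P into the child R of P *)
have down R : dedge S R P -> cav S P R K -> R != I -> comparable_or_turn S I K.
  move=> RP RK RI; constructor 4; exists P, I, R; rewrite !dedge_op !cav_op reach_op.
  by split; rewrite // ?[I == R]eq_sym //; [apply: connect0 | split=> //; apply: reach1].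
case=> [E|]; first by constructor 1; rewrite -E; apply: reach1.
case=> [h|h|[R [Q [Q' [RQ RQ' QQ' QP [Q'K RP]]]]]|[R [Q [Q' [RQ RQ' QQ' QP [Q'K PR]]]]]].
- by constructor 1; apply: reach_trans (reach1 IP) h.
- case: (eqVneq P K) => [E|KP]; first by constructor 1; rewrite -E; apply: reach1.
  rewrite eq_sym in KP; have [R [RP KR rKR]] := reach_last h KP.
  case: (eqVneq R I) => [E|RI]; first by constructor 2; rewrite -E.
  by apply: (down R) => //; rewrite cav_sym.
- have QR : Q != R by rewrite eq_sym (dedge_neq tS RQ).
  have PR := cav_neq QP QR.
  case: (eqVneq R I) => [E|RI].
    have := tree_acyc tS (dedge_adj IP) _ (cav_trans PK _).
    rewrite -E => /(_ Q' (dedge_adj RQ')); rewrite cav_sym => /(_ Q'K) E'.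
    have := tree_acyc tS (dedge_adj RQ) _ QP; rewrite E => /(_ (dedge_adj IP)) E''.
    by rewrite E'' E' eqxx in QQ'.
  have RPn : R != P by rewrite eq_sym.
  have [R' [R'P RR' rRR']] := reach_last RP RPn.
  have PI' : cav S R P I by apply: cav_edge => //; [rewrite eq_sym | apply: dedge_adj'].
  have KR : K != R by apply: cav_neq Q'K _; rewrite eq_sym (dedge_neq tS RQ').
  have RV : R \in nodes S by case/andP: (tree_edge_nodes tS RQ).
  have RPK : cav S P R K.
    case/orP: (cav_or tS RV KV RPn KR) => // RPK.
    have := tree_acyc tS (dedge_adj RQ) (dedge_adj RQ') (cav_trans QP (cav_trans RPK _)).
    by rewrite cav_sym => /(_ Q'K) E; rewrite E eqxx in QQ'.
  case: (eqVneq R' I) => [E|R'I]; last first.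
    by apply: (down R') => //; apply: cav_trans RPK; rewrite cav_sym.
  constructor 3; exists R, Q, Q'; split=> //; first exact: cav_trans QP PI'.
  by split=> //; rewrite -E.
- rewrite dedge_op in RQ; rewrite dedge_op in RQ'; rewrite !cav_op in QP Q'K.
  rewrite reach_op in PR; have IR := reach_trans (reach1 IP) PR.
  have QR : Q != R by rewrite (dedge_neq tS RQ).
  have PRn := cav_neq QP QR.
  have RI : I != R.
    apply/eqP => E; have := reach_anti tS PR; rewrite -E => /(_ (reach1 IP)) E'.
    by rewrite E' eqxx in PI.
  constructor 4; exists R, Q, Q'; rewrite !dedge_op !cav_op reach_op; split=> //.
  by apply: cav_trans QP _; apply: cav_edge => //; apply: dedge_adj'.
Qed.

(** Two incomparable nodes are separated by the first turn of the path joining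
them. *)
Lemma comparable_or_turnP S I K : is_tree S -> I \in nodes S -> K \in nodes S -> I != K ->
  comparable_or_turn S I K.
Proof.
move=> tS IV KV; have /connectP[p0] := tree_conn tS IV KV.
move=> /shortenP[p pI up _]; elim: p I IV pI up => [|P p IH] I IV /=.
  by move=> _ _ ->; rewrite eqxx.
move=> /andP[IP pP] /andP[nI up] l IK.
have PV : P \in nodes S by case/andP: (adj_nodes tS IP).
have PK : cav S I P K.
  by apply/connectP; exists p => //; apply: path_avoiding.
have ih : P = K \/ comparable_or_turn S P K.
  by case: (eqVneq P K) => [|PK']; [left | right; apply: IH].
case/orP: IP => IP; first exact: comparable_or_turn_step PK IK ih.
rewrite -[S]op_op; apply: comparable_or_turn_op.
apply: (@comparable_or_turn_step _ _ P); rewrite ?dedge_op ?cav_op //.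
  exact: is_tree_op.
by case: ih => [|/comparable_or_turn_op]; [left|right].
Qed.

End Trees.

(** * Admissible trees and arc relations *)

Section Admissible.

Variable n : nat.
Implicit Types (S T : digraph n) (I J K P Q X Y : part n) (i j k a b : 'I_n).
Implicit Types (U D : rel 'I_n) (A : pred 'I_n).

Lemma separated_btw S P Q Q' (a b : 'I_n) : separated S ->
  dedge S P Q -> dedge S P Q' -> Q != Q' ->
  cav S P Q (node_of S a) -> cav S P Q' (node_of S b) ->
  exists2 p, p \in P & btw a b p.
Proof.
move=> sS PQ PQ' QQ' Qa Q'b; have [p pP [h|h]] := sS P Q Q' PQ PQ' QQ';
  by exists p => //; have := h a b Qa Q'b; rewrite /btw; lia.
Qed.

Lemma separated_not_btw S P Q Q' (a b c : 'I_n) : separated S ->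
  dedge S P Q -> dedge S P Q' -> Q != Q' ->
  cav S P Q (node_of S a) -> cav S P Q (node_of S b) ->
  cav S P Q' (node_of S c) -> ~~ btw a b c.
Proof.
move=> sS PQ PQ' QQ' Qa Qb Q'c; have [p pP [h|h]] := sS P Q Q' PQ PQ' QQ';
  by have := h a c Qa Q'c; have := h b c Qb Q'c; rewrite /btw; lia.
Qed.

(** A turn on the path from an edge to another node would be separated by a single value
from both endpoints of the edge. So the values passed over or under by an edge belong
to nodes below its source or above its target. *)
Lemma edge_btw S I K i k j : sst S ->
  I \in nodes S -> K \in nodes S -> I = K \/ dedge S I K -> i \in I -> k \in K ->
  (forall l, btw i k l -> (l \notin I) && (l \notin K)) -> btw i k j ->
  reach S (node_of S j) I || reach S K (node_of S j).
Proof.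
case=> tS sU sD IV KV IK iI kK close bj.
have JV := node_in tS j.
have NI := node_ofE tS IV iI; have NK := node_ofE tS KV kK.
case: (eqVneq I (node_of S j)) => [->|IJ]; first by rewrite reach_refl.
(* a turn at P of the path from I to J that has both i and k on one side *)
have absurd T P Q Q' : separated T -> node_of T =1 node_of S ->
    dedge T P Q -> dedge T P Q' -> Q != Q' ->
    cav T P Q I -> cav T P Q K -> cav T P Q' (node_of S j) -> False.
  move=> sT NT PQ PQ' QQ' QI QK Q'J.
  have := @separated_not_btw T P Q Q' i k j sT PQ PQ' QQ'.
  by rewrite !NT NI NK => /(_ QI QK Q'J); rewrite bj.
case: (comparable_or_turnP tS IV JV IJ).
- move=> IJ'; case: IK => [<-|IK]; first by rewrite IJ' orbT.
  have [Q [IQ QJ rQJ]] := reach_first IJ' IJ.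
  case: (eqVneq K Q) => [->|KQ]; first by rewrite rQJ orbT.
  have [||p pI bp] := @separated_btw S I K Q k j sU IK IQ KQ; rewrite ?NK //.
    exact: connect0.
  have : btw i k p by move: bj bp; rewrite /btw; clear; lia.
  by move/close; rewrite pI.
- by move=> ->.
- move=> [P [Q [Q' [PQ PQ' QQ' QI [Q'J PI]]]]]; exfalso.
  apply: (absurd S P Q Q') => //.
  case: IK => [<-//|IK]; apply: (cav_trans QI); apply: cav_edge (dedge_adj IK).
    by apply: cav_neq QI _; rewrite eq_sym (dedge_neq tS PQ).
  apply/eqP => E; rewrite -E in PI.
  by have := reach_anti tS PI (reach1 IK); have := dedge_neq tS IK => /[swap] ->; rewrite eqxx.
- move=> [P [Q [Q' [PQ PQ' QQ' QI [Q'J IP]]]]]; exfalso.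
  rewrite reach_op in IP.
  have IPn : I != P by apply: cav_neq QI _; rewrite eq_sym (dedge_neq (is_tree_op tS) PQ).
  case: IK => [IK|IK]; first by apply: (absurd (op S) P Q Q') => //; rewrite -IK.
  case: (eqVneq K P) => [KP|KP]; last first.
    apply: (absurd (op S) P Q Q') => //; apply: (cav_trans QI); rewrite cav_op.
    exact: cav_edge (dedge_adj IK).
  rewrite -KP in PQ PQ' QI Q'J.
  have E : Q = I.
    apply: (tree_acyc tS (dedge_adj' _) (dedge_adj' IK)); last by rewrite -cav_op.
    by rewrite -dedge_op.
  rewrite {}E {QI} in PQ QQ'.
  have [||p pK bp] := @separated_btw (op S) K I Q' i j sD PQ PQ' QQ' => //.
    by rewrite [node_of _ _]NI; apply: connect0.
  have : btw i k p by move: bj bp; rewrite /btw; clear; lia.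
  by move/close; rewrite pK andbF.
Qed.

Definition mandatory U D S : Prop := forall I K i k,
  I \in nodes S -> K \in nodes S -> i \in I -> k \in K -> i < k ->
  (I == K) || adj S I K ->
  (forall j, i < j < k -> (j \notin I) && (j \notin K)) ->
  good U D i k (fun j => reach S (node_of S j) I || reach S (node_of S j) K).

(** Equivalent to missing the forbidden arcs: the arc joining the maximum of a subtree to
the minimum of a subtree on its right is contained in every arc of the same kind joining values of these subtrees. *)
Definition forbidden U S : Prop := forall P Q Q' i k,
  dedge S P Q -> dedge S P Q' -> Q != Q' ->
  cav S P Q (node_of S i) -> cav S P Q' (node_of S k) -> i < k -> ~~ U i k.

Record adm U D S : Prop := Adm {
  adm_sst : sst S;
  adm_mand : mandatory U D S;
  adm_up : forbidden U S;
  adm_down : forbidden D (op S) }.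

Lemma btw_lt i k j : i < k -> btw i k j = (i < j < k).
Proof. by move=> ik; rewrite /btw (minn_idPl (ltnW ik)) (maxn_idPr (ltnW ik)). Qed.

Lemma btwC i k j : btw i k j = btw k i j.
Proof. by rewrite /btw minnC maxnC. Qed.

Lemma edge_btw_dual S I K j : sst S -> I \in nodes S -> K \in nodes S ->
  I = K \/ dedge S I K -> j \notin I -> j \notin K ->
  reach S (node_of S j) I || reach S K (node_of S j) ->
  (reach S (node_of S j) I || reach S (node_of S j) K) =
  ~~ (reach S I (node_of S j) || reach S K (node_of S j)).
Proof.
case=> tS _ _ IV KV IK jI jK; have IK' : reach S I K.
  by case: IK => [->|/reach1//]; apply: reach_refl.
have jN := mem_node tS j.
have nI : node_of S j != I by apply: contraNneq jI => <-.
have nK : node_of S j != K by apply: contraNneq jK => <-.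
case/orP => [JI|KJ].
  rewrite JI /=; apply/esym/norP; split; apply/negP => h.
    by rewrite (reach_anti tS JI h) eqxx in nI.
  by rewrite (reach_anti tS (reach_trans JI IK') h) eqxx in nK.
rewrite KJ orbT /=; apply/norP; split; apply/negP => h.
  by rewrite (reach_anti tS (reach_trans h IK') KJ) eqxx in nK.
by rewrite (reach_anti tS h KJ) eqxx in nK.
Qed.

(** For the values passed by an edge, lying below and lying above are complementary.
This makes mandatory arcs invariant under the reversal of the tree. *)
Lemma adj_btw S I K i k j : sst S -> I \in nodes S -> K \in nodes S ->
  (I == K) || adj S I K -> i \in I -> k \in K ->
  (forall l, btw i k l -> (l \notin I) && (l \notin K)) -> btw i k j ->
  (reach S (node_of S j) I || reach S (node_of S j) K) =
  ~~ (reach S I (node_of S j) || reach S K (node_of S j)).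
Proof.
move=> sS IV KV IK iI kK close bj; have /andP[jI jK] := close j bj.
case/or3P: IK => [/eqP IK|IK|IK].
- apply: edge_btw_dual (edge_btw _ _ _ _ iI kK close bj) => //; by left.
- apply: edge_btw_dual (edge_btw _ _ _ _ iI kK close bj) => //; by right.
- rewrite orbC [X in ~~ X]orbC.
  apply: edge_btw_dual (edge_btw _ _ _ _ kK iI _ _) => //; try by right.
    by move=> l; rewrite btwC => /close; rewrite andbC.
  by rewrite btwC.
Qed.

Lemma adm_op U D S : adm U D S -> adm D U (op S).
Proof.
case=> sS mS uS dS; split=> //; rewrite ?op_op //; first exact: sst_op.
move=> I K i k IV KV iI kK ik IK close.
have {}IK : (I == K) || adj S I K by rewrite -adj_op.
apply: good_ext (good_dual (mS I K i k IV KV iI kK ik IK close)) => j bj /=.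
rewrite !reach_op -[RHS]negbK; congr (~~ _).
rewrite (adj_btw sS IV KV IK iI kK _ bj) // => l; rewrite btw_lt //; exact: close.
Qed.

Lemma adm_mandatory U D S I K i k : adm U D S ->
  I \in nodes S -> K \in nodes S -> i \in I -> k \in K -> i != k ->
  (I == K) || adj S I K ->
  (forall j, btw i k j -> (j \notin I) && (j \notin K)) ->
  good U D i k (fun j => reach S (node_of S j) I || reach S (node_of S j) K).
Proof.
move=> [sS mS _ _] IV KV iI kK ik IK close.
case: (ltngtP i k) => [lik|lki|/val_inj E]; last by rewrite E eqxx in ik.
  by apply: mS => // j; rewrite -btw_lt //; apply: close.
apply: good_swap; apply: (@good_ext _ U D k i) (mS K I k i KV IV kK iI lki _ _).
- by move=> j _; rewrite orbC.
- by rewrite eq_sym adj_sym.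
- by move=> j; rewrite -btw_lt // btwC => /close; rewrite andbC.
Qed.

(** Take [a] and [b] closest to each other in two ancestor subtrees of [P]. Every value
between them belongs to [P] or to a descendant of [P], since a turn on the way from
[P] would separate it from both [a] and [b]. *)
Lemma forbidden_gap U S P Q Q' i k : sst S -> forbidden U S ->
  dedge S P Q -> dedge S P Q' -> Q != Q' ->
  cav S P Q (node_of S i) -> cav S P Q' (node_of S k) -> i < k ->
  exists a b, [/\ i <= a, a < b, b <= k, ~~ U a b &
    forall j, a < j < b -> reach S (node_of S j) P].
Proof.
move=> sS fS; have [tS sU sD] := sS; have [m] := ubnP (k - i).
elim: m i k Q Q' => // m IH i k Q Q' hm PQ PQ' QQ' Qi Q'k ik.
case: (boolP [exists j : 'I_n, (i < j < k) &&
   [exists R, dedge S P R && cav S P R (node_of S j)]]) => [|no].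
  move=> /existsP[j /andP[/andP[ij jk] /existsP[R /andP[PR Rj]]]].
  case: (eqVneq Q R) => [E|QR].
    have [||a [b [ja ab bk nU h]]] := IH j k R Q' _ PR PQ' _ Rj Q'k jk.
    - by lia.
    - by rewrite -E.
    by exists a, b; split=> //; lia.
  have [|a [b [ja ab bk nU h]]] := IH i j Q R _ PQ PR QR Qi Rj ij; first by lia.
  by exists a, b; split=> //; lia.
exists i, k; split=> //; first exact: fS PQ PQ' QQ' Qi Q'k ik.
move=> j ijk.
have nA R : dedge S P R -> ~~ cav S P R (node_of S j).
  move=> PR; apply: contra no => Rj; apply/existsP; exists j; rewrite ijk.
  by apply/existsP; exists R; rewrite PR.
have JV := node_in tS j; have PV : P \in nodes S by case/andP: (tree_edge_nodes tS PQ).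
case: (eqVneq P (node_of S j)) => [<-|PJ]; first exact: reach_refl.
case: (comparable_or_turnP tS PV JV PJ) => //.
- move=> h; have [R [PR RJ _]] := reach_first h PJ.
  by have := nA R PR; rewrite RJ.
- move=> [R [T [T' [RT RT' TT' TP [T'J RP]]]]]; exfalso.
  have RV : R \in nodes S by case/andP: (tree_edge_nodes tS RT).
  have PR : P != R by apply: cav_neq TP _; rewrite eq_sym (dedge_neq tS RT).
  have RPn : R != P by rewrite eq_sym.
  have [R' [R'P RR' _]] := reach_last RP RPn.
  have side a X : dedge S P X -> cav S P X (node_of S a) -> cav S R P (node_of S a).
    move=> PX Xa; have aP : node_of S a != P.
      by apply: cav_neq Xa _; rewrite eq_sym (dedge_neq tS PX).
    case/orP: (cav_or tS PV (node_in tS a) PR aP) => // Ra.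
    have E : X = R'.
      apply: (tree_acyc tS (dedge_adj PX) (dedge_adj' R'P)).
      by apply: cav_trans RR'; apply: (cav_trans Xa); rewrite cav_sym.
    by have := tree_asym tS PX; rewrite E R'P.
  have := @separated_not_btw S R T T' i k j sU RT RT' TT'.
  rewrite (cav_trans TP (side _ _ PQ Qi)) (cav_trans TP (side _ _ PQ' Q'k)) T'J.
  by move=> /(_ isT isT isT); rewrite btw_lt // ijk.
- move=> [R [T [T' [RT RT' TT' TP [T'J PR]]]]]; exfalso.
  rewrite !dedge_op in RT RT'; rewrite !cav_op in TP T'J; rewrite reach_op in PR.
  have RPn : P != R by apply: cav_neq TP _; rewrite (dedge_neq tS RT).
  have [Q1 [PQ1 Q1R _]] := reach_first PR RPn.
  have JP : node_of S j != P by rewrite eq_sym.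
  case/orP: (cav_or tS PV JV RPn JP) => h.
    by have := nA Q1 PQ1; rewrite (cav_trans Q1R h).
  have E : T = T'.
    apply: (tree_acyc tS (dedge_adj' RT) (dedge_adj' RT')).
    by apply: (cav_trans TP); apply: (cav_trans h); rewrite cav_sym.
  by rewrite E eqxx in TT'.
Qed.

(** The endpoints of an arc satisfying the arc relations, whose sides respect the
order of the tree, cannot be incomparable: at the turn between them, the arc would
contain a forbidden up or down arc. *)
Lemma good_comparable U D S i k A : adm U D S -> good U D i k A ->
  (forall j, btw i k j -> node_of S j != node_of S i ->
     reach S (node_of S j) (node_of S i) -> A j) ->
  (forall j, btw i k j -> node_of S j != node_of S i ->
     reach S (node_of S i) (node_of S j) -> ~~ A j) ->
  reach S (node_of S i) (node_of S k) || reach S (node_of S k) (node_of S i).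
Proof.
(* the case of a turn above a node P, for both orientations *)
have main U' D' T B : adm U' D' T -> good U' D' i k B ->
    (forall j, btw i k j -> node_of T j != node_of T i ->
       reach T (node_of T j) (node_of T i) -> B j) ->
    ~ turn T (node_of T i) (node_of T k).
  move=> [sT _ fT _] g hB [P [Q [Q' [PQ PQ' QQ' Qi [Q'k Pi]]]]].
  have [tT _ _] := sT.
  have iP : node_of T i != P.
    by apply: cav_neq Qi _; rewrite eq_sym (dedge_neq (sst_tree sT) PQ).
  have [a [b [ab ia bk nU h]]] : exists a b : 'I_n, [/\ a < b, minn i k <= a,
      b <= maxn i k, ~~ U' a b & forall j, a < j < b -> reach T (node_of T j) P].
    case: (ltngtP i k) => [ik|ki|/val_inj E].
    - have [a [b [? ? ? ? ?]]] := forbidden_gap sT fT PQ PQ' QQ' Qi Q'k ik.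
      by exists a, b.
    - have [|a [b [? ? ? ? ?]]] := forbidden_gap sT fT PQ' PQ _ Q'k Qi ki.
        by rewrite eq_sym.
      by exists a, b.
    - rewrite -E cav_sym in Q'k.
      have := tree_acyc (sst_tree sT) (dedge_adj PQ) (dedge_adj PQ') (cav_trans Qi Q'k).
      by move=> E'; rewrite E' eqxx in QQ'.
  have [gU _] := g a b ab ia bk; case/negP: nU; apply: gU => j ajb.
  have jP := h j ajb; apply: hB; last exact: reach_trans jP Pi.
    by move: ajb ia bk; rewrite /btw; clear; lia.
  apply/eqP => E; rewrite E in jP.
  by rewrite (reach_anti tT jP Pi) eqxx in iP.
move=> aS g hA hB; have tS := sst_tree (adm_sst aS).
case: (eqVneq (node_of S i) (node_of S k)) => [->|ne]; first by rewrite reach_refl.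
case: (comparable_or_turnP tS (node_in tS i) (node_in tS k) ne) => [->//|->|h|h].
- by rewrite orbT.
- by case: (main U D S A aS g hA).
- case: (main D U (op S) (fun j => ~~ A j) (adm_op aS) (good_dual g)) => //.
  by move=> j bj ne'; rewrite reach_op; apply: hB.
Qed.

End Admissible.

Section Bridge.

Variable n : nat.
Implicit Types (S T : digraph n) (I J K P Q X Y : part n) (i j k a b : 'I_n).

Lemma cycle_split S (c : seq (part n)) : ucycle (adj S) c -> 2 < size c ->
  exists P Q p Q', [/\ c = P :: Q :: rcons p Q', adj S P Q, adj S P Q',
    path (adj_avoiding S P) Q (rcons p Q') & Q != Q'].
Proof.
case: c => [|P [|Q p]] //; case/lastP: p => [//|p Q'] /andP[cyc un] _.
exists P, Q, p, Q'; move: cyc; rewrite /= rcons_path last_rcons.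
move=> /andP[PQ /andP[pth Q'P]]; case/andP: un => nP /andP[nQ _].
split=> //; first by rewrite adj_sym.
- exact: path_avoiding.
- by apply: contraNneq nQ => ->; rewrite mem_rcons mem_head.
Qed.

Lemma is_treeP S : partition (nodes S) [set: 'I_n] -> (directed_tree S <-> is_tree S).
Proof.
move=> pS; split=> [[h1 h2 h3 h4 h5]|tS].
  split=> // P Q Q' PQ PQ' /connectP[p0 /shortenP[p pP up _] l].
  apply/eqP/negPn/negP => ne.
  apply: (h5 (P :: Q :: p)); first by case: p l {pP up} => [l|] //; rewrite l eqxx in ne.
  have QP : Q != P by apply: contraTneq PQ => ->; rewrite /adj orbb; apply: h2.
  have avoid : all [pred Y | Y != P] (Q :: p).
    rewrite /= QP /=; elim: p Q pP {up l PQ ne QP} => //= Y p IH Q.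
    by move=> /andP[/and3P[_ -> _] /IH].
  apply/andP; split; last first.
    by rewrite cons_uniq up andbT; apply/negP => /(allP avoid) /=; rewrite eqxx.
  rewrite /= PQ /= rcons_path -l adj_sym PQ' andbT.
  by apply: sub_path pP => Y Z /and3P[].
split=> //; first exact: tree_edge_nodes tS.
- exact: tree_irr tS.
- exact: tree_asym tS.
- exact: tree_conn tS.
move=> c sc /cycle_split/(_ sc)[P [Q [p [Q' [_ PQ PQ' pth ne]]]]].
case/eqP: ne; apply: (tree_acyc tS PQ PQ'); apply/connectP.
by exists (rcons p Q'); rewrite ?last_rcons.
Qed.

Lemma mem_cover_component S P Q a : is_tree S -> adj S P Q ->
  (a \in cover (component S P Q)) = cav S P Q (node_of S a).
Proof.
move=> tS PQ; have QV : Q \in nodes S by case/andP: (adj_nodes tS PQ).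
apply/bigcupP/idP => [[X]|h]; last by exists (node_of S a); rewrite ?inE ?mem_node.
rewrite inE => QX aX; rewrite (node_ofE tS _ aX) //.
exact: cav_nodes QX QV.
Qed.

Lemma separatedP S : is_tree S ->
  (forall J, J \in nodes S ->
     {in ancestor_subtrees S J &, forall (X Y : {set part n}), X != Y -> separated_by J X Y}) <->
  separated S.
Proof.
move=> tS; split=> [h P Q Q' PQ PQ' QQ'|h J JV X Y].
  have [PV QV] := andP (tree_edge_nodes tS PQ).
  have [_ QV'] := andP (tree_edge_nodes tS PQ').
  have /existsP[p /andP[pP lb]] :
      separated_by P (component S P Q) (component S P Q').
    apply: (h P PV).
    - by apply/imsetP; exists Q; rewrite ?inE ?QV.
    - by apply/imsetP; exists Q'; rewrite ?inE ?QV'.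
    - apply: contra QQ' => /eqP/setP/(_ Q'); rewrite !inE connect0 => QQ'.
      by apply/eqP/(tree_acyc tS (dedge_adj PQ) (dedge_adj PQ')).
  exists p => //; case/orP: lb => /andP[/forall_inP h1 /forall_inP h2]; [left|right];
    move=> a b; rewrite -!(mem_cover_component _ tS) ?dedge_adj // => ha hb;
    by rewrite h1 // h2.
move=> /imsetP[Q]; rewrite inE => /andP[QV PQ] ->.
move=> /imsetP[Q']; rewrite inE => /andP[QV' PQ'] -> ne.
have [|p pP lb] := h J Q Q' PQ PQ'; first by apply: contraNneq ne => ->.
have [i iQ] := node_neq0 tS QV; have [k kQ'] := node_neq0 tS QV'.
have Qi : cav S J Q (node_of S i) by rewrite iQ; apply: connect0.
have Qk : cav S J Q' (node_of S k) by rewrite kQ'; apply: connect0.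
apply/existsP; exists p; rewrite pP /=; apply/orP.
case: lb => lb; [left|right]; apply/andP; split; apply/forall_inP => a;
  rewrite (mem_cover_component _ tS) ?dedge_adj // => ha.
- by case/andP: (lb a k ha Qk).
- by case/andP: (lb i a Qi ha).
- by case/andP: (lb i a Qi ha).
- by case/andP: (lb a k ha Qk).
Qed.

Lemma ancestor_subtrees_op S J : ancestor_subtrees (op S) J = descendant_subtrees S J.
Proof.
have E K : component (op S) J K = component S J K.
  by apply/setP => X; rewrite !inE [LHS]cav_op.
by apply/setP => Z; apply/imsetP/imsetP => -[K]; rewrite inE => hK ->;
  exists K; rewrite ?inE ?E // ?dedge_op // -dedge_op.
Qed.

Lemma sstP S : schroder_separating_tree S <-> sst S.
Proof.
split=> [[pS dS uS oS]|[tS uS oS]].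
  have tS : is_tree S by apply/is_treeP.
  split=> //; first by apply/separatedP.
  apply/separatedP => [|J JV X Y]; first exact: is_tree_op.
  by rewrite ancestor_subtrees_op; apply: oS.
have pS := tree_partition tS.
split=> //; [exact/is_treeP|exact/separatedP|].
by move=> J JV X Y; rewrite -ancestor_subtrees_op; apply: (separatedP (is_tree_op tS)).2.
Qed.

Lemma ex_max (X : {set 'I_n}) i : i \in X -> exists2 l, is_max l X & i <= l.
Proof.
move=> iX; case: (@arg_maxnP _ i (mem X) val iX) => l lX lmax; exists l; last exact: lmax.
by apply/andP; split=> //; apply/forall_inP => j /lmax.
Qed.

Lemma ex_min (X : {set 'I_n}) i : i \in X -> exists2 l, is_min l X & l <= i.
Proof.
move=> iX; case: (@arg_minnP _ i (mem X) val iX) => l lX lmin; exists l; last exact: lmin.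
by apply/andP; split=> //; apply/forall_inP => j /lmin.
Qed.

Lemma forbiddenP (U : rel 'I_n) S : sst S ->
    (forall a b a' b', a <= a' -> a' < b' -> b' <= b -> U a b -> U a' b') ->
  (forall J (X Y : {set part n}) l r, J \in nodes S -> X \in ancestor_subtrees S J ->
     Y \in ancestor_subtrees S J -> gap X Y l r -> ~~ U l r) <-> forbidden U S.
Proof.
case=> tS sU _ U_sub; split=> [h P Q Q' i k PQ PQ' QQ' Qi Q'k ik|h J X Y l r JV].
  have [PV QV] := andP (tree_edge_nodes tS PQ).
  have [_ QV'] := andP (tree_edge_nodes tS PQ').
  have cov R a : dedge S P R -> cav S P R (node_of S a) -> a \in cover (component S P R).
    by move=> PR Ra; rewrite (mem_cover_component _ tS) ?dedge_adj.
  have [l /[dup] lm /andP[lX lmax] il] := ex_max (cov _ _ PQ Qi).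
  have [r /[dup] rm /andP[rY rmin] rk] := ex_min (cov _ _ PQ' Q'k).
  have lt : subtree_lt (component S P Q) (component S P Q').
    apply/forall_inP => a aX; apply/forall_inP => b bY.
    rewrite (mem_cover_component _ tS) ?dedge_adj // in aX.
    rewrite (mem_cover_component _ tS) ?dedge_adj // in bY.
    have [p pP [lb|lb]] := sU P Q Q' PQ PQ' QQ'.
      by have /andP[] := lb a b aX bY; apply: ltn_trans.
    have /andP[h1 h2] := lb i k Qi Q'k.
    by have := ltn_trans h1 h2; rewrite ltnNge (ltnW ik).
  have lr : l < r by move/forall_inP: lt => /(_ l lX)/forall_inP/(_ r rY).
  have nU : ~~ U l r.
    apply: (h P (component S P Q) (component S P Q')) => //; last by apply/and3P.
    - by apply/imsetP; exists Q; rewrite ?inE ?QV.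
    - by apply/imsetP; exists Q'; rewrite ?inE ?QV'.
  by apply: contra nU; apply: U_sub.
move=> /imsetP[Q]; rewrite inE => /andP[QV PQ] ->.
move=> /imsetP[Q']; rewrite inE => /andP[QV' PQ'] ->.
move=> /and3P[lt /andP[lX _] /andP[rY _]].
have lr : l < r by move/forall_inP: lt => /(_ l lX)/forall_inP/(_ r rY).
apply: (h J Q Q') => //.
- apply: contraTneq rY => E; rewrite -E; apply/negP => rX.
  by move/forall_inP: lt => /(_ r rX)/forall_inP/(_ r); rewrite -E ltnn => /(_ rX).
- by rewrite -(mem_cover_component _ tS) ?dedge_adj.
- by rewrite -(mem_cover_component _ tS) ?dedge_adj.
Qed.

Variable e : rel 'S_n.
Hypothesis e_congr : lattice_congruence e.
Hypothesis e_simple : simple_congruence e.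
Hypothesis e_ess : essential e.
Local Notation U := (up_ok e).
Local Notation D := (down_ok e).

Lemma reachE S (P : pred (part n)) j : is_tree S ->
  [exists J in nodes S, (j \in J) && P J] = P (node_of S j).
Proof.
move=> tS; apply/exists_inP/idP => [[J JV /andP[jJ PJ]]|h].
  by rewrite (node_ofE tS JV jJ).
by exists (node_of S j); rewrite ?(node_in tS) ?(mem_node tS).
Qed.

Lemma mandatoryP S : sst S ->
  mandatory_arcs S \subset congruence_arcs e <-> mandatory U D S.
Proof.
move=> sS; have tS := sst_tree sS.
split=> [/subsetP h I K i k IV KV iI kK ik IK close|h].
  pose A j := reach S (node_of S j) I || reach S (node_of S j) K.
  apply/(mem_congruence_good e_congr e_simple A ik)/h.
  rewrite inE mkarc_all //=; apply/exists_inP; exists I => //; apply/exists_inP; exists K => //.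
  have cl j : btw i k j -> (j \notin I) && (j \notin K) by rewrite btw_lt //; apply: close.
  apply/and5P; split=> //; last (apply/andP; split).
  - apply/eqP/setP => j; rewrite !inE; apply/negP => /andP[/close/andP[/negPf-> /negPf->]] //.
  - apply/eqP/setP => j; rewrite !inE.
    by rewrite (reachE (fun J => connect (dedge S) J I || connect (dedge S) J K)).
  - apply/eqP/setP => j; rewrite !inE.
    rewrite (reachE (fun J => connect (dedge S) I J || connect (dedge S) K J)) //.
    case: (boolP (i < j < k)) => //= ijk; rewrite /A (adj_btw sS IV KV IK iI kK cl) ?negbK //.
    by rewrite btw_lt.
apply/subsetP => -[[[i k] A] B]; rewrite inE => /andP[/all_arcsE[ik ->]].
move=> /exists_inP[I IV /exists_inP[K KV /and5P[iI kK IK /eqP/setP close /andP[/eqP-> _]]]].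
pose A' j := reach S (node_of S j) I || reach S (node_of S j) K.
rewrite (mkarc_eq (A' := A')); last first.
  move=> j ijk; rewrite /= !inE ijk /=.
  by rewrite (reachE (fun J => connect (dedge S) J I || connect (dedge S) J K)).
apply/mem_congruence_good => //; apply: h => // j ijk.
by have := close j; rewrite !inE ijk /= => /negbT/norP[-> ->].
Qed.

Lemma admissibleP S : admissible_trees e S <-> adm U D S.
Proof.
have [U_sub D_sub _ _] := congruence_arc_relations e_congr e_ess.
have exP (F : part n -> {set {set part n}}) (f : 'I_n -> 'I_n -> quad n)
    (V : {set part n}) (a : quad n) :
  reflect (exists J (X Y : {set part n}) l r, [/\ J \in V, X \in F J, Y \in F J, gap X Y l r & a = f l r])
   [exists J in V, exists X in F J, exists Y in F J, exists l, exists r,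
     gap X Y l r && (a == f l r)].
  apply: (iffP exists_inP).
    move=> [J JV /exists_inP[X XF /exists_inP[Y YF /existsP[l /existsP[r /andP[g /eqP E]]]]]].
    by exists J, X, Y, l, r.
  move=> [J [X [Y [l [r [JV XF YF g E]]]]]]; exists J => //.
  apply/exists_inP; exists X => //; apply/exists_inP; exists Y => //.
  by apply/existsP; exists l; apply/existsP; exists r; rewrite g E eqxx.
split=> [[/sstP sS [mS dis]]|[sS mS fU fD]].
  split=> //; first exact/mandatoryP.
  - apply/(forbiddenP sS U_sub) => J X Y l r JV XF YF g; apply/negP => lr.
    have := disjointFl dis lr => /negbT/negP; apply; rewrite in_setU.
    by apply/orP; left; rewrite inE; apply/exP; exists J, X, Y, l, r.
  - apply/(forbiddenP (sst_op sS) D_sub) => J X Y l r JV.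
    rewrite ancestor_subtrees_op => XF YF g; apply/negP => lr.
    have := disjointFl dis lr => /negbT/negP; apply; rewrite in_setU.
    by apply/orP; right; rewrite inE; apply/exP; exists J, X, Y, l, r.
split; first exact/sstP; split; first exact/mandatoryP.
rewrite -setI_eq0; apply/eqP/setP => a; rewrite in_set0 in_setI in_setU.
apply/negP => /andP[/orP[]]; rewrite inE => /exP[J [X [Y [l [r [JV XF YF g ->]]]]]].
  exact/negP/((forbiddenP sS U_sub).2 fU J X Y l r JV XF YF g).
rewrite -ancestor_subtrees_op in XF YF.
exact/negP/((forbiddenP (sst_op sS) D_sub).2 fD J X Y l r JV XF YF g).
Qed.

End Bridge.

(** * The tree of a permutation *)

Section PermTree.

Variable n : nat.
Implicit Types (I J K P Q X Y : part n) (i j k l p q r a b z : 'I_n).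

Definition perm_tree (U D : rel 'I_n) (x : 'I_n -> nat) : digraph n :=
  ([set [set i] | i : 'I_n],
   [set ([set f.1], [set f.2]) | f : 'I_n * 'I_n & cov U D x f.1 f.2]).

Section Basics.

Variables (U D : rel 'I_n) (x : 'I_n -> nat).
Local Notation T := (perm_tree U D x).
Local Notation cov := (cov U D x).
Local Notation tle := (tle U D x).

Lemma perm_tree_edgeP X Y :
  reflect (exists i k, [/\ X = [set i], Y = [set k] & cov i k]) (dedge T X Y).
Proof.
apply: (iffP imsetP) => [[[i k]]|[i [k [-> -> ik]]]].
  by rewrite inE /= => ik [-> ->]; exists i, k.
by exists (i, k); rewrite ?inE.
Qed.

Lemma perm_tree_edge i k : dedge T [set i] [set k] = cov i k.
Proof.
apply/perm_tree_edgeP/idP => [[i' [k' [/set1_inj-> /set1_inj->]]] //|ik].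
by exists i, k.
Qed.

Lemma perm_tree_partition : partition (nodes T) [set: 'I_n].
Proof.
apply/and3P; split.
- apply/eqP/setP => i; rewrite inE; apply/bigcupP; exists [set i]; rewrite ?inE //.
  exact: imset_f.
- apply/trivIsetP => _ _ /imsetP[i _ ->] /imsetP[k _ ->] ne.
  by rewrite disjoints1 inE; apply: contra ne => /eqP->.
- by apply/negP => /imsetP[i _ /setP/(_ i)]; rewrite !inE eqxx.
Qed.

Lemma perm_tree_node i : node_of T i = [set i].
Proof.
have /and3P[_ tr _] := perm_tree_partition.
by apply: def_pblock => //; [exact: imset_f | rewrite inE].
Qed.

Lemma perm_tree_adj X Y : adj T X Y ->
  exists i k, [/\ X = [set i], Y = [set k] & cov i k || cov k i].
Proof.
case/orP => /perm_tree_edgeP[i [k [-> -> ik]]]; first by exists i, k; rewrite ik.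
by exists k, i; rewrite ik orbT.
Qed.

Hypothesis x_inj : injective x.

Lemma perm_tree_reach i k : reach T [set i] [set k] = tle i k.
Proof.
apply/connectP/idP => [[p]|/(tle_connect_cov x_inj)/connectP[p]].
  elim: p i => [|X p IH] i /=; first by move=> _ /set1_inj->; apply: connect0.
  move=> /andP[/perm_tree_edgeP[i' [j [/set1_inj<- -> ij]]] pX] l.
  exact: tle_trans (cov_le ij) (IH _ pX l).
elim: p i => [|j p IH] i /=; first by move=> _ ->; exists [::].
move=> /andP[ij pj] l; have [p' pp' l'] := IH j pj l.
by exists ([set j] :: p'); rewrite //= perm_tree_edge ij.
Qed.

End Basics.

Section Tree.

Variables (U D : rel 'I_n) (x : 'I_n -> nat) (N : nat).
Hypothesis UD : arc_relations U D.
Hypothesis x_inj : injective x.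
Hypothesis x_le : forall v, x v <= N.
Local Notation T := (perm_tree U D x).
Local Notation cov := (cov U D x).
Local Notation tle := (tle U D x).
Local Notation vis := (vis U D x).

Lemma same_side_or p l a b : same_side p l a -> b != p ->
  same_side p l b || btw a b p.
Proof. by rewrite neq_ord /same_side /btw; lia. Qed.

Lemma same_side_btw p l r : same_side p l r -> ~~ btw l r p.
Proof. by rewrite /same_side /btw; lia. Qed.

Lemma perm_tree_connected : {in nodes T &, forall I J, connect (adj T) I J}.
Proof.
have sym := sym_connect_sym (@adj_sym n T).
have reach_adj I J : reach T I J -> connect (adj T) I J.
  by apply: connect_sub => X Y XY; apply: connect1; rewrite /adj XY.
have up i k : i <= k -> connect (adj T) [set i] [set k].
  have [m] := ubnP (k - i); elim: m i k => // m IH i k hm ik.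
  case: (eqVneq i k) => [->|ne]; first exact: connect0.
  have lt : i < k := le_ne_lt ik ne.
  have hi : i.+1 < n := leq_ltn_trans lt (ltn_ord k).
  apply: (@connect_trans _ _ [set Ordinal hi]); last by apply: IH => /=; lia.
  case/orP: (@vis_succ n U D x x_inj i (Ordinal hi) UD erefl) => h.
    by apply: reach_adj; rewrite perm_tree_reach //; apply: connect1.
  by rewrite sym; apply: reach_adj; rewrite perm_tree_reach //; apply: connect1.
move=> _ _ /imsetP[i _ ->] /imsetP[k _ ->].
by case/orP: (leq_total i k) => h; [|rewrite sym]; apply: up.
Qed.

(** Only an edge passing over or under [p] changes sides. *)
Lemma stay_same_side p l a (s : seq (part n)) r :
    same_side p l a -> path (adj_avoiding T [set p]) [set a] s -> last [set a] s = [set r] ->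
    (forall i k, [set i] \in [set a] :: s -> cov i k -> ~~ btw i k p) ->
  same_side p l r.
Proof.
elim: s a => [|X s IH] a sa /=; first by move=> _ /set1_inj<-.
move=> /andP[/and3P[_ Xp aX] pX] lst no.
have [a' [b [/set1_inj<- E ab]]] := perm_tree_adj aX.
rewrite {}E {X aX} in Xp pX lst no.
have bp : b != p by apply: contra Xp => /eqP->.
apply: (IH b) => //; last by move=> i k ib; apply: no; rewrite inE ib orbT.
case/orP: (same_side_or sa bp) => // h; case/orP: ab => ab.
  by have := no a b (mem_head _ _) ab; rewrite h.
by have := no b a _ ab; rewrite btwC h !inE eqxx orbT => /(_ isT).
Qed.

(** The lowest value of a cycle would be covered from both of its sides by values
joined above it. *)
Lemma perm_tree_acyclic (c : seq (part n)) : 2 < size c -> ~ ucycle (adj T) c.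
Proof.
move=> sc uc; pose h X := \sum_(i in X) x i.
have h1 i : h [set i] = x i by rewrite /h big_set1.
have [X0 X0c] : exists X0, X0 \in c by case: c sc {uc} => // X0 c _; exists X0; rewrite mem_head.
case: (@arg_minnP _ X0 (mem c) h X0c) => P Pc Pmin.
have [m c' rotc] := rot_to Pc.
have uc' : ucycle (adj T) (P :: c') by rewrite -rotc rot_ucycle.
have mem' Y : Y \in P :: c' -> h P <= h Y by rewrite -rotc mem_rot => /Pmin.
have sc' : 2 < size (P :: c') by rewrite -rotc size_rot.
have [P' [Q [s [Q' [E PQ PQ' pth QQ']]]]] := cycle_split uc' sc'.
case: E mem' {uc' sc' rotc} => {c'} -> -> mem'.
have up Y : Y \in P' :: Q :: rcons s Q' -> adj T P' Y ->
    exists p l, [/\ P' = [set p], Y = [set l] & cov p l].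
  move=> Yc /perm_tree_adj[p [l [EP EY /orP[pl|lp]]]]; first by exists p, l.
  by have := cov_x lp; rewrite ltnNge -!h1 -EP -EY mem'.
have [|p [l [EP EQ pl]]] := up Q _ PQ; first by rewrite !inE eqxx orbT.
have [|p' [r [EP' EQ' pr]]] := up Q' _ PQ'; first by rewrite !inE mem_rcons mem_head !orbT.
move: EP' pr; rewrite EP => /set1_inj<- pr.
have lr : l != r by apply: contraNneq QQ' => E; rewrite EQ EQ' E.
have plr := cov_btw x_inj x_le pl pr lr.
have low a : [set a] \in Q :: rcons s Q' -> a != p -> x p < x a.
  move=> aQ ap; rewrite ltn_neqAle; apply/andP; split.
    by apply: contra ap => /eqP/x_inj->.
  by rewrite -!h1 -EP mem' // inE aQ orbT.
have [t [tp tl tm]] : exists t, [/\ path (adj_avoiding T [set p]) [set l] t,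
    last [set l] t = [set r] & {subset [set l] :: t <= Q :: rcons s Q'}].
  by exists (rcons s Q'); rewrite -EP -EQ -EQ' last_rcons; split.
have sl : same_side p l l by move: plr; rewrite /same_side /btw; clear; lia.
have no i k : [set i] \in [set l] :: t -> cov i k -> ~~ btw i k p.
  move=> it ik; apply/negP => bp.
  have ip : i != p by apply/eqP => E; move: bp; rewrite E /btw; clear; lia.
  exact: (no_arc_above x_inj x_le pl pr lr (cov_vis ik) bp (low i (tm _ it) ip)).
by have := same_side_btw (stay_same_side sl tp tl no); rewrite plr.
Qed.

Lemma perm_tree_is_tree : is_tree T.
Proof.
apply/is_treeP; first exact: perm_tree_partition.
split.
- by move=> I J /perm_tree_edgeP[i [k [-> -> _]]]; rewrite !imset_f.
- move=> I; apply/negP => /perm_tree_edgeP[i [k [-> /set1_inj<- /cov_x]]].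
  by rewrite ltnn.
- move=> I J /perm_tree_edgeP[i [k [-> -> /cov_x ik]]].
  by apply/negP; rewrite perm_tree_edge => /cov_x; lia.
- exact: perm_tree_connected.
- exact: perm_tree_acyclic.
Qed.

(** The values below [p] are reached from [p] through a child, never through the
parent [l]. *)
Lemma not_below p l a :
  cov p l -> cav T [set p] [set l] [set a] -> ~~ tle a p.
Proof.
move=> pl la; apply/negP => ap.
have pT : [set p] != [set l] by rewrite (dedge_neq perm_tree_is_tree) // perm_tree_edge.
have ap' : [set a] != [set p] by apply: (cav_neq la); rewrite eq_sym.
rewrite -perm_tree_reach // in ap.
have [Q [Qp aQ _]] := reach_last ap ap'.
have plT : dedge T [set p] [set l] by rewrite perm_tree_edge.
have E := tree_acyc perm_tree_is_tree (dedge_adj plT) (dedge_adj' Qp) (cav_trans la aQ).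
by have := tree_asym perm_tree_is_tree plT; rewrite E Qp.
Qed.

Lemma cover_same_side p l r a : cov p l -> cov p r -> l != r ->
  cav T [set p] [set l] [set a] -> same_side p l a.
Proof.
move=> pl pr lr /connectP[s ps ls].
have plr := cov_btw x_inj x_le pl pr lr.
have sl : same_side p l l by move: plr; rewrite /same_side /btw; clear; lia.
apply: (stay_same_side sl ps) => // i k it ik; apply/negP => bp.
have li : cav T [set p] [set l] [set i].
  case/splitPl: it ps {ls} => s1 s2 E; rewrite cat_path => /andP[p1 _].
  by apply/connectP; exists s1.
have [xik noik _] := visP _ _ _ _ _ (cov_vis ik).
case/orP: (noik p bp) => xp.
  exact: (no_arc_above x_inj x_le pl pr lr (cov_vis ik) bp xp).
have kp := vis_above x_inj x_le (cov_vis ik) bp xp.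
have := not_below pl li; rewrite (tle_trans _ kp) //.
exact: cov_le ik.
Qed.

Lemma perm_tree_separated : separated T.
Proof.
move=> P Q Q' /perm_tree_edgeP[p [l [-> -> pl]]] /perm_tree_edgeP[p' [r [/set1_inj<- -> pr]]] ne.
have lr : l != r by apply: contraNneq ne => ->.
have rl : r != l by rewrite eq_sym.
exists p; first by rewrite inE.
have plr := cov_btw x_inj x_le pl pr lr.
have side a b : cav T [set p] [set l] (node_of T a) -> cav T [set p] [set r] (node_of T b) ->
    same_side p l a /\ same_side p r b.
  rewrite !perm_tree_node => la rb.
  by rewrite (cover_same_side pl pr lr la) (cover_same_side pr pl rl rb).
case: (ltnP l p) => lp; [left|right] => a b la rb; have := side a b la rb;
  by move: plr lp; rewrite /btw /same_side; clear; lia.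
Qed.

(** Take [m] closest to [p]: only values placed before [p] lie between them, so that arcs
starting at [m] may pass above [p]. *)
Lemma nearest_above p l : cov p l ->
  exists m : 'I_n, [/\ same_side p l m, minn p l <= m <= maxn p l, x p < x m &
    forall j, btw p m j -> x j < x p].
Proof.
move=> pl; have xpl := cov_x pl.
have lp : l != p by apply/eqP => E; rewrite E ltnn in xpl.
pose P z := same_side p l z && (x p < x z).
have Pl : P l by rewrite /P xpl andbT; move: lp; rewrite neq_ord /same_side; clear; lia.
case: (@arg_minnP _ l P (dist p) Pl) => m /andP[sm xpm] mmin; exists m; split=> //.
  by have := mmin l Pl; move: sm; rewrite /same_side /dist; clear; lia.
move=> j bj; rewrite ltnNge leq_eqVlt; apply/negP => /orP[/eqP/x_inj E|xpj].
  by move: bj; rewrite -E /btw; clear; lia.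
have : P j by rewrite /P xpj andbT; move: bj sm; rewrite /btw /same_side; clear; lia.
by move/mmin; move: bj; rewrite /btw /dist; clear; lia.
Qed.

Lemma perm_tree_forbidden : forbidden U T.
Proof.
have [U_sub _ _ D1] := UD.
move=> P Q Q' i k /perm_tree_edgeP[p [l [-> -> pl]]] /perm_tree_edgeP[p' [r [/set1_inj<- -> pr]]] ne.
rewrite !perm_tree_node => li rk ik.
have lr : l != r by apply: contraNneq ne => ->.
have rl : r != l by rewrite eq_sym.
have plr := cov_btw x_inj x_le pl pr lr.
have [si sk] := (cover_same_side pl pr lr li, cover_same_side pr pl rl rk).
have beyond q a (m : 'I_n) : cov p q -> cav T [set p] [set q] [set a] ->
    same_side p q a -> minn p q <= m <= maxn p q ->
    (forall j, btw p m j -> x j < x p) -> ~~ btw p m a.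
  move=> pq qa sa mq mj; apply/negP => bma; have xap := mj a bma.
  have := not_below pq qa; rewrite (vis_below x_inj (cov_vis pq)) //.
  by move: bma mq; rewrite /btw; clear; lia.
have [m [sm ml xm mj]] := nearest_above pl.
have [m' [sm' ml' xm' mj']] := nearest_above pr.
have im := beyond _ _ _ pl li si ml mj.
have km' := beyond _ _ _ pr rk sk ml' mj'.
have [im' mm' mk'] : [/\ i <= m, m < m' & m' <= k].
  by move: im km' si sk sm sm' plr ik; rewrite /btw /same_side; clear; split; lia.
apply/negP => Uik.
have Umm : U m m' := U_sub _ _ _ _ im' mm' mk' Uik.
have mp : btw m m' p by move: sm sm' plr; rewrite /btw /same_side; clear; lia.
have low j : btw m m' j -> x j <= x p.
  move=> bj; case: (eqVneq j p) => [->//|jp].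
  have /orP[/mj|/mj'] : btw p m j || btw p m' j; try exact: ltnW.
  by move: bj jp mp; rewrite neq_ord /btw; clear; lia.
have vis_mm a b : (a = m /\ b = m') \/ (a = m' /\ b = m) -> x p < x a -> x a < x b -> vis a b.
  move=> ab xpa xab.
  have bab j : btw a b j -> btw m m' j by case: ab => -[-> ->]; rewrite // btwC.
  apply/visP; split=> // [j /bab/low xj|c d cd ac db]; first by rewrite (leq_ltn_trans xj).
  have h j : c < j < d -> x j < x a.
    move=> jcd; apply: leq_ltn_trans xpa; apply/low/bab.
    by move: jcd ac db; rewrite /btw; clear; lia.
  split=> hA.
    have [mc dm] : m <= c /\ d <= m' by move: ac db mm'; case: ab => -[-> ->]; clear; lia.
    exact: U_sub mc cd dm Umm.
  apply: D1; apply/eqP; rewrite eqn_leq cd andbT leqNgt; apply/negP => cd'.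
  have hj : c.+1 < n := ltn_trans cd' (ltn_ord d).
  have cj : c < Ordinal hj < d by rewrite /= ltnSn.
  by have := hA _ cj; rewrite h.
have ne' : m != m' by rewrite lt_ne.
have : x m != x m' by apply: contra ne' => /eqP/x_inj->.
rewrite neq_ltn => /orP[h|h].
- have v : vis m m' by apply: vis_mm => //; left.
  exact: (no_arc_above x_inj x_le pl pr lr v mp xm).
- have v : vis m' m by apply: vis_mm => //; right.
  by apply: (no_arc_above x_inj x_le pl pr lr v _ xm'); rewrite btwC.
Qed.

Lemma perm_tree_mandatory : mandatory U D T.
Proof.
have main a b : cov a b -> good U D a b
    (fun j => reach T (node_of T j) [set a] || reach T (node_of T j) [set b]).
  move=> ab; have [xab noab g] := visP _ _ _ _ _ (cov_vis ab).
  apply: good_ext g => j bj; rewrite perm_tree_node !perm_tree_reach //.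
  apply/idP/idP => [xj|/orP[]/tle_x xj]; first by rewrite (vis_below x_inj (cov_vis ab)).
    have ja : j != a by apply/eqP => E; move: bj; rewrite E /btw; clear; lia.
    by rewrite ltn_neqAle xj andbT; apply: contra ja => /eqP/x_inj->.
  by case/orP: (noab j bj) => //; rewrite ltnNge xj.
move=> I K i k /imsetP[i' _ ->] /imsetP[k' _ ->]; rewrite !inE => /eqP<- /eqP<- ik.
case/orP => [/eqP/set1_inj E|]; first by rewrite E ltnn in ik.
rewrite /adj !perm_tree_edge => /orP[|] h _; first exact: main.
by apply: good_ext (good_swap (main _ _ h)) => j _; rewrite orbC.
Qed.

End Tree.

Lemma perm_tree_dual (U D : rel 'I_n) x N : (forall v, x v <= N) ->
  op (perm_tree U D x) = perm_tree D U (fun v => N - x v).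
Proof.
move=> x_le; congr (_, _); apply/setP => -[X Y].
apply/imsetP/imsetP => [[_ /imsetP[[i k] + ->] [-> ->]]|[[k i]]]; rewrite inE /= => ik.
  by exists (k, i); rewrite ?inE //= cov_dual.
move=> [-> ->]; exists ([set i], [set k]) => //; apply/imsetP; exists (i, k) => //.
by rewrite inE /= -(cov_dual _ _ x_le).
Qed.

Lemma perm_tree_adm (U D : rel 'I_n) x N : arc_relations U D -> injective x ->
  (forall v, x v <= N) -> adm U D (perm_tree U D x).
Proof.
move=> UD x_inj x_le.
have DU := arc_relations_dual UD.
have x'_inj := dual_inj x_inj x_le.
have x'_le v : N - x v <= N by apply: leq_subr.
split.
- split; [exact: perm_tree_is_tree | exact: perm_tree_separated |].
  by rewrite (perm_tree_dual _ _ x_le); apply: perm_tree_separated.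
- exact: perm_tree_mandatory.
- exact: perm_tree_forbidden.
- by rewrite (perm_tree_dual _ _ x_le); apply: perm_tree_forbidden.
Qed.

End PermTree.

(** * Contractions *)

Section Contract.

Variables (n : nat) (S : digraph n) (I K : part n).
Hypothesis tS : is_tree S.
Hypothesis IK : dedge S I K.
Implicit Types (P Q X Y Z : part n) (i j k a b c d : 'I_n).

Local Notation S' := (contract S (I, K)).
Local Notation pi := (merge_parts (I, K)).
Local Notation V := (nodes S).

Let IV : I \in V. Proof. by case/andP: (tree_edge_nodes tS IK). Qed.
Let KV : K \in V. Proof. by case/andP: (tree_edge_nodes tS IK). Qed.
Let I_K : I != K. Proof. exact: (dedge_neq tS IK). Qed.

Definition merged X := (X == I) || (X == K).

Lemma pi_merged X : merged X -> pi X = I :|: K.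
Proof. by rewrite /merged /merge_parts /= => ->. Qed.

Lemma pi_id X : ~~ merged X -> pi X = X.
Proof. by rewrite /merged /merge_parts /= => /negPf->. Qed.

Lemma sub_pi X : X \subset pi X.
Proof.
rewrite /merge_parts; case: ifP => // /orP[]/eqP->; [exact: subsetUl|exact: subsetUr].
Qed.

Lemma mem_pi X i : X \in V -> i \in pi X -> pi (node_of S i) = pi X.
Proof.
move=> XV; case: (boolP (merged X)) => mX; last first.
  by rewrite pi_id // => iX; rewrite (node_ofE tS XV iX) pi_id.
rewrite (pi_merged mX) inE => /orP[iX|iX].
  by rewrite (node_ofE tS IV iX) pi_merged // /merged eqxx.
by rewrite (node_ofE tS KV iX) pi_merged // /merged eqxx orbT.
Qed.

Lemma pi_inj X Y : X \in V -> Y \in V -> pi X = pi Y ->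
  X = Y \/ (merged X && merged Y).
Proof.
move=> XV YV; have not_union Z : Z \in V -> ~~ merged Z -> Z != I :|: K.
  move=> ZV nZ; apply: contra nZ => /eqP E; have [i iI] := node_neq0 tS IV.
  have iZ : i \in Z by rewrite E inE -{1}iI mem_node.
  by rewrite /merged -(node_ofE tS ZV iZ) iI eqxx.
case: (boolP (merged X)) => mX; case: (boolP (merged Y)) => mY; first by right.
- by rewrite (pi_merged mX) (pi_id mY) => E; have := not_union Y YV mY; rewrite E eqxx.
- by rewrite (pi_merged mY) (pi_id mX) => E; have := not_union X XV mX; rewrite E eqxx.
- by rewrite !pi_id //; left.
Qed.

Lemma merged_adj X Y : merged X -> merged Y -> X != Y -> adj S X Y.
Proof.
move=> /orP[]/eqP-> /orP[]/eqP->; rewrite ?eqxx // => _; first exact: dedge_adj.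
exact: dedge_adj'.
Qed.

Lemma contract_nodeP X' : reflect (exists2 X, X \in V & X' = pi X) (X' \in nodes S').
Proof. exact: imsetP. Qed.

Lemma contract_edgeP X' Y' :
  reflect (exists X Y, [/\ dedge S X Y, (X, Y) != (I, K), X' = pi X & Y' = pi Y])
          (dedge S' X' Y').
Proof.
apply: (iffP imsetP) => [[[X Y]]|[X [Y [XY ne -> ->]]]].
  by rewrite !inE /= => /andP[ne XY] [-> ->]; exists X, Y.
by exists (X, Y); rewrite ?inE ?ne.
Qed.

Lemma contract_partition : partition (nodes S') [set: 'I_n].
Proof.
have piP X i : X \in V -> i \in pi X -> pi X = pi (node_of S i).
  by move=> XV iX; rewrite (mem_pi XV iX).
apply/and3P; split.
- apply/eqP/setP => i; rewrite inE; apply/bigcupP; exists (pi (node_of S i)).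
    exact/imset_f/node_in.
  exact: (subsetP (sub_pi _)) (mem_node tS i).
- apply/trivIsetP => _ _ /imsetP[X XV ->] /imsetP[Y YV ->] ne.
  rewrite -setI_eq0; apply: contraNT ne => /set0Pn[i]; rewrite inE => /andP[iX iY].
  by rewrite (piP X i) // (piP Y i).
- apply/negP => /imsetP[X XV E]; have [i iX] := node_neq0 tS XV.
  have : i \in pi X by apply: (subsetP (sub_pi X)); rewrite -iX mem_node.
  by rewrite -E inE.
Qed.

Lemma contract_node i : node_of S' i = pi (node_of S i).
Proof.
have /and3P[_ tr _] := contract_partition.
apply: def_pblock => //; first exact/imset_f/node_in.
exact: (subsetP (sub_pi _)) (mem_node tS i).
Qed.

Lemma contract_edge_neq X Y : dedge S X Y -> (X, Y) != (I, K) -> pi X != pi Y.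
Proof.
move=> XY ne; have /andP[XV YV] := tree_edge_nodes tS XY.
apply/eqP => /(pi_inj XV YV)[E|/andP[mX mY]].
  by have := tree_irr tS X; rewrite {2}E XY.
have nXY := dedge_neq tS XY.
case/orP: mX XY ne nXY => /eqP->; case/orP: mY => /eqP->; rewrite ?eqxx //.
by move=> KI _ _; have := tree_asym tS IK; rewrite KI.
Qed.

Lemma contract_adjP X' Y' : adj S' X' Y' ->
  exists X Y, [/\ adj S X Y, pi X != pi Y, X' = pi X & Y' = pi Y].
Proof.
case/orP => /contract_edgeP[X [Y [XY ne -> ->]]].
  by exists X, Y; rewrite contract_edge_neq // dedge_adj.
by exists Y, X; rewrite eq_sym contract_edge_neq // dedge_adj'.
Qed.

Lemma contract_adj X Y : adj S X Y -> (pi X == pi Y) || adj S' (pi X) (pi Y).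
Proof.
have main A B : dedge S A B -> (pi A == pi B) || dedge S' (pi A) (pi B).
  move=> AB; case: (eqVneq (A, B) (I, K)) => [[-> ->]|ne].
    by rewrite !pi_merged /merged ?eqxx ?orbT.
  by apply/orP; right; apply/contract_edgeP; exists A, B.
case/orP => /main /orP[/eqP->|h]; rewrite ?eqxx //; first by rewrite dedge_adj ?orbT.
by rewrite dedge_adj' ?orbT.
Qed.

Lemma contract_reach X Y : reach S X Y -> reach S' (pi X) (pi Y).
Proof.
move/connectP => [p]; elim: p X => [|Z p IH] X /=; first by move=> _ ->; apply: connect0.
move=> /andP[XZ pZ] l; have {}IH := IH Z pZ l.
case: (eqVneq (X, Z) (I, K)) => [[EX EZ]|ne].
  by rewrite EX pi_merged /merged ?eqxx // -[_ :|: _](@pi_merged Z) // EZ /merged eqxx orbT.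
by apply: reach_trans IH; apply/reach1/contract_edgeP; exists X, Z.
Qed.

Lemma same_pi_cav P X Y : P \in V -> X \in V -> Y \in V ->
  pi X = pi Y -> pi X != pi P -> cav S P X Y.
Proof.
move=> PV XV YV E XP; case: (pi_inj XV YV E) => [->|/andP[mX mY]]; first exact: connect0.
case: (eqVneq X Y) => [->|XY]; first exact: connect0.
apply: cav_edge (merged_adj mX mY XY).
  by apply: contraNneq XP => ->.
by apply: contraNneq XP => EY; rewrite E EY.
Qed.

(** A step of a path of the contraction lifts to an edge; the lifts of two consecutive
steps differ at most by the contracted edge, which avoids [P] because [P] is then not
one of its endpoints. *)
Lemma cav_lift P X Y : P \in V -> X \in V -> Y \in V -> pi X != pi P ->
  cav S' (pi P) (pi X) (pi Y) -> cav S P X Y.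
Proof.
move=> PV XV YV XP /connectP[p]; elim: p X XV XP => [|Z' p IH] X XV XP /=.
  by move=> _ E; apply: same_pi_cav.
move=> /andP[/and3P[_ ZP /contract_adjP[X1 [Z [XZ nXZ EX EZ]]]] pZ] l.
rewrite {}EZ {Z'} in ZP pZ l; have /andP[X1V ZV] := adj_nodes tS XZ.
apply: cav_trans (same_pi_cav PV XV X1V EX XP) _.
apply: (@cav_trans _ _ _ Z); last exact: IH.
apply: cav_edge XZ; last by apply: contraNneq ZP => ->.
by apply: contraNneq XP => E; rewrite EX E.
Qed.

(** If the two neighbours come from different endpoints of the contracted edge, then the
endpoint [P1] is a neighbour of [P] on the side of [R], hence of [Q]. *)
Lemma contract_acyc P' Q' R' :
  adj S' P' Q' -> adj S' P' R' -> cav S' P' Q' R' -> Q' = R'.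
Proof.
move=> /contract_adjP[P [Q [PQ nPQ -> ->]]] /contract_adjP[P1 [R [PR nPR EP ->]]] QR.
have [/andP[PV QV] /andP[P1V RV]] := (adj_nodes tS PQ, adj_nodes tS PR).
have QP : pi Q != pi P by rewrite eq_sym.
have {}QR := cav_lift PV QV RV QP QR.
case: (pi_inj PV P1V EP) => [E|/andP[mP mP1]].
  by rewrite -E in PR; rewrite (tree_acyc tS PQ PR QR).
case: (eqVneq P P1) => [E|ne]; first by rewrite -E in PR; rewrite (tree_acyc tS PQ PR QR).
have PP1 := merged_adj mP mP1 ne.
have RP : R != P by apply: contraNneq nPR => ->; rewrite EP.
have RP1 : cav S P R P1 by rewrite cav_sym; apply: cav_edge => //; rewrite eq_sym.
by move: nPQ; rewrite (tree_acyc tS PQ PP1 (cav_trans QR RP1)) EP eqxx.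
Qed.

Lemma contract_is_tree : is_tree S'.
Proof.
split.
- exact: contract_partition.
- move=> X Y /contract_edgeP[X1 [Y1 [/(tree_edge_nodes tS)/andP[XV YV] _ -> ->]]].
  by rewrite !imset_f.
- move=> X; apply/negP => /contract_edgeP[X1 [Y1 [XY ne EX EY]]].
  by have := contract_edge_neq XY ne; rewrite -EX -EY eqxx.
- move=> X' Y' /contract_edgeP[X [Y [XY ne -> ->]]].
  apply/negP => /contract_edgeP[Y1 [X1 [YX ne' EY EX]]].
  have nXY := contract_edge_neq XY ne.
  have [/andP[XV YV] /andP[Y1V X1V]] := (tree_edge_nodes tS XY, tree_edge_nodes tS YX).
  (* otherwise I, K and a common neighbour Z form a triangle *)
  have tri Z : adj S Z I -> adj S Z K -> False.
    move=> ZI ZK; have := tree_acyc tS ZI ZK.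
    rewrite cav_edge ?dedge_adj 1?eq_sym ?(adj_neq tS) // => /(_ isT) E.
    by move: (I_K); rewrite E eqxx.
  have tri' Z X1' X2' : merged X1' -> merged X2' -> X1' != X2' -> adj S Z X1' -> adj S Z X2' -> False.
    move=> /orP[]/eqP-> /orP[]/eqP->; rewrite ?eqxx // => _ h1 h2;
      [exact: tri h1 h2 | exact: tri h2 h1].
  case: (pi_inj XV X1V EX) => [E1|/andP[mX mX1]]; case: (pi_inj YV Y1V EY) => [E2|/andP[mY mY1]].
  + by have := tree_asym tS XY; rewrite E1 E2 YX.
  + case: (eqVneq Y Y1) => [E2|ne2]; first by have := tree_asym tS XY; rewrite E1 E2 YX.
    by apply: (tri' X Y Y1) => //; [apply: dedge_adj | rewrite E1; apply: dedge_adj'].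
  + case: (eqVneq X X1) => [E1|ne1]; first by have := tree_asym tS XY; rewrite E1 E2 YX.
    by apply: (tri' Y X X1) => //; [apply: dedge_adj' | rewrite E2; apply: dedge_adj].
  + by move: nXY; rewrite !pi_merged ?eqxx.
- move=> _ _ /imsetP[X XV ->] /imsetP[Y YV ->].
  have /connectP[p] := tree_conn tS XV YV.
  elim: p X XV => [|Z p IH] X XV /=; first by move=> _ ->; apply: connect0.
  move=> /andP[XZ pZ] l; have /andP[_ ZV] := adj_nodes tS XZ.
  have {}IH := IH Z ZV pZ l.
  case/orP: (contract_adj XZ) => [/eqP->//|h]; exact: connect_trans (connect1 h) IH.
- exact: contract_acyc.
Qed.

(** A pair of parents of a node of the contraction comes from a pair of parents of
one of its preimages; if the two parents come from different endpoints of the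
contracted edge, its target serves as second parent of its source. *)
Lemma turn_lift P' Q' R' : dedge S' P' Q' -> dedge S' P' R' -> Q' != R' ->
  exists P Q R, [/\ dedge S P Q, dedge S P R, Q != R, P \subset P' &
    (forall X, X \in V -> cav S' P' Q' (pi X) -> cav S P Q X) /\
    (forall X, X \in V -> cav S' P' R' (pi X) -> cav S P R X)].
Proof.
move=> /contract_edgeP[P [Q [PQ nPQ -> ->]]] /contract_edgeP[P1 [R [PR nPR EP ->]]] QR.
have [/andP[PV QV] /andP[P1V RV]] := (tree_edge_nodes tS PQ, tree_edge_nodes tS PR).
have hPQ := contract_edge_neq PQ nPQ; have hPR := contract_edge_neq PR nPR.
have QP : pi Q != pi P by rewrite eq_sym.
have RP1 : pi R != pi P1 by rewrite eq_sym.
have RP : pi R != pi P by rewrite EP.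
have QP1 : pi Q != pi P1 by rewrite -EP.
have QR1 : Q != R by apply: contraNneq QR => ->.
case: (eqVneq P P1) => [E|ne].
  rewrite -E in PR; exists P, Q, R; split=> //; first exact: sub_pi.
  by split=> X XV; apply: cav_lift.
have [//|/andP[mP mP1]] : P = P1 \/ (merged P && merged P1) by apply: pi_inj.
  by move=> E; rewrite E eqxx in ne.
(* the parent K of I sees everything seen by a parent Z of K *)
have viaK Z X : Z \in V -> X \in V -> dedge S K Z -> pi Z != pi I ->
    cav S' (pi I) (pi Z) (pi X) -> cav S I K X.
  move=> ZV XV KZ nZ ZX; have ZI : Z != I by apply: contraNneq nZ => ->.
  have KI : K != I by rewrite eq_sym.
  exact: cav_trans (cav_edge KI ZI (dedge_adj KZ)) (cav_lift IV ZV XV nZ ZX).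
have pIK : pi I = pi K by rewrite !pi_merged // /merged eqxx ?orbT.
case/orP: mP mP1 PQ PR nPQ nPR EP QP RP QP1 RP1 ne hPQ hPR => /eqP->; case/orP => /eqP->; rewrite ?eqxx //.
- move=> PQ PR nPQ nPR EP QP RP QP1 RP1 _ hPQ hPR; exists I, Q, K; split=> //.
  + by apply: contraNneq nPQ => ->.
  + exact: sub_pi.
  + by split=> X XV; [apply: cav_lift | apply: viaK].
- move=> PQ PR nPQ nPR EP QP RP QP1 RP1 _ hPQ hPR; exists I, K, R; split=> //.
  + by rewrite eq_sym; apply: contraNneq nPR => ->.
  + by rewrite EP; exact: sub_pi.
  + by rewrite EP; split=> X XV; [apply: viaK | apply: cav_lift].
Qed.

Lemma contract_separated : separated S -> separated S'.
Proof.
move=> sS P' Q' R' PQ' PR' QR'.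
have [P [Q [R [PQ PR QR sub [hQ hR]]]]] := turn_lift PQ' PR' QR'.
have [p pP h] := sS P Q R PQ PR QR; exists p; first exact: (subsetP sub).
by case: h => h; [left|right] => a b; rewrite !contract_node => /(hQ _ (node_in tS a)) ha
  /(hR _ (node_in tS b)) hb; apply: h.
Qed.

Lemma contract_forbidden U : forbidden U S -> forbidden U S'.
Proof.
move=> fS P' Q' R' i k PQ' PR' QR'.
have [P [Q [R [PQ PR QR sub [hQ hR]]]]] := turn_lift PQ' PR' QR'.
rewrite !contract_node => /(hQ _ (node_in tS i)) hi /(hR _ (node_in tS k)) hk.
exact: fS PQ PR QR hi hk.
Qed.

End Contract.

Section ContractAdm.

Variable n : nat.
Implicit Types (S : digraph n) (I J K P Q X Y Z : part n) (i j k a b c d : 'I_n).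

Lemma contract_op S I K : contract (op S) (K, I) = op (contract S (I, K)).
Proof.
have pi_eq : merge_parts (K, I) =1 merge_parts (I, K).
  by move=> X; rewrite /merge_parts /= orbC setUC.
congr (_, _); first exact: eq_imset.
rewrite -imset_comp; apply/setP => f; apply/imsetP/imsetP => [[g]|[g]].
- rewrite in_setD1 => /andP[ne /imsetP[h hS E]] ->; exists h; last by rewrite E /= !pi_eq.
  by rewrite in_setD1 hS andbT; apply: contra ne => /eqP Eh; rewrite E Eh.
- rewrite in_setD1 => /andP[ne hS] ->; exists (g.2, g.1); last by rewrite /= !pi_eq.
  rewrite in_setD1; apply/andP; split; last exact: imset_f.
  by apply: contra ne => /eqP[<- <-]; case: (g).
Qed.

(** Among the values of the two nodes [X] and [Y], those closest to the gap between [a]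
and [b] are the endpoints of a mandatory arc. It passes above the gap because no node
of [W] lies below a value of the gap. *)
Lemma crossing_up U D S (W : pred (part n)) X Y a b c0 d0 :
  arc_relations U D -> adm U D S -> {subset W <= nodes S} -> a < b ->
  (forall w j, W w -> a < j < b -> ~~ reach S w (node_of S j)) ->
  W X -> W Y -> (X == Y) || adj S X Y -> c0 \in X -> c0 <= a -> d0 \in Y -> b <= d0 ->
  U a b.
Proof.
move=> [U_sub _ _ _] aS WV ab noW WX WY XY c0X c0a d0Y bd0.
have [sS _ _ _] := aS; have [tS _ _] := sS.
have out j Z : W Z -> j \in Z -> ~~ (a < j < b).
  move=> WZ jZ; apply/negP => /(noW Z j WZ).
  by rewrite (node_ofE tS (WV _ WZ) jZ) reach_refl.
pose XYset := [pred z | (z \in X) || (z \in Y)].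
pose Pc z := XYset z && (z <= a); pose Pd z := XYset z && (b <= z).
have Pc0 : Pc c0 by rewrite /Pc /= c0X.
have Pd0 : Pd d0 by rewrite /Pd /= d0Y orbT.
case: (@arg_maxnP _ c0 Pc val Pc0) => c /andP[cXY ca] cmax.
case: (@arg_minnP _ d0 Pd val Pd0) => d /andP[dXY bd] dmin.
have nodeXY z : XYset z -> (node_of S z = X \/ node_of S z = Y) /\ W (node_of S z).
  move=> /orP[zX|zY]; first by rewrite (node_ofE tS (WV _ WX) zX); split=> //; left.
  by rewrite (node_ofE tS (WV _ WY) zY); split=> //; right.
have [cN cW] := nodeXY c cXY; have [dN dW] := nodeXY d dXY.
have close j : btw c d j -> (j \notin X) && (j \notin Y).
  move=> bj; rewrite -negb_or; apply/negP => jXY.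
  have jab : ~~ (a < j < b) by case/orP: jXY; [apply: out WX | apply: out WY].
  case: (leqP j a) => ja.
    by have := cmax j; rewrite /Pc /= jXY ja /= => /(_ isT); move: bj ca bd ab; rewrite /btw; clear; lia.
  have bj' : b <= j by move: jab ja; clear; lia.
  by have := dmin j; rewrite /Pd /= jXY bj' /= => /(_ isT); move: bj ca bd ab; rewrite /btw; clear; lia.
have close' j : btw c d j -> (j \notin node_of S c) && (j \notin node_of S d).
  by move/close => /andP[h1 h2]; case: cN dN => -> [] ->; rewrite ?h1 ?h2.
have cd_adj : (node_of S c == node_of S d) || adj S (node_of S c) (node_of S d).
  case: cN dN => -> [] ->; rewrite ?eqxx //.
  by rewrite eq_sym adj_sym.
have cd : c < d := leq_ltn_trans ca (leq_trans ab bd).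
have cd' : c != d by rewrite lt_ne.
have g := adm_mandatory aS (node_in tS c) (node_in tS d) (mem_node tS c)
  (mem_node tS d) cd' cd_adj close'.
have ca' : minn c d <= a by rewrite (minn_idPl (ltnW cd)).
have bd' : b <= maxn c d by rewrite (maxn_idPr (ltnW cd)).
have [gU _] := g a b ab ca' bd'; apply: gU => j jab.
have bj : btw c d j by move: jab ca bd; rewrite /btw; clear; lia.
rewrite (adj_btw sS (node_in tS c) (node_in tS d) cd_adj (mem_node tS c) (mem_node tS d) close' bj).
by apply/norP; split; apply: noW.
Qed.

(** The nodes above the lower endpoint of the mandatory arc form a connected set in the
original tree, with values on both sides of the gap between [a] and [b]. So one of the
edges of this set crosses the gap. *)
Lemma contract_mandatory_up U D S S' I K P' Q' i k a b :
  arc_relations U D -> adm U D S -> dedge S I K -> S' = contract S (I, K) ->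
  P' \in nodes S' -> Q' \in nodes S' -> P' = Q' \/ dedge S' P' Q' ->
  i \in P' -> k \in Q' ->
  (forall j, btw i k j -> (j \notin P') && (j \notin Q')) ->
  minn i k <= a -> a < b -> b <= maxn i k ->
  (forall j, a < j < b -> ~~ reach S' P' (node_of S' j)) ->
  U a b.
Proof.
move=> UD aS IK ES PV QV PQ iP kQ close ia ab bk low.
have [sS _ _ _] := aS; have [tS _ _] := sS.
have tS' : is_tree S' by rewrite ES; apply: contract_is_tree.
pose pi := merge_parts (I, K).
have nS' j : node_of S' j = pi (node_of S j) by rewrite ES; apply: contract_node.
have P'i : reach S' P' (node_of S' i) by rewrite (node_ofE tS' PV iP); apply: reach_refl.
have P'k : reach S' P' (node_of S' k).
  rewrite (node_ofE tS' QV kQ); case: PQ => [->|/reach1//]; exact: reach_refl.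
pose above z := reach S' P' (node_of S' z).
have ends z : (z = i \/ z = k) -> above z by case=> ->.
(* enlarge the gap until its ends lie above P' *)
have [m [m' [mm mm' am am']]] : exists m m' : 'I_n, [/\ m = minn i k :> nat,
    m' = maxn i k :> nat, above m & above m'].
  case: (leqP i k) => ik.
    by exists i, k.
  by exists k, i.
pose Pa z := above z && (z <= a); pose Pb z := above z && (b <= z).
have Pam : Pa m by rewrite /Pa am mm ia.
have Pbm : Pb m' by rewrite /Pb am' mm' bk.
case: (@arg_maxnP _ m Pa val Pam) => a' /andP[aa' a'a] amax.
case: (@arg_minnP _ m' Pb val Pbm) => b' /andP[bb' bb] bmin.
have [U_sub _ _ _] := UD.
have ab' : a' < b' := leq_ltn_trans a'a (leq_trans ab bb).
apply: (U_sub a' b' a b a'a ab bb).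
have low' j : a' < j < b' -> ~~ above j.
  move=> /andP[aj jb]; apply/negP => abj; case: (leqP j a) => ja.
    by have := amax j; rewrite /Pa abj ja => /(_ isT) /=; rewrite leqNgt aj.
  case: (leqP b j) => bj.
    by have := bmin j; rewrite /Pb abj bj => /(_ isT) /=; rewrite leqNgt jb.
  by have := low j; rewrite ja bj => /(_ isT); rewrite -/(above j) abj.
pose W X := (X \in nodes S) && reach S' P' (pi X).
have WV : {subset W <= nodes S} by move=> X /andP[].
have noW w j : W w -> a' < j < b' -> ~~ reach S w (node_of S j).
  move=> /andP[_ P'w] /low'; apply: contra => wj; rewrite /above nS'.
  by apply: (reach_trans P'w); rewrite ES; apply: contract_reach.
apply/negPn/negP => nU.
(* every node of W then lies to the left of the gap *)
have cross := crossing_up UD aS WV ab' noW.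
pose left X := forall d, d \in X -> d <= a'.
have out X d : W X -> d \in X -> d <= a' \/ b' <= d.
  move=> WX dX; case: (leqP d a') => da; first by left.
  case: (leqP b' d) => bd; first by right.
  have := low' d; rewrite da bd => /(_ isT); rewrite /above nS' (node_ofE tS (WV _ WX) dX).
  by case/andP: WX => _ ->.
have step X Y : W X -> W Y -> (X == Y) || adj S X Y -> left X -> left Y.
  move=> WX WY XY lX d dY; case: (out Y d WY dY) => // bd; case/negP: nU.
  have [c cX] := node_neq0 tS (WV _ WX); have cX' : c \in X by rewrite -cX mem_node.
  exact: cross WX WY XY cX' (lX c cX') dY bd.
have Wnode z : above z -> W (node_of S z).
  by move=> abz; rewrite /W node_in //= -nS'.
have same X Y : W X -> W Y -> pi X = pi Y -> left X -> left Y.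
  move=> WX WY E; apply: step => //.
  case: (pi_inj tS IK (WV _ WX) (WV _ WY) E) => [->|/andP[mX mY]]; first by rewrite eqxx.
  by case: (eqVneq X Y) => //= ne; apply: (merged_adj IK).
have climb X Y : W X -> W Y -> reach S' (pi X) (pi Y) -> (left X <-> left Y).
  move=> WX WY /connectP[p]; elim: p X WX => [|Z' p IH] X WX /=.
    by move=> _ E; split; apply: same.
  rewrite {1}ES => /andP[/contract_edgeP[X1 [Z [XZ nXZ EX EZ]]] pZ] l.
  have [X1V ZV] := andP (tree_edge_nodes tS XZ).
  have WX1 : W X1 by rewrite /W X1V /=; case/andP: WX => _; rewrite EX.
  have WZ : W Z.
    rewrite /W ZV /=; case/andP: WX1 => _ h; apply: reach_trans h _.
    by rewrite ES; apply/reach1/contract_edgeP; exists X1, Z.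
  rewrite EZ in pZ l.
  apply: iff_trans (IH Z WZ pZ l); split=> h.
    by apply: (step X1) => //; rewrite ?dedge_adj ?orbT //; apply: same h.
  by apply: (same X1) => //; apply: (step Z) => //; rewrite ?dedge_adj' ?orbT.
have start : left (node_of S a').
  move=> d da; case: (out _ _ (Wnode _ aa') da) => // bd; case/negP: nU.
  have aN := mem_node tS a'.
  by apply: cross (Wnode _ aa') (Wnode _ aa') _ aN (leqnn a') da bd; rewrite eqxx.
have [P PV' EP] : exists2 P, P \in nodes S & P' = pi P.
  by apply/contract_nodeP; rewrite -ES.
have WP : W P by rewrite /W PV' /= -EP; apply: reach_refl.
have lP : left P by apply/(climb P _ WP (Wnode _ aa')) => //; rewrite -EP -nS'.
have lb : left (node_of S b') by apply/(climb P _ WP (Wnode _ bb')) => //; rewrite -EP -nS'.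
by have := lb b' (mem_node tS b'); rewrite leqNgt ab'.
Qed.

Lemma contract_sst S I K : sst S -> dedge S I K -> sst (contract S (I, K)).
Proof.
case=> tS uS oS IK; split; first exact: contract_is_tree.
  exact: contract_separated.
rewrite -contract_op; apply: contract_separated => //; first exact: is_tree_op.
by rewrite dedge_op.
Qed.

(** Down arcs are handled by contracting the reversed edge in the reversed tree. *)
Lemma contract_adm U D S I K : arc_relations U D -> adm U D S -> dedge S I K ->
  adm U D (contract S (I, K)).
Proof.
move=> UD aS IK; have [sS mS uS oS] := aS; have [tS _ _] := sS.
have sS' := contract_sst sS IK; have tS' := sst_tree sS'.
set S' := contract S (I, K) in sS' tS' *.
split=> //; last first.
- rewrite -contract_op; apply: contract_forbidden oS; first exact: is_tree_op.
  by rewrite dedge_op.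
- exact: contract_forbidden.
have main P Q i k : P \in nodes S' -> Q \in nodes S' -> P = Q \/ dedge S' P Q ->
    i \in P -> k \in Q -> (forall j, btw i k j -> (j \notin P) && (j \notin Q)) ->
    good U D i k (fun j => reach S' (node_of S' j) P || reach S' (node_of S' j) Q).
  move=> PV QV PQ iP kQ close a b ab ia bk.
  have PQ' : (P == Q) || adj S' P Q.
    by case: PQ => [->|/dedge_adj->]; rewrite ?eqxx ?orbT.
  have bt j : a < j < b -> btw i k j by move: ia bk; rewrite /btw; clear; lia.
  have dual j : a < j < b -> _ := fun h => adj_btw sS' PV QV PQ' iP kQ close (bt j h).
  split=> h.
    apply: (contract_mandatory_up UD aS IK erefl PV QV PQ iP kQ close ia ab bk) => j jab.
    by have := h j jab; rewrite dual // => /norP[].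
  have IK' : dedge (op S) K I by rewrite dedge_op.
  have E : op S' = contract (op S) (K, I) by rewrite contract_op.
  apply: (@contract_mandatory_up _ _ _ (op S') K I Q P k i a b
            (arc_relations_dual UD) (adm_op aS) IK' E) => //.
  - by case: PQ => [->|PQ]; [left | right; rewrite dedge_op].
  - by move=> j; rewrite btwC => /close; rewrite andbC.
  - by rewrite minnC.
  - by rewrite maxnC.
  - by move=> j /h /norP[_ hQ]; rewrite reach_op.
move=> P Q i k PV QV iP kQ ik PQ close.
have close' j : btw i k j -> (j \notin P) && (j \notin Q).
  by rewrite btw_lt //; apply: close.
case/or3P: PQ => [/eqP E|PQ|QP].
- by apply: main => //; left.
- by apply: main => //; right.
- apply: good_ext (good_swap (main Q P k i _ _ _ _ _ _)) => //; last 1 first.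
  + by move=> j; rewrite btwC => /close'; rewrite andbC.
  + by move=> j _; rewrite orbC.
  + by right.
Qed.

End ContractAdm.

(** * The cones of admissible trees *)

Section TreeOrder.

Variable n : nat.
Implicit Types (S T : digraph n) (I J K P Q X Y Z : part n) (i j k a b c d : 'I_n).

Lemma mem_node_of S i k : is_tree S -> (k \in node_of S i) = (node_of S k == node_of S i).
Proof.
move=> tS; apply/idP/eqP => [h|<-]; last exact: mem_node.
by apply: node_ofE; rewrite ?node_in.
Qed.

Lemma reach_cav S J X Y : reach S X Y -> ~~ reach S J Y -> cav S J X Y.
Proof.
move/connectP => [p]; elim: p X => [|Z p IH] X /=; first by move=> _ ->; rewrite /cav connect0.
move=> /andP[XZ pZ] l nJ.
have ZY : reach S Z Y by apply/connectP; exists p.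
have XY : reach S X Y := reach_trans (reach1 XZ) ZY.
have XJ : X != J by apply: contraNneq nJ => <-.
have ZJ : Z != J by apply: contraNneq nJ => <-.
exact: (cav_trans (cav_edge XJ ZJ (dedge_adj XZ)) (IH Z pZ l nJ)).
Qed.

(** A node strictly between [I] and [J] would yield a second path from [I] to [J]. *)
Lemma edge_cover S I J Q : is_tree S -> dedge S I J -> reach S I Q -> reach S Q J ->
  Q != I -> Q = J.
Proof.
move=> tS IJ IQ QJ QI; apply/eqP/negPn/negP => QnJ.
have [R [RJ QR rQR]] := reach_last QJ QnJ.
have nJQ : ~~ reach S J Q.
  by apply/negP => JQ; rewrite (reach_anti tS QJ JQ) eqxx in QnJ.
have E := tree_acyc tS (dedge_adj' IJ) (dedge_adj' RJ) (cav_trans (reach_cav IQ nJQ) QR).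
rewrite -E in rQR; by rewrite (reach_anti tS rQR IQ) eqxx in QI.
Qed.

(** By [edge_cover], a tree is the Hasse diagram of its order. *)
Lemma tree_eq S T : is_tree S -> is_tree T ->
  (forall i k, reach S (node_of S i) (node_of S k) = reach T (node_of T i) (node_of T k)) ->
  S = T.
Proof.
move=> tS tT h.
have same i k : (node_of S i == node_of S k) = (node_of T i == node_of T k).
  apply/eqP/eqP => E.
    by apply: (reach_anti tT); rewrite -h E reach_refl.
  by apply: (reach_anti tS); rewrite h E reach_refl.
have N i : node_of S i = node_of T i.
  by apply/setP => k; rewrite !mem_node_of // same.
have sub S1 T1 : is_tree S1 -> is_tree T1 -> node_of S1 =1 node_of T1 ->
    {subset nodes S1 <= nodes T1}.
  by move=> t1 t2 E X XV; have [i <-] := node_neq0 t1 XV; rewrite E node_in.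
have subE S1 T1 : is_tree S1 -> is_tree T1 -> node_of S1 =1 node_of T1 ->
    (forall i k, reach S1 (node_of S1 i) (node_of S1 k) = reach T1 (node_of T1 i) (node_of T1 k)) ->
    {subset edges S1 <= edges T1}.
  move=> t1 t2 EN E [X Y] XY; have /andP[XV YV] := tree_edge_nodes t1 XY.
  have [[i Ei] [k Ek]] := (node_neq0 t1 XV, node_neq0 t1 YV).
  have R1 Z1 Z2 : Z1 \in nodes S1 -> Z2 \in nodes S1 -> reach S1 Z1 Z2 = reach T1 Z1 Z2.
    move=> h1 h2; have [[a <-] [b <-]] := (node_neq0 t1 h1, node_neq0 t1 h2).
    by rewrite E !EN.
  have XY2 : reach T1 X Y by rewrite -R1 //; apply: reach1.
  have [Q [XQ _ QY]] := reach_first XY2 (dedge_neq t1 XY).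
  have /andP[_ QV] := tree_edge_nodes t2 XQ.
  have QV1 : Q \in nodes S1.
    by have [q <-] := node_neq0 t2 QV; rewrite -EN node_in.
  have XQ1 : reach S1 X Q by rewrite R1 // reach1.
  have QY1 : reach S1 Q Y by rewrite R1.
  have QX : Q != X by rewrite eq_sym (dedge_neq t2 XQ).
  by rewrite -(edge_cover t1 XY XQ1 QY1 QX).
have EV : nodes S = nodes T.
  by apply/setP => X; apply/idP/idP; apply: sub => // i; rewrite N.
have EE : edges S = edges T.
  by apply/setP => X; apply/idP/idP; apply: subE => // i k; rewrite ?N // h.
by case: S T EV EE {tS tT h same N sub subE} => [V E] [V' E'] /= -> ->.
Qed.

Lemma contraction_ind (P : digraph n -> digraph n -> Prop) (A : digraph n -> Prop) :
  (forall S, A S -> P S S) ->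
  (forall S I K T, A S -> dedge S I K -> P (contract S (I, K)) T -> P S T) ->
  (forall S I K, A S -> dedge S I K -> A (contract S (I, K))) ->
  forall S T, A S -> contraction_le S T -> A T /\ P S T.
Proof.
move=> refl step stepA S T AS /connectP[p]; elim: p S AS => [|S' p IH] S AS /=.
  by move=> _ ->; split=> //; apply: refl.
move=> /andP[/exists_inP[[I K] IK /eqP E] pS'] l.
have AS' : A S' by rewrite E; apply: stepA.
by have [AT PT] := IH S' AS' pS' l; split=> //; apply: step IK _ => //; rewrite -E.
Qed.

Lemma contraction_step1 S I K : dedge S I K -> contraction_le S (contract S (I, K)).
Proof. by move=> IK; apply/connect1/exists_inP; exists (I, K). Qed.

Lemma contraction_reach S T : sst S -> contraction_le S T ->
  sst T /\ forall i k, reach S (node_of S i) (node_of S k) -> reach T (node_of T i) (node_of T k).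
Proof.
apply: (@contraction_ind (fun S T => forall i k, reach S (node_of S i) (node_of S k) ->
  reach T (node_of T i) (node_of T k))) => [//|S1 I K T1 sS IK h i k ik|S1 I K].
  by apply: h; rewrite !(contract_node (sst_tree sS) IK); apply: contract_reach.
exact: contract_sst.
Qed.

Lemma contraction_adm U D S T : arc_relations U D -> adm U D S -> contraction_le S T ->
  adm U D T.
Proof.
move=> UD aS ST; have [] := @contraction_ind (fun _ _ => True) (adm U D) _ _ _ S T aS ST => //.
by move=> S1 I K; apply: contract_adm.
Qed.

Lemma contract_card S I K : is_tree S -> dedge S I K ->
  #|nodes (contract S (I, K))| < #|nodes S|.
Proof.
move=> tS IK; have /andP[IV KV] := tree_edge_nodes tS IK.
rewrite ltn_neqAle leq_imset_card andbT; apply/negP => /imset_injP/(_ I K IV KV).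
rewrite !pi_merged /merged ?eqxx ?orbT // => /(_ erefl) E.
by have := dedge_neq tS IK; rewrite E eqxx.
Qed.

Lemma contraction_anti S T : sst S -> sst T -> contraction_le S T -> contraction_le T S -> S = T.
Proof.
have card S1 T1 : sst S1 -> contraction_le S1 T1 -> S1 = T1 \/ #|nodes T1| < #|nodes S1|.
  move=> sS ST.
  have [] := @contraction_ind (fun S T => S = T \/ #|nodes T| < #|nodes S|) (@sst n)
    _ _ _ S1 T1 sS ST => //; first by left.
  - move=> S2 I K T2 sS2 IK h; right; have := contract_card (sst_tree sS2) IK.
    by case: h => [<-//|]; apply: ltn_trans.
  - by move=> S2 I K; apply: contract_sst.
move=> sS sT /(card _ _ sS)[//|h1] /(card _ _ sT)[//|h2].
by have := ltn_trans h1 h2; rewrite ltnn.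
Qed.

End TreeOrder.

Section Cones.

Variables (R : realType) (n : nat).
Local Notation vec := 'rV[R]_n.
Implicit Types (S T : digraph n) (I J K P Q X Y Z : part n) (i j k a b c d : 'I_n).
Implicit Types (x y : vec).
Local Open Scope ring_scope.

Definition tree_cone S : set vec := fun x =>
  forall i k, reach S (node_of S i) (node_of S k) -> x ord0 i <= x ord0 k.

(** The relative interior of [tree_cone S]. *)
Definition tree_relint S x : Prop :=
  forall i k, reach S (node_of S i) (node_of S k) ->
    x ord0 i <= x ord0 k /\ (x ord0 k <= x ord0 i -> node_of S i = node_of S k).

Lemma tree_relint_cone S x : tree_relint S x -> tree_cone S x.
Proof. by move=> h i k /h[]. Qed.

Lemma tree_relint_lt S x i k : tree_relint S x ->
  reach S (node_of S i) (node_of S k) -> node_of S i != node_of S k -> x ord0 i < x ord0 k.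
Proof.
move=> h /h[_ h2] ne; rewrite real_ltNge ?num_real //; apply: contra ne => /h2 ->.
by rewrite eqxx.
Qed.

Lemma tree_cone_node S x i k : tree_cone S x -> node_of S i = node_of S k ->
  x ord0 i = x ord0 k.
Proof. by move=> h E; apply/le_anti; rewrite !h // E reach_refl. Qed.

Lemma tree_cone_edges S x : is_tree S ->
  (forall i k, node_of S i = node_of S k \/ dedge S (node_of S i) (node_of S k) ->
     x ord0 i <= x ord0 k) -> tree_cone S x.
Proof.
move=> tS h i k /connectP[p]; elim: p i => [|Z p IH] i /=.
  by move=> _ E; apply: h; left.
move=> /andP[iZ pZ] l; have /andP[_ ZV] := tree_edge_nodes tS iZ.
have [z Ez] := node_neq0 tS ZV; rewrite -Ez in iZ pZ l.
by apply: Order.POrderTheory.le_trans (IH z pZ l); apply: h; right.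
Qed.

Lemma tree_relint_edges S x : is_tree S -> tree_cone S x ->
  (forall i k, dedge S (node_of S i) (node_of S k) -> x ord0 i < x ord0 k) ->
  tree_relint S x.
Proof.
move=> tS cx h i k ik; split=> [|ki]; first exact: cx.
apply/eqP/negPn/negP => ne; have [Q [iQ _ Qk]] := reach_first ik ne.
have /andP[_ QV] := tree_edge_nodes tS iQ.
have [q Eq] := node_neq0 tS QV; rewrite -Eq in iQ Qk.
have := lt_le_trans (h _ _ iQ) (cx _ _ Qk); rewrite real_ltNge ?num_real //.
by rewrite ki.
Qed.

(** The number of nodes below each node is a strictly increasing labelling. *)
Lemma tree_relint_exists S : is_tree S -> exists x, tree_relint S x.
Proof.
move=> tS; pose c X := #|[set w in nodes S | reach S w X]|.
exists (\row_i (c (node_of S i))%:R) => i k ik; rewrite !mxE !ler_nat.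
have sub : [set w in nodes S | reach S w (node_of S i)] \subset
           [set w in nodes S | reach S w (node_of S k)].
  by apply/subsetP => w; rewrite !inE => /andP[-> /= wi]; apply: reach_trans wi ik.
split=> [|ki]; first exact: subset_leq_card.
have E : [set w in nodes S | reach S w (node_of S i)] =
         [set w in nodes S | reach S w (node_of S k)].
  by apply/eqP; rewrite eqEcard sub.
apply: (reach_anti tS ik); move/setP: E => /(_ (node_of S k)).
by rewrite !inE node_in // reach_refl /=.
Qed.

Lemma contraction_cone S T : sst S -> contraction_le S T -> (tree_cone T `<=` tree_cone S)%classic.
Proof. by move=> sS ST x cx i k /(contraction_reach sS ST).2; apply: cx. Qed.

(** The mandatory arc of an edge of [S'] passes above values whose coordinates in [x] are at
most that of its source, and below values whose coordinates are at least that of its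
target. So its sides respect the order of [S], and its endpoints are comparable in
[S]. *)
Lemma relint_reach U D S S' x : adm U D S -> adm U D S' ->
  tree_relint S x -> tree_relint S' x ->
  forall i k, reach S' (node_of S' i) (node_of S' k) -> reach S (node_of S i) (node_of S k).
Proof.
move=> aS aS' rS rS'; have [sS' _ _ _] := aS'; have [sS _ _ _] := aS.
have [tS tS'] := (sst_tree sS, sst_tree sS').
have cS' := tree_relint_cone rS'.
have close_pair i k : i != k ->
    node_of S' i = node_of S' k \/ dedge S' (node_of S' i) (node_of S' k) ->
    (forall j, btw i k j -> (j \notin node_of S' i) && (j \notin node_of S' k)) ->
    reach S (node_of S i) (node_of S k).
  move=> ik IK close.
  have IK' : (node_of S' i == node_of S' k) || adj S' (node_of S' i) (node_of S' k).
    by case: IK => [->|/dedge_adj->]; rewrite ?eqxx ?orbT.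
  have rik : reach S' (node_of S' i) (node_of S' k).
    by case: IK => [->|/reach1//]; apply: reach_refl.
  have xik := cS' _ _ rik.
  have [iV kV] := (node_in tS' i, node_in tS' k).
  have [iN kN] := (mem_node tS' i, mem_node tS' k).
  have g := adm_mandatory aS' iV kV iN kN ik IK' close.
  have := good_comparable aS g _ _ => /(_ _ _)/orP[||//|ki].
  - move=> j bj ne ji; have xji := tree_relint_lt rS ji ne.
    apply/negPn; rewrite (adj_btw sS' iV kV IK' iN kN close bj) negbK.
    apply/negP => /orP[/cS' xij|/cS' xkj].
      by have := lt_le_trans xji xij; rewrite ltxx.
    by have := lt_le_trans xji (Order.POrderTheory.le_trans xik xkj); rewrite ltxx.
  - move=> j bj ne ij; have ne' : node_of S i != node_of S j by rewrite eq_sym.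
    have xij := tree_relint_lt rS ij ne'.
    rewrite (adj_btw sS' iV kV IK' iN kN close bj) negbK.
    case/orP: (edge_btw sS' iV kV IK iN kN close bj) => [/cS' xji|->]; last by rewrite orbT.
    by have := lt_le_trans xij xji; rewrite ltxx.
  - have [_ E] := rS _ _ ki; by rewrite (E xik) reach_refl.
have same i k : node_of S' i = node_of S' k -> node_of S i = node_of S k.
  have [m] := ubnP (dist i k); elim: m i k => // m IH i k hm E.
  case: (eqVneq i k) => [->//|ik].
  case: (boolP [exists j, btw i k j && (j \in node_of S' i)]) => [/existsP[j /andP[bj ji]]|no].
    have Ej : node_of S' j = node_of S' i by apply/eqP; rewrite -mem_node_of.
    rewrite -(IH j i) //; last by move: bj hm; rewrite /btw /dist; clear; lia.
    by apply: IH; rewrite ?Ej //; move: bj hm; rewrite /btw /dist; clear; lia.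
  have rik : reach S (node_of S i) (node_of S k).
    apply: close_pair => //; first by left.
    move=> j bj; rewrite -E andbb; apply: contra no => ji; apply/existsP; exists j.
    by rewrite bj.
  by have [_ ->] := rS _ _ rik => //; rewrite (tree_cone_node cS' E).
have edge i k : dedge S' (node_of S' i) (node_of S' k) -> reach S (node_of S i) (node_of S k).
  have [m] := ubnP (dist i k); elim: m i k => // m IH i k hm IK.
  have ik : i != k by apply: contraTneq IK => ->; apply: tree_irr.
  case: (boolP [exists j, btw i k j && (j \in node_of S' i)]) => [/existsP[j /andP[bj ji]]|noi].
    have Ej : node_of S' j = node_of S' i by apply/eqP; rewrite -mem_node_of.
    rewrite -(same j i) //; apply: IH; rewrite ?Ej //.
    by move: bj hm; rewrite /btw /dist; clear; lia.
  case: (boolP [exists j, btw i k j && (j \in node_of S' k)]) => [/existsP[j /andP[bj jk]]|nok].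
    have Ej : node_of S' j = node_of S' k by apply/eqP; rewrite -mem_node_of.
    rewrite -(same j k) //; apply: IH; rewrite ?Ej //.
    by move: bj hm; rewrite /btw /dist; clear; lia.
  apply: close_pair => //; first by right.
  move=> j bj; apply/andP; split; [apply: contra noi|apply: contra nok] => h;
    by apply/existsP; exists j; rewrite bj.
move=> i k /connectP[p]; elim: p i => [|Z p IH] i /=.
  by move=> _ E; rewrite (same i k) ?reach_refl.
move=> /andP[iZ pZ] l; have /andP[_ ZV] := tree_edge_nodes tS' iZ.
have [z Ez] := node_neq0 tS' ZV; rewrite -Ez in iZ pZ l.
exact: reach_trans (edge _ _ iZ) (IH z pZ l).
Qed.

Lemma relint_unique U D S S' x : adm U D S -> adm U D S' ->
  tree_relint S x -> tree_relint S' x -> S = S'.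
Proof.
move=> aS aS' rS rS'; apply: tree_eq; try exact: (sst_tree (adm_sst _)).
- exact: (sst_tree (adm_sst aS)).
- exact: (sst_tree (adm_sst aS')).
- move=> i k; apply/idP/idP; [exact: relint_reach aS' aS rS' rS i k |
    exact: relint_reach aS aS' rS rS' i k].
Qed.

End Cones.

Section Faces.

Variables (R : realType) (n : nat).
Local Notation vec := 'rV[R]_n.
Implicit Types (S T : digraph n) (I J K P Q X Y Z : part n) (i j k a b c d : 'I_n).
Implicit Types (x y : vec).
Local Open Scope ring_scope.

Lemma tight_merge S I K x i k : is_tree S -> dedge S I K -> tree_cone S x ->
  (forall i k, i \in I -> k \in K -> x ord0 i = x ord0 k) ->
  merge_parts (I, K) (node_of S i) = merge_parts (I, K) (node_of S k) ->
  x ord0 i = x ord0 k.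
Proof.
move=> tS IK cx tight E.
case: (pi_inj tS IK (node_in tS i) (node_in tS k) E) => [|/andP[]].
  exact: tree_cone_node.
have [iN kN] := (mem_node tS i, mem_node tS k).
case: (eqVneq (node_of S i) (node_of S k)) => [/(tree_cone_node cx)//|ne].
move=> /orP[]/eqP Ei /orP[]/eqP Ek; rewrite Ei Ek ?eqxx // in ne iN kN.
  exact: tight.
by rewrite (tight k i).
Qed.

Lemma contract_cone S I K x : is_tree S -> dedge S I K -> tree_cone S x ->
  (forall i k, i \in I -> k \in K -> x ord0 i = x ord0 k) ->
  tree_cone (contract S (I, K)) x.
Proof.
move=> tS IK cx tight; apply: tree_cone_edges; first exact: contract_is_tree.
have tm := tight_merge tS IK cx tight.
move=> i k; rewrite !(contract_node tS IK) => -[/tm-> //|/contract_edgeP].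
move=> [X [Y [XY _ EX EY]]]; have /andP[XV YV] := tree_edge_nodes tS XY.
have [[a Ea] [b Eb]] := (node_neq0 tS XV, node_neq0 tS YV).
rewrite -Ea in EX XY; rewrite -Eb in EY XY.
by rewrite (tm _ _ EX) (tm _ _ EY); apply: cx; apply: reach1.
Qed.

(** Contracting one by one the edges that are tight at [x] leads to the tree having
[x] in its relative interior. *)
Lemma relint_contraction S x : sst S -> tree_cone S x ->
  exists S', [/\ contraction_le S S', tree_relint S' x &
    forall y, tree_cone S y ->
      (forall i k, dedge S (node_of S i) (node_of S k) ->
         x ord0 i = x ord0 k -> y ord0 i = y ord0 k) -> tree_cone S' y].
Proof.
have [m] := ubnP #|nodes S|; elim: m S => // m IH S hm sS cx.
have tS := sst_tree sS.
case: (boolP [exists i, exists k, dedge S (node_of S i) (node_of S k) && (x ord0 i == x ord0 k)]); last first.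
  rewrite negb_exists => /forallP no; exists S; split=> //; first exact: connect0.
  apply: tree_relint_edges => // i k ik; rewrite lt_neqAle cx ?andbT; last exact: reach1.
  have := no i; rewrite negb_exists => /forallP/(_ k); by rewrite ik.
move=> /existsP[i0 /existsP[k0 /andP[IK /eqP x0]]].
set I := node_of S i0 in IK; set K := node_of S k0 in IK.
have cst y i k : tree_cone S y -> i \in I -> k \in K -> y ord0 i0 = y ord0 k0 ->
    y ord0 i = y ord0 k.
  rewrite !mem_node_of // => cy /eqP Ei /eqP Ek E.
  by rewrite (tree_cone_node cy Ei) (tree_cone_node cy Ek).
have cx1 : tree_cone (contract S (I, K)) x.
  by apply: contract_cone => // i k iI kK; apply: cst.
have hm1 := leq_trans (contract_card tS IK) (hm : #|nodes S| <= m)%N.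
have [S' [SS' rS' hS']] := IH (contract S (I, K)) hm1 (contract_sst sS IK) cx1.
exists S'; split=> //; first exact: connect_trans (contraction_step1 IK) SS'.
move=> y cy tight; have y0 : y ord0 i0 = y ord0 k0 by apply: tight.
apply: hS'; first by apply: contract_cone => // i k iI kK; apply: cst.
have tmx := tight_merge tS IK cx (fun i k iI kK => cst x i k cx iI kK x0).
have tmy := tight_merge tS IK cy (fun i k iI kK => cst y i k cy iI kK y0).
move=> i k; rewrite !(contract_node tS IK) => /contract_edgeP[X [Y [XY _ EX EY]]] xik.
have /andP[XV YV] := tree_edge_nodes tS XY.
have [[a Ea] [b Eb]] := (node_neq0 tS XV, node_neq0 tS YV).
rewrite -Ea in EX XY; rewrite -Eb in EY XY.
rewrite (tmy _ _ EX) (tmy _ _ EY); apply: tight => //.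
by rewrite -(tmx _ _ EX) -(tmx _ _ EY).
Qed.

Lemma dotDr (a : vec) x y : dot a (x + y) = dot a x + dot a y.
Proof. by rewrite /dot -big_split; apply: eq_bigr => i _; rewrite mxE mulrDr. Qed.

Lemma dotZr (a : vec) (c : R) x : dot a (c *: x) = c * dot a x.
Proof. by rewrite /dot mulr_sumr; apply: eq_bigr => i _; rewrite mxE mulrCA. Qed.

Lemma dotNr (a : vec) x : dot a (- x) = - dot a x.
Proof. by rewrite -scaleN1r dotZr mulN1r. Qed.

Lemma tree_coneD S x y : tree_cone S x -> tree_cone S y -> tree_cone S (x + y).
Proof. by move=> cx cy i k ik; rewrite !mxE lerD ?cx ?cy. Qed.

(** The face is the cone of the contraction [S'] of the edges tight at a generic point
[x0] of the face: for [y] in this cone, a large multiple of [x0] minus [y] stays in the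
cone, so that the linear form defining the face cannot be negative at [y]. *)
Lemma face_contraction S (F : set vec) : sst S -> nonempty_faces (tree_cone S) F ->
  exists2 S', contraction_le S S' & F = tree_cone S'.
Proof.
move=> sS [[z0 Fz0] [a EF]].
have c0 : tree_cone S (0 : vec) by move=> i k _; rewrite !mxE.
have dot0 : dot a (0 : vec) = 0 by rewrite -(scale0r 0) dotZr mul0r.
have max0 x : F x -> dot a x = 0.
  rewrite EF => -[cx mx]; apply/le_anti/andP; split; last by have := mx 0 c0; rewrite dot0.
  by have := mx _ (tree_coneD cx cx); rewrite dotDr gerDl.
have Fin x : F x <-> tree_cone S x /\ dot a x = 0.
  split=> [Fx|[cx ax]]; first by split; [move: Fx; rewrite EF => -[]|apply: max0].
  have [_ mz] : maximizers (tree_cone S) a z0 by rewrite -EF.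
  by rewrite EF; split=> // y cy; rewrite ax -(max0 _ Fz0); apply: mz.
have neg y : tree_cone S y -> dot a y <= 0.
  have [_ mz] : maximizers (tree_cone S) a z0 by rewrite -EF.
  by move=> cy; rewrite -(max0 _ Fz0); apply: mz.
pose tight (x : vec) := [set p : 'I_n * 'I_n |
  dedge S (node_of S p.1) (node_of S p.2) && (x ord0 p.1 == x ord0 p.2)].
(* a point of F with as few tight edges as possible *)
have [x0 Fx0 min0] : exists2 x, F x & forall y, F y -> tight x \subset tight y.
  have [m] := ubnP #|tight z0|; elim: m z0 Fz0 => // m IH z Fz hm.
  case: (boolP (`[< forall y, F y -> tight z \subset tight y >])) => [/asboolP h|/asboolPn].
    by exists z.
  move=> /existsNP[y /not_implyP[Fy /negP nsub]].
  have [[cz az] [cy ay]] := ((Fin z).1 Fz, (Fin y).1 Fy).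
  have Fzy : F (z + y).
    by apply/Fin; split; [apply: tree_coneD | rewrite dotDr az ay addr0].
  apply: (IH (z + y)) => //; apply: (leq_trans _ (hm : #|tight z| <= m)%N); apply: proper_card.
  have tight_both p : p \in tight (z + y) -> (p \in tight z) && (p \in tight y).
    rewrite !inE !mxE => /andP[ep /eqP E]; rewrite ep /=.
    have hz := cz _ _ (reach1 ep); have hy := cy _ _ (reach1 ep).
    apply/andP; split; rewrite eq_le ?hz ?hy /=.
      by rewrite -(lerD2r (y ord0 p.1)) E lerD2l.
    by rewrite -(lerD2l (z ord0 p.1)) E lerD2r.
  apply/properP; split; first by apply/subsetP => p /tight_both/andP[].
  have /subsetPn[p pz py] := nsub; exists p => //; apply/negP => /tight_both/andP[_].
  by rewrite (negPf py).
have [cx0 ax0] := (Fin x0).1 Fx0.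
have [S' [SS' rS' hS']] := relint_contraction sS cx0.
exists S' => //; apply/seteqP; split=> y.
  move=> Fy; apply: hS' => [|i k ik xik]; first by have [] := (Fin y).1 Fy.
  have /subsetP/(_ (i, k)) := min0 y Fy; rewrite !inE /= ik xik eqxx /= => /(_ isT).
  by move/eqP.
move=> cy; have cyS := contraction_cone sS SS' cy.
apply/Fin; split=> //; apply/le_anti; rewrite neg //=.
(* a large multiple of x0 minus y is still in the cone *)
pose N := \sum_(p : 'I_n * 'I_n) if x0 ord0 p.1 < x0 ord0 p.2 then
  `|y ord0 p.2 - y ord0 p.1| / (x0 ord0 p.2 - x0 ord0 p.1) else 0.
have cN : tree_cone S' (N *: x0 - y).
  move=> i k ik; rewrite !mxE; have [xik eqn] := rS' _ _ ik.
  case: (boolP (x0 ord0 i < x0 ord0 k)) => [lt|]; last first.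
    rewrite -real_leNgt ?num_real // => /eqn E.
    by rewrite (tree_cone_node cy E) (tree_cone_node (tree_relint_cone rS') E).
  have pos : 0 < x0 ord0 k - x0 ord0 i by rewrite subr_gt0.
  have : `|y ord0 k - y ord0 i| / (x0 ord0 k - x0 ord0 i) <= N.
    rewrite /N (bigD1 (i, k)) //= lt lerDl; apply: sumr_ge0 => p _.
    by case: ifP => // h; rewrite divr_ge0 // subr_ge0 ltW.
  rewrite ler_pdivrMr // => h.
  have {}h : y ord0 k - y ord0 i <= N * (x0 ord0 k - x0 ord0 i).
    exact: Order.POrderTheory.le_trans (ler_norm _) h.
  rewrite -subr_ge0; rewrite -subr_ge0 in h.
  have -> // : N * x0 ord0 k - y ord0 k - (N * x0 ord0 i - y ord0 i) =
    N * (x0 ord0 k - x0 ord0 i) - (y ord0 k - y ord0 i) by ring.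
have := neg _ (contraction_cone sS SS' cN).
by rewrite dotDr dotZr ax0 mulr0 add0r dotNr oppr_le0.
Qed.

(** The linear form to maximize is the sum of the opposites of the slacks of the edges
tight at [x]. *)
Lemma contraction_face S S' x : sst S -> contraction_le S S' -> tree_relint S' x ->
  (forall y, tree_cone S y ->
     (forall i k, dedge S (node_of S i) (node_of S k) ->
        x ord0 i = x ord0 k -> y ord0 i = y ord0 k) -> tree_cone S' y) ->
  nonempty_faces (tree_cone S) (tree_cone S' : set vec).
Proof.
move=> sS SS' rx hx; have [sS' reach'] := contraction_reach sS SS'.
have cx := tree_relint_cone rx.
split; first by exists x.
pose T (p : 'I_n * 'I_n) := dedge S (node_of S p.1) (node_of S p.2) && (x ord0 p.1 == x ord0 p.2).
pose a : vec := \row_j \sum_(p | T p) ((p.1 == j)%:R - (p.2 == j)%:R).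
have dota y : dot a y = \sum_(p | T p) (y ord0 p.1 - y ord0 p.2).
  rewrite /dot; under eq_bigr => j _ do rewrite mxE mulr_suml.
  rewrite exchange_big; apply: eq_bigr => p _.
  have delta i : \sum_j (i == j)%:R * y ord0 j = y ord0 i.
    rewrite (bigD1 i) //= eqxx mul1r big1 ?addr0 // => j ji.
    by rewrite eq_sym (negPf ji) mul0r.
  by under eq_bigr => j _ do rewrite mulrBl; rewrite sumrB !delta.
have le0 y p : tree_cone S y -> T p -> y ord0 p.1 - y ord0 p.2 <= 0.
  by move=> cy /andP[ep _]; rewrite subr_le0; apply/cy/reach1.
have tight y p : tree_cone S' y -> T p -> y ord0 p.1 - y ord0 p.2 = 0.
  move=> cy /andP[ep /eqP E]; apply/eqP; rewrite subr_eq0; apply/eqP.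
  have [_ eqn] := rx _ _ (reach' _ _ (reach1 ep)).
  by apply: (tree_cone_node cy); apply: eqn; rewrite E.
have zero y : tree_cone S' y -> dot a y = 0.
  by move=> cy; rewrite dota big1 // => p Tp; apply: tight.
exists a; apply/seteqP; split=> y.
  move=> cy; split; first exact: contraction_cone cy.
  move=> z cz; rewrite (zero y cy) dota; apply: sumr_le0 => p Tp; exact: le0.
move=> [cy my]; apply: hx => // i k ik xik.
have Tik : T (i, k) by rewrite /T /= ik xik eqxx.
have := my x (contraction_cone sS SS' cx); rewrite (zero x cx) dota.
rewrite (bigD1 (i, k)) //= => h.
apply/eqP; rewrite -subr_eq0 eq_le (le0 y (i, k)) //=.
apply: (Order.POrderTheory.le_trans h); rewrite gerDl; apply: sumr_le0 => p /andP[Tp _].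
exact: le0.
Qed.

End Faces.

(** * The quotient fan *)

Section ClassCone.

Variables (R : realType) (n : nat) (e : rel 'S_n).
Hypothesis e_congr : lattice_congruence e.
Hypothesis e_simple : simple_congruence e.
Hypothesis e_ess : essential e.
Implicit Types (s t : 'S_n) (i j k a b p q v w : 'I_n).
Local Notation vec := 'rV[R]_n.
Local Notation U := (up_ok e).
Local Notation D := (down_ok e).

Definition pos s v : nat := s^-1%g v.

Lemma pos_inj s : injective (pos s).
Proof. by move=> v w /val_inj/perm_inj. Qed.

Lemma pos_le s v : pos s v <= n.
Proof. exact/ltnW/ltn_ord. Qed.

Definition class_tree s : digraph n := perm_tree U D (pos s).

Lemma class_tree_adm s : adm U D (class_tree s).
Proof. exact: perm_tree_adm (congruence_arc_relations e_congr e_ess) (@pos_inj s) (@pos_le s). Qed.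

Definition linear_ext (T : digraph n) t : Prop := forall i k,
  reach T (node_of T i) (node_of T k) -> i != k -> bef t i k.

Lemma linear_ext_class_tree s : linear_ext (class_tree s) s.
Proof.
move=> i k; rewrite !perm_tree_node perm_tree_reach; last exact: pos_inj.
by move=> ik ne; apply: (tle_lt (@pos_inj s) ik ne).
Qed.

Lemma drop_inv_outside t t' a b u j : drop_inv t t' a b -> (u = t \/ u = t') ->
  j != a -> j != b -> bef u j a = bef t j b /\ bef u j b = bef t j b.
Proof.
move=> d ut ja jb; have [ab tba tt'] := d; have E := drop_inv_adjacent d ja jb.
have out x : (x == a) || (x == b) -> bef t' j x = bef t j x.
  move=> xab; have jx : j != x by case/orP: xab => /eqP->.
  case: (ltngtP j x) => [jx'|xj|/val_inj E']; last by rewrite E' eqxx in jx.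
    have xj : x != j by rewrite eq_sym.
    rewrite -(befC t' xj) -(befC t xj); congr (~~ _).
    by rewrite tt' // (negPf ja) andbF andbT.
  by rewrite tt' // (negPf jb) andbT.
by case: ut => ->; rewrite ?out ?eqxx ?orbT // E.
Qed.

Section OneTree.

Variable T : digraph n.
Hypothesis aT : adm U D T.
Hypothesis discrete : forall i, node_of T i = [set i].

Let tT : is_tree T := sst_tree (adm_sst aT).

Lemma discrete_inj i k : node_of T i = node_of T k -> i = k.
Proof. by rewrite !discrete => /set1_inj. Qed.

(** Crossing an edge of the tree leaves the class, because the mandatory arc of that
edge is the arc of the cover relation. *)
Lemma contracted_incomparable t t' a b u : has_arc t t' a b (fun j => bef t j b) ->
  e t t' -> linear_ext T u -> (u = t \/ u = t') ->
  ~~ reach T (node_of T a) (node_of T b) && ~~ reach T (node_of T b) (node_of T a).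
Proof.
move=> [d _] ett' lu ut; have [ab tba tt'] := d.
have ne : a != b := lt_ne ab.
have beft j : j != a -> j != b -> bef u j a = bef t j b /\ bef u j b = bef t j b.
  exact: drop_inv_outside d ut.
have adj_u j : j != a -> j != b -> bef u j a = bef u j b.
  by move=> ja jb; have [-> ->] := beft j ja jb.
rewrite -negb_or; apply/negP => comp.
have edge : adj T (node_of T a) (node_of T b).
  have main v w : (v = a /\ w = b) \/ (v = b /\ w = a) ->
      reach T (node_of T v) (node_of T w) -> dedge T (node_of T v) (node_of T w).
    move=> vw rvw; have vw' : v != w by case: vw => -[-> ->]; rewrite // eq_sym.
    have nN : node_of T v != node_of T w by apply: contra vw' => /eqP/discrete_inj->.
    have [Q [vQ _ Qw]] := reach_first rvw nN.
    have /andP[_ QV] := tree_edge_nodes tT vQ.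
    have [z Ez] := node_neq0 tT QV; rewrite -Ez in vQ Qw.
    have zv : z != v by apply: contraTneq vQ => ->; apply: tree_irr.
    case: (eqVneq z w) => [<- //|zw].
    have b1 := lu v z (reach1 vQ); have b2 := lu z w Qw zw.
    rewrite eq_sym in b1; have {}b1 := b1 zv.
    have E : bef u z v = bef u z w.
      by case: vw zv zw => -[-> ->] h1 h2; rewrite (adj_u z).
    by have := bef_asym b1; rewrite E b2.
  by case/orP: comp => /main h; rewrite /adj; [rewrite h ?orbT //; left | rewrite h ?orbT //; right].
have aN := mem_node tT a; have bN := mem_node tT b.
have close j : btw a b j -> (j \notin node_of T a) && (j \notin node_of T b).
  rewrite !discrete !inE !neq_ord; rewrite /btw; clear; lia.
have edge' : (node_of T a == node_of T b) || adj T (node_of T a) (node_of T b).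
  by rewrite edge orbT.
have g := adm_mandatory aT (node_in tT a) (node_in tT b) aN bN ne edge' close.
pose A j := reach T (node_of T j) (node_of T a) || reach T (node_of T j) (node_of T b).
have arcA : has_arc t t' a b A.
  split=> // j /andP[aj jb].
  have [ja jb'] : j != a /\ j != b by rewrite gt_ne // lt_ne.
  have bj : btw a b j by rewrite btw_lt // aj.
  have [_ <-] := beft j ja jb'; apply/idP/idP => [|].
    by case/orP => /lu h; [rewrite -adj_u //; apply: h | apply: h].
  apply: contraTT => nA; have := adj_btw (adm_sst aT) (node_in tT a) (node_in tT b)
    edge' aN bN close bj; rewrite -/(A j) (negPf nA) => /esym/negbFE/orP[] /lu h.
    rewrite -adj_u //; apply/bef_asym/h; by rewrite eq_sym.
  by apply/bef_asym/h; rewrite eq_sym.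
by have := (mem_congruence_good e_congr e_simple A ab).2 g;
  rewrite (mem_congruence_arcs e_congr arcA) ett'.
Qed.

(** Conversely, an arc of the congruence between the two exchanged values would make them
comparable, by [good_comparable]. *)
Lemma incomparable_contracted t t' a b u : drop_inv t t' a b ->
  linear_ext T u -> (u = t \/ u = t') ->
  ~~ reach T (node_of T a) (node_of T b) -> ~~ reach T (node_of T b) (node_of T a) ->
  e t t'.
Proof.
move=> d lu ut nab nba; have [ab _ _] := d.
have h : has_arc t t' a b (fun j => bef t j b) by split.
apply/negPn; rewrite -(mem_congruence_arcs e_congr h); apply/negP => inA.
have g := (mem_congruence_good e_congr e_simple _ ab).1 inA.
have ne j : btw a b j -> j != a /\ j != b.
  by rewrite btw_lt // => /andP[aj jb]; rewrite gt_ne // lt_ne.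
have comp : reach T (node_of T a) (node_of T b) || reach T (node_of T b) (node_of T a).
  apply: (good_comparable aT g) => j bj _ ja; have [nja njb] := ne j bj;
    have [E _] := drop_inv_outside d ut nja njb.
    by rewrite /= -E; apply: lu.
  by rewrite /= -E; apply/bef_asym/lu => //; rewrite eq_sym.
by rewrite (negPf nab) (negPf nba) in comp.
Qed.

Lemma class_linear_ext s t : linear_ext T s -> e s t -> linear_ext T t.
Proof.
move=> ls; apply: cong_ind => // {t} t t' a b h ett'.
have [d _] := h; have [ab tba tt'] := d.
(* the two permutations disagree on a and b only *)
have agree (u u' : 'S_n) :
      (u = t /\ u' = t') \/ (u = t' /\ u' = t) -> linear_ext T u -> linear_ext T u'.
  move=> uv lu i k ik ne; have ui := lu i k ik ne.
  have ut : u = t \/ u = t' by case: uv => -[-> _]; [left|right].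
  have /andP[nab nba] := contracted_incomparable h ett' lu ut.
  have not_ab : ~~ ((i == b) && (k == a)) by apply: contra nba => /andP[/eqP<- /eqP<-].
  have not_ba : ~~ ((i == a) && (k == b)) by apply: contra nab => /andP[/eqP<- /eqP<-].
  have E : bef t i k = bef t' i k.
    case: (ltngtP i k) => [ik'|ki|/val_inj E]; last by rewrite E eqxx in ne.
      have ki : k != i by rewrite eq_sym.
      rewrite -(befC t ki) -(befC t' ki); congr (~~ _).
      by rewrite tt' // [(k == b) && _]andbC not_ba andbT.
    by rewrite tt' // not_ab andbT.
  by case: uv ui => -[-> ->]; rewrite E.
by split; apply: agree; [left|right].
Qed.

Lemma linear_ext_class s t : linear_ext T s -> linear_ext T t -> e s t.
Proof.
move=> ls; have [m] := ubnP #|[set p : 'I_n * 'I_n | bef t p.1 p.2 && bef s p.2 p.1]|.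
elim: m t => // m IH t hm lt.
case: (eqVneq t s) => [->|ts]; first exact: cong_refl.
have [v [w [tvw no swv]]] := adjacent_disagreement ts.
have vw : v != w by apply: contraTneq tvw => ->; rewrite bef_irr.
have nvw : ~~ reach T (node_of T v) (node_of T w).
  by apply/negP => /ls/(_ vw)/bef_asym; rewrite swv.
have nwv : ~~ reach T (node_of T w) (node_of T v).
  apply/negP => /lt; rewrite eq_sym vw => /(_ isT)/bef_asym; by rewrite tvw.
have ett : e t (swap t v w).
  case: (ltngtP v w) => [lvw|lwv|/val_inj E]; last by rewrite E eqxx in vw.
    rewrite cong_sym //; apply: (incomparable_contracted (swap_raise lvw tvw no) lt) => //.
    by right.
  by apply: (incomparable_contracted (swap_drop lwv tvw no) lt) => //; left.
have lt' := class_linear_ext lt ett.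
apply: (cong_trans e_congr) (_ : e s (swap t v w)) _; last by rewrite cong_sym.
apply: IH => //; rewrite ltnS in hm; apply: leq_trans hm; apply: proper_card; apply/properP; split.
  apply/subsetP => -[i k]; rewrite !inE /= bef_swap //.
  case: ifP => // _; case: ifP => // /andP[/eqP-> /eqP->].
  by move=> /andP[_ /bef_asym]; rewrite swv.
exists (v, w); rewrite !inE /= ?tvw //.
by rewrite bef_swap // !eqxx.
Qed.

Local Open Scope ring_scope.

Lemma perm_coneP t (x : vec) :
  perm_cone t x <-> forall i k, bef t i k -> x ord0 i <= x ord0 k.
Proof.
split=> [h i k tik|h p q].
  by have := h (t^-1 i)%g (t^-1 k)%g (ltnW tik); rewrite !permKV.
rewrite leq_eqVlt => /orP[/eqP/val_inj-> //|pq]; apply: h.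
by rewrite /bef !permK.
Qed.

Lemma sorting_perm (x : vec) s : exists t, forall v w,
  bef t v w = (x ord0 v < x ord0 w) || (x ord0 v == x ord0 w) && bef s v w.
Proof.
apply: perm_of_lt => [v|v u w|v w vw].
- by rewrite ltxx bef_irr andbF.
- case/orP => [uv|/andP[/eqP-> uv]]; case/orP => [vw|/andP[/eqP<- vw]].
  + by rewrite (lt_trans uv vw).
  + by rewrite uv.
  + by rewrite vw.
  + by rewrite eqxx (bef_trans uv vw) orbT.
- by case: (ltgtP (x ord0 v) (x ord0 w)) => //= _; apply: bef_total.
Qed.

(** A point of the cone of the tree is sorted by a linear extension of the tree, obtained
by breaking ties as in [s]. *)
Lemma class_cone_tree s : linear_ext T s -> class_cone e s = (tree_cone T : set vec).
Proof.
move=> ls; apply/seteqP; split=> x.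
  move=> [t est /perm_coneP tx] i k ik; case: (eqVneq i k) => [->//|ne].
  exact/tx/(class_linear_ext ls est).
move=> cx; have [t tP] := sorting_perm x s.
exists t; last first.
  apply/perm_coneP => i k; rewrite tP => /orP[/ltW//|/andP[/eqP-> _]]; exact: lexx.
apply: linear_ext_class => // i k ik ne; rewrite tP.
by have := cx i k ik; rewrite le_eqVlt => /orP[/eqP->|->//]; rewrite eqxx ls ?orbT.
Qed.

End OneTree.

Local Open Scope ring_scope.

Lemma class_coneE s : class_cone e s = (tree_cone (class_tree s) : set vec).
Proof.
have dis i : node_of (class_tree s) i = [set i] by apply: perm_tree_node.
exact: (class_cone_tree (class_tree_adm s) dis (@linear_ext_class_tree s)).
Qed.

Lemma point_in_class_cone (x : vec) : exists s, tree_cone (class_tree s) x.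
Proof.
have [t tP] := sorting_perm x 1%g.
exists t; rewrite -class_coneE; exists t; first exact: cong_refl.
apply/perm_coneP => i k; rewrite tP => /orP[/ltW//|/andP[/eqP-> _]]; exact: lexx.
Qed.

End ClassCone.

Section Isomorphism.

Variables (R : realType) (n : nat) (e : rel 'S_n).
Hypothesis e_congr : lattice_congruence e.
Hypothesis e_simple : simple_congruence e.
Hypothesis e_ess : essential e.
Local Notation vec := 'rV[R]_n.
Local Notation adme := (adm (up_ok e) (down_ok e)).
Local Open Scope classical_set_scope.

Let UD := congruence_arc_relations e_congr e_ess.

(** A permutation sorting a relative interior point of the cone of [S] determines a class
tree; [S] is the contraction of this tree at that point. *)
Lemma adm_class_tree S (x : vec) : adme S -> tree_relint S x ->
  exists s, contraction_le (class_tree e s) S /\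
    forall y : vec, tree_cone (class_tree e s) y ->
      (forall i k, dedge (class_tree e s) (node_of (class_tree e s) i) (node_of (class_tree e s) k) ->
         x ord0 i = x ord0 k -> y ord0 i = y ord0 k) -> tree_cone S y.
Proof.
move=> aS rx; have [s cx] := point_in_class_cone e_congr e_simple e_ess x.
have aT := class_tree_adm e_congr e_ess s.
have [S' [TS' rx' h]] := relint_contraction (adm_sst aT) cx.
have E := relint_unique aS (contraction_adm UD aT TS') rx rx'.
by exists s; rewrite E.
Qed.

Lemma tree_cone_fan S : adme S -> @quotient_fan R n e (tree_cone S).
Proof.
move=> aS; have [x rx] := tree_relint_exists R (sst_tree (adm_sst aS)).
have [s [TS h]] := adm_class_tree aS rx; exists s.
rewrite (class_coneE R e_congr e_simple e_ess).
exact: contraction_face (adm_sst (class_tree_adm e_congr e_ess s)) TS rx h.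
Qed.

Lemma fan_tree_cone C : @quotient_fan R n e C -> exists2 S, adme S & C = tree_cone S.
Proof.
move=> [s]; rewrite (class_coneE R e_congr e_simple e_ess) => FC.
have aT := class_tree_adm e_congr e_ess s.
have [S TS ->] := face_contraction (adm_sst aT) FC.
by exists S => //; apply: contraction_adm UD aT TS.
Qed.

Lemma contraction_le_cone S S' : adme S -> adme S' ->
  contraction_le S S' <-> (tree_cone S' : set vec) `<=` tree_cone S.
Proof.
move=> aS aS'; split=> [|sub]; first exact: contraction_cone (adm_sst aS).
have [x rx] := tree_relint_exists R (sst_tree (adm_sst aS')).
have [S'' [SS'' rx' _]] := relint_contraction (adm_sst aS) (sub x (tree_relint_cone rx)).
by rewrite (relint_unique aS' (contraction_adm UD aS SS'') rx rx').
Qed.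

Lemma quotient_fan_iso : poset_isomorphic (admissible_trees e) (@contraction_le n)
  (@quotient_fan R n e) (fun C D => D `<=` C).
Proof.
have admE S : admissible_trees e S <-> adme S by apply: admissibleP.
exists (fun S => tree_cone S : set vec); last first.
  by move=> S S' /admE aS /admE aS'; apply: contraction_le_cone.
split=> [S /admE|S S'|C]; first exact: tree_cone_fan.
- move=> /set_mem/admE aS /set_mem/admE aS' E.
  apply: (contraction_anti (adm_sst aS) (adm_sst aS')).
    by apply/contraction_le_cone => //; rewrite E.
  by apply/contraction_le_cone => //; rewrite E.
- by move=> /fan_tree_cone[S aS ->]; exists S => //; apply/admE.
Qed.

(** Taking normal cones is an antiisomorphism from the faces of [P] to the fan: a face is
recovered from its normal cone as the intersection of the faces maximizing the linear
forms of this cone. *)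
Lemma quotientope_iso (P : set vec) : quotientope e P ->
  poset_isomorphic (admissible_trees e) (@contraction_le n)
    (nonempty_faces P) (fun F G => F `<=` G).
Proof.
move=> [_ fanP]; have [f [fun_f inj_f surj_f] ord_f] := quotient_fan_iso.
pose face (N : set vec) : set vec := fun x => forall a, N a -> maximizers P a x.
have faceK F : nonempty_faces P F -> face (normal_cone P F) = F.
  move=> [_ [a EF]]; apply/seteqP; split=> x; last by move=> Fx b; apply.
  by move=> h; rewrite EF; apply: h => y; rewrite EF.
have coneK N : normal_fan P N -> nonempty_faces P (face N) /\ normal_cone P (face N) = N.
  by move=> [F FF <-]; rewrite faceK.
have coneS F G : nonempty_faces P F -> nonempty_faces P G ->
    F `<=` G <-> normal_cone P G `<=` normal_cone P F.
  move=> FF GG; split=> [FG a aG x /FG/aG //|h].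
  by rewrite -(faceK _ FF) -(faceK _ GG) => x hx a /h; apply: hx.
have fN S : admissible_trees e S -> normal_fan P (f S).
  by move=> aS; rewrite fanP; apply: fun_f.
exists (fun S => face (f S)); last first.
  move=> S S' aS aS'; apply: (iff_trans (ord_f S S' aS aS')).
  have [[FS ES] [FS' ES']] := (coneK _ (fN _ aS), coneK _ (fN _ aS')).
  have h := coneS _ _ FS FS'; rewrite ES ES' in h; exact: iff_sym h.
split=> [S aS|S S'|F FF].
- exact: (coneK _ (fN _ aS)).1.
- move=> aS aS' E; apply: inj_f => //.
  move/set_mem in aS; move/set_mem in aS'.
  by rewrite -(coneK _ (fN _ aS)).2 E (coneK _ (fN _ aS')).2.
- have : quotient_fan e (normal_cone P F) by rewrite -fanP; exists F.
  move=> /surj_f[S aS E]; exists S => //.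
  by rewrite /= E faceK.
Qed.

End Isomorphism.

Theorem corollary4p20 (R : realType) (n : nat) (e : rel 'S_n)
    (e_congr : lattice_congruence e) (e_simple : simple_congruence e)
    (e_ess : essential e) :
  (forall P : set 'rV[R]_n, quotientope e P ->
     poset_isomorphic (admissible_trees e) (@contraction_le n)
       (nonempty_faces P) (fun F G => (F `<=` G)%classic)) /\
  poset_isomorphic (admissible_trees e) (@contraction_le n)
    (@quotient_fan R n e) (fun C D => (D `<=` C)%classic).
Proof.
split; first by move=> P; apply: quotientope_iso.
exact: quotient_fan_iso.
Qed.
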